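(* Let $W$ be a finite Coxeter group of type $A$ (i.e. $W=S_n$, type $A_{n-1}$) or of type $B$ (i.e. $W=B_n$), with Coxeter diagram $G$. Then for every orientation $\vec G$ of $G$, the Cambrian fan $\mathcal F(\vec G)$ is combinatorially isomorphic to the normal fan of the generalized associahedron for $W$.
   Context: A Coxeter system $(W,S)$ has Coxeter diagram $G$: vertex set $S$, with an edge labeled $m(s,t)$ (the order of $st$) between $s\neq t$ whenever $m(s,t)>2$. An orientation $\vec G$ of $G$ is a directed graph on $S$ with exactly one directed edge for each edge of $G$ (keeping labels). The (right) weak order on $W$ is the partial order $v\le w$ iff $I(v)\subseteq I(w)$, where $I(w)$ is the set of reflections $t$ (conjugates of elements of $S$) with $\ell(tw)<\ell(w)$; for finite $W$ it is a lattice. The Cambrian congruence $\Theta(\vec G)$ is the smallest lattice congruence of the weak order on $W$ such that for every directed edge $s\to t$ of $\vec G$, the element $t$ is congruent to the element represented by the alternating word $tsts\cdots$ with $m(s,t)-1$ letters. Realize $W$ as a finite reflection group in $\mathbb R^n$; the reflecting hyperplanes cut $\mathbb R^n$ into regions (closures of components of the complement), and fixing a base region $B$ the map $w\mapsto wB$ is a bijection from $W$ to the regions; the regions and all their faces form the Coxeter fan $\mathcal F$. For a lattice congruence $\Theta$ of the weak order, $\mathcal F_\Theta$ denotes the complete fan whose maximal cones are the unions, over each $\Theta$-class, of the corresponding regions (together with all faces of these cones). The Cambrian fan is $\mathcal F(\vec G):=\mathcal F_{\Theta(\vec G)}$. The generalized associahedron for $W$ (Chapoton–Fomin–Zelevinsky)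 is, in type $A_{n-1}$, the classical associahedron (faces correspond to partial triangulations of a convex $(n+2)$-gon, ordered by reverse inclusion), and in type $B_n$, the cyclohedron (faces correspond to centrally symmetric partial triangulations of a centrally symmetric $(2n+2)$-gon, ordered by reverse inclusion). Two fans are combinatorially isomorphic if their posets of cones are isomorphic. *)

(* Defs.v *)
From HB Require Import structures.
From mathcomp Require Import all_boot all_order all_algebra all_fingroup.
From mathcomp Require Import reals.

Set Implicit Arguments.
Unset Strict Implicit.
Unset Printing Implicit Defensive.

Import Order.TTheory GRing.Theory Num.Theory.

Section Coxeter.
Variables (gT : finGroupType) (W S : {set gT}).

Definition wordlen (k : nat) (w : gT) : bool :=
  [exists t : k.-tuple gT, all (mem S) t && ((\prod_(x <- t) x)%g == w)].

(* Coxeter length: minimal length of an S-word for w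
   (every element of W has length < #|W|) *)
Definition coxlen (w : gT) : nat :=
  \big[minn/#|W|]_(k < #|W| | wordlen k w) (k : nat).

Definition refl : {set gT} := [set (s ^ w)%g | s in S, w in W].

Definition invset (w : gT) : {set gT} :=
  [set t in refl | coxlen (t * w)%g < coxlen w].

Definition weak_le (v w : gT) : bool := invset v \subset invset w.

Definition is_meet (x y m : gT) : bool :=
  [&& m \in W, weak_le m x, weak_le m y &
      [forall z in W, (weak_le z x && weak_le z y) ==> weak_le z m]].

Definition is_join (x y j : gT) : bool :=
  [&& j \in W, weak_le x j, weak_le y j &
      [forall z in W, (weak_le x z && weak_le y z) ==> weak_le j z]].

Definition lattice_congr (Th : gT -> gT -> Prop) : Prop :=
  [/\ (forall x, x \in W -> Th x x),
      (forall x y, Th x y -> Th y x),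
      (forall x y z, Th x y -> Th y z -> Th x z),
      (forall x y z m1 m2, x \in W -> y \in W -> z \in W -> Th x y ->
          is_meet x z m1 -> is_meet y z m2 -> Th m1 m2) &
      (forall x y z j1 j2, x \in W -> y \in W -> z \in W -> Th x y ->
          is_join x z j1 -> is_join y z j2 -> Th j1 j2)].

Definition mcox (s t : gT) : nat := #[(s * t)%g]%g.

Fixpoint alt (a b : gT) (k : nat) : gT :=
  if k is k'.+1 then (a * alt b a k')%g else 1%g.

(* orientation of the Coxeter diagram: o s t means a directed edge s -> t *)
Definition is_orientation (o : rel gT) : Prop :=
  (forall s t, o s t -> [/\ s \in S, t \in S, s != t & 2 < mcox s t]) /\
  (forall s t, s \in S -> t \in S -> s != t -> 2 < mcox s t ->
     o s t != o t s).

Definition camb (o : rel gT) (x y : gT) : Prop :=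
  forall Th, lattice_congr Th ->
    (forall s t, o s t -> Th t (alt t s (mcox s t).-1)) -> Th x y.

Variables (R : realType) (n : nat) (act : gT -> 'rV[R]_n -> 'rV[R]_n)
          (B : 'rV[R]_n -> Prop).

Definition dotp (a x : 'rV[R]_n) : R := (\sum_(i < n) a ord0 i * x ord0 i)%R.

Definition region (w : gT) : 'rV[R]_n -> Prop :=
  fun y => exists2 x, B x & y = act w x.

Definition camb_maxcone (o : rel gT) (w : gT) : 'rV[R]_n -> Prop :=
  fun y => exists w', [/\ w' \in W, camb o w w' & region w' y].

Definition face_of (C D : 'rV[R]_n -> Prop) : Prop :=
  exists a : 'rV[R]_n, (forall x, C x -> (0 <= dotp a x)%R) /\
                       (forall x, D x <-> C x /\ dotp a x = 0%R).

Definition camb_fan_cone (o : rel gT) (D : 'rV[R]_n -> Prop) : Prop :=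
  exists2 w, w \in W & face_of (camb_maxcone o w) D.

End Coxeter.

Definition pt_sub (R : realType) n (C D : 'rV[R]_n -> Prop) : Prop :=
  forall x, C x -> D x.

Definition poset_iso (A : Type) (R : realType) n (P : A -> Prop)
  (leA : A -> A -> Prop) (Q : ('rV[R]_n -> Prop) -> Prop) : Prop :=
  exists f : A -> ('rV[R]_n -> Prop),
    [/\ (forall a, P a -> Q (f a)),
        (forall C, Q C -> exists a, P a /\ forall x, f a x <-> C x) &
        (forall a1 a2, P a1 -> P a2 -> (leA a1 a2 <-> pt_sub (f a1) (f a2)))].

(* Vertices of the convex N-gon are 0..N-1 in cyclic order.            *)
Definition is_diag (N : nat) (d : 'I_N * 'I_N) : bool :=
  [&& d.1 < d.2, (d.1 : nat).+1 != d.2 & ~~ ((d.1 == 0 :> nat) && (d.2 == N.-1 :> nat))].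

Definition crossing (N : nat) (d e : 'I_N * 'I_N) : bool :=
  ((d.1 < e.1) && (e.1 < d.2) && (d.2 < e.2)) ||
  ((e.1 < d.1) && (d.1 < e.2) && (e.2 < d.2)).

Definition partial_tri (N : nat) (T : {set 'I_N * 'I_N}) : Prop :=
  (forall d, d \in T -> is_diag d) /\
  (forall d e, d \in T -> e \in T -> ~~ crossing d e).

Definition rot_half (N i : nat) : nat := (i + N./2) %% N.

(* T is invariant under the half-turn (diagonals stored as (min, max)) *)
Definition cs_partial_tri (N : nat) (T : {set 'I_N * 'I_N}) : Prop :=
  partial_tri T /\
  (forall d, d \in T -> exists2 e, e \in T &
     let a := rot_half N d.1 in let b := rot_half N d.2 in
     ((e.1 : nat), (e.2 : nat)) = (minn a b, maxn a b)).

(* Face poset of the (generalized) associahedron: faces <-> partial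
   triangulations, ordered by reverse inclusion. *)
Definition assoc_face_le (N : nat) (T1 T2 : {set 'I_N * 'I_N}) : Prop :=
  T2 \subset T1.

(* Poset of cones of the normal fan of a full-dimensional polytope:
   nonempty face F |-> normal cone N_F, with N_F <= N_G iff G <= F. *)
Definition normal_fan_le (N : nat) (T1 T2 : {set 'I_N * 'I_N}) : Prop :=
  assoc_face_le T2 T1.

Definition WA (n : nat) : {set {perm 'I_n}} := [set: {perm 'I_n}].

Definition SA (n : nat) : {set {perm 'I_n}} :=
  [set s | [exists i : 'I_n, exists j : 'I_n,
              ((j : nat) == i.+1) && (s == tperm i j)]].

Definition actA (R : realType) n (w : {perm 'I_n}) (x : 'rV[R]_n) : 'rV[R]_n :=
  \row_j x ord0 (w j).

Definition baseA (R : realType) n (x : 'rV[R]_n) : Prop :=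
  (\sum_(i < n) x ord0 i = 0)%R /\ (forall i j : 'I_n, i <= j -> (x ord0 i <= x ord0 j)%R).

(* Type B_n: signed permutations, as permutations of {+-1..+-n}        *)
(* ('I_n * bool, the bool being the sign) commuting with negation.     *)
Definition negT n (x : 'I_n * bool) : 'I_n * bool := (x.1, ~~ x.2).

Definition WB (n : nat) : {set {perm 'I_n * bool}} :=
  [set w : {perm 'I_n * bool} | [forall x, w (negT x) == negT (w x)]].

Definition SB (n : nat) : {set {perm 'I_n * bool}} :=
  [set s | [exists i : 'I_n, ((i : nat) == 0) && (s == tperm (i, false) (i, true))]]
  :|: [set s | [exists i : 'I_n, exists j : 'I_n, ((j : nat) == i.+1) &&
         (s == (tperm (i, false) (j, false) * tperm (i, true) (j, true))%g)]].

Definition actB (R : realType) n (w : {perm 'I_n * bool}) (x : 'rV[R]_n)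
  : 'rV[R]_n :=
  \row_j (let k := w (j, false) in if k.2 then (- x ord0 k.1)%R else x ord0 k.1).

Definition baseB (R : realType) n (x : 'rV[R]_n) : Prop :=
  (forall i : 'I_n, (i : nat) == 0 -> (0 <= x ord0 i)%R) /\
  (forall i j : 'I_n, i <= j -> (x ord0 i <= x ord0 j)%R).

(* Main.v *)
Require Import Defs.
From HB Require Import structures.
From mathcomp Require Import all_boot all_order all_algebra all_fingroup.
From mathcomp Require Import reals boolp cyclic.
From mathcomp Require Import zify.

(** Identify [W] with permutations of [N] labels ([N = n], resp. [N = 2n] with
    central symmetry) and place the labels, from left to right, as the inner
    vertices of an [(N+2)]-gon; the orientation of the edge at a label decides
    whether the label lies on the upper or on the lower hull.  Reading the labels
    in the order given by [w], the prefixes bound monotone paths of chords, which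
    sweep out a triangulation [T(w)].  A chord belongs to [T(w)] iff the
    labels of one family ([pre]) all come before those of another one ([post]).

    Two elements are Cambrian congruent iff [T(x) = T(y)].  On the one hand,
    equality of triangulations is a lattice congruence, since its classes have least
    elements whose inversions are the forced inversions of the class, and it
    identifies the generators.  On the other hand, any lattice congruence
    identifying the generators contracts every cover along which an inversion
    that is not forced disappears, so that each element is congruent to the
    bottom of its class.

    Define [T(y)] in the same way for a real vector [y].  Modulo constants, [y] is
    a nonnegative combination of the vectors [- 1_K(d)], where [K(d)] is the set of
    labels below [d], and the chords [d] with a nonzero coefficient are those of
    [T(y)].  Hence the maximal cone of [w] is the set of vectors [y] with [T(y)]
    included in [T(w)], and its faces correspond to the (in type B, symmetric)
    subsets of [T(w)]. *)

Set Implicit Arguments.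
Unset Strict Implicit.
Unset Printing Implicit Defensive.

(** * Chords of the polygon *)

(** The geometric part rests on one fact: each chord of [T(w)] has two labels [i] and [j] that lie
    on different sides of this chord and on the same side of every other chord of [T(w)]. Hence the
    coefficient of the chord in a decomposition of [y] is the difference [y j - y i]. This yields
    uniqueness of decompositions, maximality of triangulations and the functionals that cut out
    faces. The obstacle is the contraction in type B. Joining a generator at a lower label [e] with
    a reversal of blocks inverts everything in sight except certain pairs ending at [e] or starting
    at its mirror image [r]. The element to be contracted must avoid these pairs, which forces a
    case distinction on the places of [e] among the labels and among the positions. *)

Section Chords.
Variable up : nat -> bool.

(* Vertices are numbered from left to right, [up v] meaning that [v] is on the
   upper hull.  For the chord joining [p < q], [below] collects the vertices on
   its lower side, where the endpoints on the upper hull count as lower and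
   conversely; [pre] and [post] are the vertices [v] with [p <= v <= q] that are
   below, resp. not below. *)
Definition pre (p q v : nat) : bool :=
  [|| up p && (v == p), up q && (v == q) | [&& ~~ up v, p < v & v < q]].
Definition post (p q v : nat) : bool :=
  [|| ~~ up p && (v == p), ~~ up q && (v == q) | [&& up v, p < v & v < q]].
Definition below (p q v : nat) : bool :=
  [|| up p && (v <= p), up q && (q <= v) | [&& ~~ up v, p < v & v < q]].

(* Crossing of chords, in terms of the horizontal order: in the first two cases the
   ranges of the chords overlap, in the last two one contains the other. *)
Definition vcross (p q r s : nat) : bool :=
  [|| [&& p < r, r < q, q < s & up r == up q],
      [&& r < p, p < s, s < q & up p == up s],
      [&& p < r, r < s, s < q & up r != up s] |
      [&& r < p, p < q, q < s & up p != up q]].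

(** Congruence of [up] in disjunctive form, so that [lia], which sees [up u] and [up v] as unrelated
    atoms, can exploit equal vertices. *)
Lemma up_eq u v : (u != v) || (up u == up v).
Proof. by case: eqVneq => // ->; rewrite eqxx. Qed.

(** Consequently a positive multiple of a chord that does not cross [p q] never spoils an inequality
    between a [pre] and a [post] label of [p q]. *)
Lemma noncross_below p q r s i j : p < q -> r < s -> ~~ vcross p q r s ->
  pre p q i -> post p q j -> below r s j -> below r s i.
Proof.
move=> pq rs; rewrite /vcross /pre /post /below.
have := up_eq i r; have := up_eq i s; have := up_eq j r; have := up_eq j s.
have := up_eq p r; have := up_eq p s; have := up_eq q r; have := up_eq q s.
have := up_eq i p; have := up_eq i q; have := up_eq j p; have := up_eq j q.
have := up_eq i j. lia.
Qed.

(* The witnesses have to appear in both orders, hence crossing chords cannot lie in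
   the triangulation of the same permutation. *)
Lemma cross_witness p q r s : p < q -> r < s -> vcross p q r s ->
  exists i j, [/\ p <= i <= q, r <= i <= s, p <= j <= q & r <= j <= s] /\
   [/\ pre p q i, post r s i, post p q j & pre r s j].
Proof.
move=> pq rs; rewrite /vcross /pre /post => /or4P[] /and4P[a b c].
- case E: (up r); case F: (up q) => // _.
  + exists q, r; rewrite E F; do !split; lia.
  + exists r, q; rewrite E F; do !split; lia.
- case E: (up p); case F: (up s) => // _.
  + exists p, s; rewrite E F; do !split; lia.
  + exists s, p; rewrite E F; do !split; lia.
- case E: (up r); case F: (up s) => // _.
  + exists s, r; rewrite E F; do !split; lia.
  + exists r, s; rewrite E F; do !split; lia.
- case E: (up p); case F: (up q) => // _.
  + exists p, q; rewrite E F; do !split; lia.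
  + exists q, p; rewrite E F; do !split; lia.
Qed.

(** A left label below the chord can be exchanged for a [pre] label that is not smaller: itself, or
    the endpoint [p] if it lies to the left of the chord. The next lemma does the same for the right
    label and [post]. *)
Lemma below_sep_pre p q i j : p < q -> i < j -> below p q i -> ~~ below p q j ->
  if p <= i then pre p q i && (i < q) else up p && (p < j).
Proof. by move=> pq ij; rewrite /below /pre; case: ifP; case: (up p); lia. Qed.

Lemma below_sep_post p q i j : p < q -> i < j -> below p q i -> ~~ below p q j ->
  if j <= q then post p q j && (p < j) else ~~ up q && (i < q).
Proof.
move=> pq ij; rewrite /below /post; have := up_eq p j.
by case: ifP; case: (up q); case: (up p); lia.
Qed.

Section PathBelow.
Variables (a : nat -> bool) (p q r s i j : nat).
Hypotheses (pq : p < q) (rs : r < s) (hi : pre p q i) (hj : post p q j).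
Hypothesis e1 : forall v, pre r s v -> a v.
Hypothesis e2 : forall v, post r s v -> ~~ a v.

(** By [e1] and [e2] the chord [r s] is on the path of the prefix [a]. The three lemmas treat a
    prefix containing [j], one missing [i], and one whose path also contains [p q]. Combined with
    [noncross_below], they place [i] and [j] on the same side of [r s]. *)
Lemma below_before : (forall v, pre p q v -> a v) -> a j ->
  below r s i -> below r s j.
Proof.
move=> d aj; have := @e2 j; have := @e2 r; have := @e2 s; have := @d r; have := @d s.
move: hi hj; rewrite aj /pre /post /below.
have := up_eq i r; have := up_eq i s; have := up_eq j r; have := up_eq j s.
clear -pq rs; case: (a r); case: (a s); lia.
Qed.

Lemma below_after : (forall v, post p q v -> ~~ a v) -> ~~ a i ->
  below r s i -> below r s j.
Proof.
move=> d /negbTE ai; have := @e1 i; have := @e1 r; have := @e1 s; have := @d r; have := @d s.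
move: hi hj; rewrite ai /pre /post /below.
have := up_eq i r; have := up_eq i s; have := up_eq j r; have := up_eq j s.
clear -pq rs; case: (a r); case: (a s); lia.
Qed.

Lemma below_same : (forall v, pre p q v -> a v) -> (forall v, post p q v -> ~~ a v) ->
  (p != r) || (q != s) -> below r s i -> below r s j.
Proof.
move=> d1 d2 ne.
have := @d1 r; have := @d2 r; have := @d1 s; have := @d2 s.
have := @d1 p; have := @d2 p; have := @d1 q; have := @d2 q.
have := @e1 p; have := @e2 p; have := @e1 q; have := @e2 q.
have := @e1 r; have := @e2 r; have := @e1 s; have := @e2 s.
move: hi hj ne; rewrite /pre /post /below.
have := up_eq i r; have := up_eq i s; have := up_eq j r; have := up_eq j s.
have := up_eq p r; have := up_eq p s; have := up_eq q r; have := up_eq q s.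
clear -pq rs.
case: (ltngtP p r) => [pr|rp|->].
- case: (a r); case: (up r); lia.
- case: (a p); case: (up p); lia.
case: (ltngtP q s) => [pr|rp|->].
- case: (a q); case: (up q); lia.
- case: (a s); case: (up s); lia.
by rewrite !eqxx.
Qed.
End PathBelow.

End Chords.

(** * Paths of sets of labels and the count of their steps *)

Section Paths.
Variables (N : nat) (up a : nat -> bool).

(* The path of the set of labels [a]: it passes through the elements of [a] on the
   upper hull and the elements outside [a] on the lower hull. *)
Definition onpath (v : nat) : bool :=
  [|| v == 0, v == N.+1 | [&& 0 < v, v <= N & up v == a v]].
Definition step (p q : nat) : bool :=
  [&& p < q, onpath p, onpath q &
      [forall v : 'I_(N + 2), (p < v < q) ==> ~~ onpath v]].

Lemma stepP p q : q < N + 2 ->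
  reflect [/\ p < q, onpath p, onpath q & forall v, p < v < q -> ~~ onpath v]
          (step p q).
Proof.
move=> qN; apply: (iffP and4P) => [][pq vp vq] h; split => //.
  move=> v vpq; have vN : v < N + 2 by lia.
  by have /forallP/(_ (Ordinal vN))/implyP := h; apply.
by apply/forallP => v; apply/implyP; apply: h.
Qed.

Lemma prev_onpath q : 0 < q < N + 2 ->
  exists p : 'I_(N + 2), [/\ p < q, onpath p & forall v, p < v < q -> ~~ onpath v].
Proof.
elim: q => // q IH hq; case E: (onpath q).
  have qN : q < N + 2 by lia.
  by exists (Ordinal qN); split => //= v; lia.
have q0 : 0 < q by case: q E {IH hq}.
have [|p [pq vp hp]] := IH; first by lia.
exists p; split => //; first by lia.
move=> v /andP[pv]; rewrite ltnS leq_eqVlt => /orP[/eqP->|vq]; first by rewrite E.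
by apply: hp; rewrite pv.
Qed.

Lemma next_onpath p : p < N.+1 ->
  exists q : 'I_(N + 2), [/\ p < q, onpath q & forall v, p < v < q -> ~~ onpath v].
Proof.
move=> hp; have [k hk] : exists k, k = N - p by exists (N - p).
elim: k p hp hk => [|k IH] p hp hk; case E: (onpath p.+1).
- have qN : p.+1 < N + 2 by lia.
  by exists (Ordinal qN); split => //= v; lia.
- by move: E; rewrite /onpath; lia.
- have qN : p.+1 < N + 2 by lia.
  by exists (Ordinal qN); split => //= v; lia.
have [||q [pq vq hq]] := IH p.+1; [lia|lia|].
exists q; split => //; first by lia.
move=> v /andP[]; rewrite leq_eqVlt => /orP[/eqP<-|pv] vq'; first by rewrite E.
by apply: hq; rewrite pv.
Qed.

Lemma onpath0 : onpath 0. Proof. by []. Qed.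

(** The in-degree and, below, the out-degree of a path vertex turn sums over steps into sums over
    vertices. *)
Lemma sum_step_col (q : 'I_(N + 2)) :
  \sum_(p < N + 2) step p q = ((0 < q) && onpath q).
Proof.
case: (posnP q) => [q0|qp] /=.
  by rewrite big1 // => p _; rewrite /step q0 ltn0.
case E: (onpath q); last first.
  by rewrite big1 // => p _; rewrite /step E !andbF.
have [|p [pq vp hp]] := @prev_onpath q; first by rewrite qp ltn_ord.
rewrite (bigD1 p) //= big1 ?addn0.
  by have -> : step p q by apply/stepP => //; split.
move=> r rp; case: (stepP _ (ltn_ord q)) => //.
case=> rq vr _ hr; case: (ltngtP r p) => [rp'|pr|/val_inj rp'].
- by have := hr p; rewrite rp' pq vp => /(_ isT).
- by have := hp r; rewrite pr rq vr => /(_ isT).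
- by rewrite rp' eqxx in rp.
Qed.

Lemma sum_step_row (p : 'I_(N + 2)) :
  \sum_(q < N + 2) step p q = ((p < N.+1) && onpath p).
Proof.
case: (ltnP p N.+1) => [pN|pN] /=; last first.
  by rewrite big1 // => q _; rewrite /step; have := ltn_ord q; lia.
case E: (onpath p); last first.
  by rewrite big1 // => q _; rewrite /step E !andbF.
have [q [pq vq hq]] := next_onpath pN.
rewrite (bigD1 q) //= big1 ?addn0.
  by have -> : step p q by apply/stepP => //; split.
move=> r rp; case: (stepP _ (ltn_ord r)) => //.
case=> rq _ vr hr; case: (ltngtP r q) => [rp'|pr|/val_inj rp'].
- by have := hq r; rewrite rp' rq vr => /(_ isT).
- by have := hr q; rewrite pr pq vq => /(_ isT).
- by rewrite rp' eqxx in rp.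
Qed.

Hypothesis up0 : up 0 = false.
Hypothesis upN : up N.+1 = false.

(** This links paths with triangulations: the chords of [T(w)] are the steps of the paths of the
    prefixes of [w]. *)
Lemma step_pre_post p q : p < q -> q < N + 2 ->
  step p q <-> (forall v, 0 < v <= N ->
                  (pre up p q v -> a v) /\ (post up p q v -> ~~ a v)).
Proof.
move=> pq qN; split.
  case/stepP=> // _ vp vq h v vN; have := h v; move: vp vq; rewrite /onpath.
  have := up_eq up v p; have := up_eq up v q.
  have := up_eq a v p; have := up_eq a v q.
  rewrite /pre /post; lia.
move=> h; apply/stepP => //; split=> //.
- have := h p; rewrite /onpath /pre /post; case: (posnP p) => // p0.
  by case: (up p) (a p) => [] [] /=; rewrite ?eqxx ?andbT /=; lia.
- have := h q; rewrite /onpath /pre /post; case: (eqVneq q N.+1) => [->|p0].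
    by rewrite orbT.
  by case: (up q) (a q) => [] [] /=; rewrite ?eqxx ?andbT ?orbT /=; lia.
- move=> v vpq; have := h v; rewrite /onpath /pre /post.
  by case: (up v) (a v) => [] [] /=; rewrite ?vpq ?andbT ?orbT /=; lia.
Qed.

(* A telescoping sum along the path: up to a constant, its chords decompose the
   indicator function of [a]. *)
Lemma sum_path_below x : 0 < x <= N ->
  \sum_(p < N + 2) \sum_(q < N + 2) (step p q && below up p q x) =
  a x + \sum_(v < N + 2) (onpath v && up v).
Proof.
move=> xN.
(* If a step passes over [x], then [x] is off the path and is below the step iff [a x] holds;
   otherwise the endpoint nearer to [x] decides. The indicator of [p < x < q] is the difference of
   those of [p < x] and [q <= x], whose negative term is moved to the left because the sums are in
   [nat]. *)
have E (p q : 'I_(N + 2)) : (step p q && below up p q x : nat) + a x * (step p q * (q <= x))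
   = a x * (step p q * (p < x)) + step p q * ((q <= x) && up q)
     + step p q * ((x <= p) && up p).
  case H: (step p q) => /=; last by rewrite !mul0n !muln0.
  have/stepP [|pq vp vq h] := H; first exact: ltn_ord.
  move: vp vq (h x); rewrite /below /onpath.
  have := up_eq up x p; have := up_eq up x q.
  have := up_eq a x p; have := up_eq a x q.
  by case: (a x); case: (up x); case: (up p); case: (up q); lia.
pose C (f : nat -> nat -> nat) := \sum_(p < N + 2) \sum_(q < N + 2) step p q * f p q.
have Csum : \sum_(p < N + 2) \sum_(q < N + 2) (step p q && below up p q x : nat)
   + a x * C (fun p q => q <= x) = a x * C (fun p q => p < x)
   + C (fun p q => (q <= x) && up q) + C (fun p q => (x <= p) && up p).
  rewrite /C !big_distrr -!big_split /=; apply: eq_bigr => p _.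
  by rewrite !big_distrr -!big_split /=; apply: eq_bigr => q _; apply: E.
have Crow (f : nat -> bool) : C (fun p q => f p) =
    \sum_(p < N + 2) ((p < N.+1) && onpath p && f p).
  apply: eq_bigr => p _; rewrite -big_distrl /= sum_step_row.
  by case: (_ && _) => //=; case: (f p).
have Ccol (f : nat -> bool) : C (fun p q => f q) =
    \sum_(q < N + 2) ((0 < q) && onpath q && f q).
  rewrite /C exchange_big; apply: eq_bigr => q _; rewrite -big_distrl /= sum_step_col.
  by case: (_ && _) => //=; case: (f q).
(* The vertex [0] starts a step without ending one, and [x], if on the path, ends a step counted on
   the right. *)
have V1 : C (fun p q => p < x) + onpath x = C (fun p q => q <= x) + 1.
  rewrite (Crow (fun p => p < x)) (Ccol (fun q => q <= x)).
  have xM : x < N + 2 by lia. have zM : 0 < N + 2 by lia.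
  have -> : (onpath x : nat) = \sum_(p < N + 2 | p == Ordinal xM) (onpath p : nat).
    by rewrite big_pred1_eq.
  rewrite [X in _ = _ + X](_ : _ = \sum_(p < N + 2 | p == Ordinal zM) (onpath p : nat));
    last by rewrite big_pred1_eq onpath0.
  rewrite !(big_mkcond (fun p => p == _)) -!big_split /=; apply: eq_bigr => p _.
  rewrite -!val_eqE /=; case: (onpath p); rewrite ?andbF //= ?andbT; last by case: ifP; case: ifP.
  have pM := ltn_ord p; do 2!case: eqP => ? /=; lia.
have V2 : C (fun p q => (q <= x) && up q) + C (fun p q => (x <= p) && up p)
   = (onpath x && up x) + \sum_(v < N + 2) (onpath v && up v).
  rewrite (Crow (fun p => (x <= p) && up p)) (Ccol (fun q => (q <= x) && up q)).
  have xM : x < N + 2 by lia.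
  have -> : (onpath x && up x : nat) =
    \sum_(p < N + 2 | p == Ordinal xM) (onpath p && up p : nat).
    by rewrite big_pred1_eq.
  rewrite !(big_mkcond (fun p => p == _)) -!big_split /=; apply: eq_bigr => p _.
  rewrite -!val_eqE /=; have := up_eq up p 0; have := up_eq up p N.+1.
  have := ltn_ord p; rewrite up0 upN.
  by case: (onpath p); case: (up p); rewrite ?andbF //= ?andbT => *; case: eqP => ? /=; lia.
have ox : onpath x = (up x == a x) by rewrite /onpath; lia.
move: V1 V2 Csum; rewrite ox.
by case: (a x); case: (up x); rewrite /= ?mul0n ?mul1n; lia.
Qed.

(** By [sum_path_below], [x] is below exactly one step more than [y] is. *)
Lemma path_separates x y : 0 < x <= N -> 0 < y <= N -> a x -> ~~ a y ->
  exists p q : 'I_(N + 2), [/\ p < q, step p q, below up p q x & ~~ below up p q y].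
Proof.
move=> xN yN ax ay.
have [/existsP[p /existsP[q /and3P[h1 h2 h3]]]|/existsPn H] := boolP
    [exists p : 'I_(N + 2), [exists q : 'I_(N + 2),
       [&& step p q, below up p q x & ~~ below up p q y]]].
  by exists p, q; split => //; have /and4P[] := h1.
have : \sum_(p < N + 2) \sum_(q < N + 2) (step p q && below up p q x) <=
   \sum_(p < N + 2) \sum_(q < N + 2) (step p q && below up p q y).
  apply: leq_sum => p _; apply: leq_sum => q _.
  have /existsPn/(_ q) := H p.
  by case: (step p q) (below up p q x) (below up p q y) => [] [] [].
by rewrite !sum_path_below // ax (negbTE ay); lia.
Qed.

End Paths.

(** * Permutations, weak order and the triangulation relation *)

Section Orders.
Variable N : nat.
Implicit Types (v w x y z m : 'S_N) (i j k : 'I_N).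

Lemma card_ltn_perm w i : #|[set j | w j < w i]| = w i.
Proof.
have -> : [set j | w j < w i] = w @^-1: [set k : 'I_N | k < w i].
  by apply/setP => j; rewrite !inE.
rewrite card_preimset; last exact: perm_inj.
rewrite cardsE -sum1_card (big_ord_narrow_cond (P := xpredT) (ltnW (ltn_ord (w i)))).
by rewrite sum1_card card_ord.
Qed.

Lemma perm_of_order (r : rel 'I_N) : irreflexive r -> transitive r ->
  (forall i j, i != j -> r i j || r j i) ->
  exists w, forall i j, (w i < w j) = r i j.
Proof.
move=> irr tr tot.
have lt i : #|[set j | r j i]| < N.
  rewrite -[X in _ < X]card_ord -cardsT; apply: proper_card.
  by rewrite properT; apply/eqP => /setP/(_ i); rewrite !inE irr.
pose f i := Ordinal (lt i).
have mono i j : r i j -> f i < f j.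
  move=> rij; apply: proper_card; apply/properP; split.
    by apply/subsetP => k; rewrite !inE => /tr; apply.
  by exists i; rewrite !inE ?irr.
have finj : injective f.
  move=> i j e; apply/eqP/negPn/negP => /tot/orP[]/mono; by rewrite e ltnn.
exists (perm finj) => i j; rewrite !permE; case E: (r i j); first exact: mono.
apply/negbTE; rewrite -leqNgt; case: (eqVneq i j) => [->//|/tot].
by rewrite E /= => /mono/ltnW.
Qed.

Lemma perm_order_eq w z : (forall i j, (w i < w j) = (z i < z j)) -> w = z.
Proof.
move=> h; apply/permP => i; apply: val_inj => /=.
by rewrite -(card_ltn_perm w) -(card_ltn_perm z); apply: eq_card => j; rewrite !inE h.
Qed.

(** The classical characterization of inversion sets as biclosed sets. Both [pid] and the joins are
    obtained from it. *)
Lemma perm_of_biclosed (F : rel 'I_N) :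
  (forall i j k, i < j -> j < k -> F i j -> F j k -> F i k) ->
  (forall i j k, i < j -> j < k -> F i k -> F i j || F j k) ->
  exists z, forall i j,
    (z i < z j) = if i < j then ~~ F i j else (j < i) && F j i.
Proof.
move=> tr sp.
apply: (@perm_of_order (fun i j => if i < j then ~~ F i j else (j < i) && F j i)).
- by move=> i; rewrite ltnn.
- move=> j i k; case: (ltngtP i j) => [ij|ji|_] //=.
  + case: (ltngtP j k) => [jk|kj|/val_inj<-] //=.
      move=> h1 h2; have -> : i < k by lia.
      by apply/negP => /(sp _ _ _ ij jk); rewrite (negbTE h1) (negbTE h2).
    move=> h1 h2; case: (ltngtP i k) => [ik|ki|/val_inj e] /=.
    * by apply: contra h1 => h1; apply: tr h1 h2.
    * by have := sp _ _ _ ki ij h2; rewrite (negbTE h1) orbF.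
    * by move: h2; rewrite -e (negbTE h1).
  + case: (ltngtP j k) => [jk|kj|/val_inj<-] //=.
      move=> h1 h2; case: (ltngtP i k) => [ik|ki|/val_inj e] /=.
      * by apply: contra h2 => h2; apply: tr h1 h2.
      * by have := sp _ _ _ jk ki h1; rewrite (negbTE h2).
      * by move: h1; rewrite e (negbTE h2).
    move=> h1 h2; have ki : k < i by lia.
    by rewrite ltnNge (ltnW ki) ki /=; apply: tr h2 h1.
- move=> i j; case: (ltngtP i j) => [_|_|/val_inj->] /=; last by rewrite eqxx.
    by rewrite orNb.
  by rewrite orbN.
Qed.

(* [w i] is the position of the label [i]; an inversion of [w] is a pair [i < j] of
   labels with [w j < w i]. *)
Definition wle v w := forall i j, i < j -> v j < v i -> w j < w i.

Lemma wle_trans y x z : wle x y -> wle y z -> wle x z.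
Proof. by move=> h1 h2 i j ij h; apply: h2 => //; apply: h1. Qed.

Lemma perm_lt_total w i j : i != j -> (w i < w j) = ~~ (w j < w i).
Proof.
move=> ij; rewrite -leqNgt ltn_neqAle andb_idl // => _.
by apply: contra ij => /eqP/val_inj/perm_inj->.
Qed.

Lemma wle_anti x y : wle x y -> wle y x -> x = y.
Proof.
move=> h1 h2; apply: perm_order_eq => i j; case: (ltngtP i j) => [ij|ij|/val_inj->].
- have ne : i != j by rewrite neq_ltn ij.
  by rewrite !(perm_lt_total _ ne); congr (~~ _); apply/idP/idP; [apply: h1|apply: h2].
- by apply/idP/idP; [apply: h1|apply: h2].
- by rewrite !ltnn.
Qed.

Definition symw w := [forall i, w (rev_ord i) == rev_ord (w i)].

Lemma symwP w : reflect (forall i, w (rev_ord i) = rev_ord (w i)) (symw w).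
Proof. by apply: (iffP forallP) => h i; apply/eqP. Qed.

Lemma symw_lt w i j : symw w -> (w (rev_ord j) < w (rev_ord i)) = (w i < w j).
Proof. by move=> /symwP h; rewrite !h /=; have := ltn_ord (w i); have := ltn_ord (w j); lia. Qed.

Lemma lt_symw w : (forall i j, w i < w j -> w (rev_ord j) < w (rev_ord i)) -> symw w.
Proof.
move=> h; apply/symwP.
have finj : injective (fun i => rev_ord (w (rev_ord i))).
  by move=> i j /rev_ord_inj/perm_inj/rev_ord_inj.
have e : perm finj = w.
  apply: perm_order_eq => i j; rewrite !permE /=.
  have H : w (rev_ord j) < w (rev_ord i) = (w i < w j).
    by apply/idP/idP => /h; rewrite ?rev_ordK.
  by rewrite -H; have := ltn_ord (w (rev_ord i)); have := ltn_ord (w (rev_ord j)); lia.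
by move=> i; rewrite -[in LHS]e permE rev_ordK.
Qed.

Variable sy : bool.
(** The flag [sy] selects type B, realized as the permutations commuting with [rev_ord]; without it,
    all permutations are allowed, as in type A. *)
Definition inW w := sy ==> symw w.

Definition ismeet x y m := [/\ inW m, wle m x, wle m y &
  forall z, inW z -> wle z x -> wle z y -> wle z m].
Definition isjoin x y m := [/\ inW m, wle x m, wle y m &
  forall z, inW z -> wle x z -> wle y z -> wle m z].

(* An antiautomorphism of the weak order, used to deduce joins from meets. *)
Definition rvp : 'S_N := perm (@rev_ord_inj N).
Definition rv x : 'S_N := (x * rvp)%g.

Lemma rvE x i : rv x i = rev_ord (x i).
Proof. by rewrite permM permE. Qed.

Lemma rvK : involutive rv.
Proof. by move=> x; apply/permP => i; rewrite !rvE rev_ordK. Qed.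

Lemma rv_lt x i j : (rv x i < rv x j) = (x j < x i).
Proof. by rewrite !rvE /=; have := ltn_ord (x i); have := ltn_ord (x j); lia. Qed.

Lemma rv_le x y : wle x y -> wle (rv y) (rv x).
Proof.
move=> h i j ij; rewrite !rv_lt; have ne : i != j by rewrite neq_ltn ij.
by rewrite !(perm_lt_total _ ne); apply: contra; apply: h.
Qed.

Lemma rv_inW x : inW x -> inW (rv x).
Proof.
rewrite /inW; case: sy => //= /symwP h.
by apply/symwP => i; rewrite !rvE h.
Qed.

Lemma rv_join x y m : isjoin x y m -> ismeet (rv x) (rv y) (rv m).
Proof.
case=> Wm xm ym h; split; [exact: rv_inW|exact: rv_le|exact: rv_le|].
move=> z Wz /rv_le zx /rv_le zy; rewrite -[z]rvK; apply: rv_le.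
by apply: h; [exact: rv_inW| move: zx | move: zy]; rewrite rvK.
Qed.

Section Tri.
Variable up : nat -> bool.

Definition tri (r : rel 'I_N) (p q : nat) : bool :=
  [forall i : 'I_N, forall j : 'I_N, pre up p q i.+1 ==> post up p q j.+1 ==> r i j].

Lemma triP (r : rel 'I_N) p q : reflect
  (forall i j, pre up p q i.+1 -> post up p q j.+1 -> r i j) (tri r p q).
Proof.
apply: (iffP forallP) => [h i j hi hj|h i].
  by have /forallP/(_ j)/implyP/(_ hi)/implyP := h i; apply.
by apply/forallP => j; apply/implyP => hi; apply/implyP; apply: h.
Qed.

Definition ordr w : rel 'I_N := fun i j => w i < w j.

Definition teq x y := forall p q, p < q -> q < N + 2 ->
  tri (ordr x) p q = tri (ordr y) p q.

Lemma teq_sym x y : teq x y -> teq y x.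
Proof. by move=> h p q pq qN; rewrite h. Qed.

Lemma teq_trans y x z : teq x y -> teq y z -> teq x z.
Proof. by move=> h1 h2 p q pq qN; rewrite h1 ?h2. Qed.

(* These are the inversions shared by all permutations having the same triangulation. *)
Definition forced x i j : bool := (i < j) &&
  [forall a : 'I_N, forall b : 'I_N, [&& i <= a, a < b, b <= j,
     (a == i) || up a.+1 & (b == j) || ~~ up b.+1] ==> (x b < x a)].

Lemma forcedP x i j : i < j -> reflect
  (forall a b : 'I_N, i <= a -> a < b -> b <= j -> (a == i) || up a.+1 ->
     (b == j) || ~~ up b.+1 -> x b < x a) (forced x i j).
Proof.
move=> ij; rewrite /forced ij /=; apply: (iffP forallP) => H a.
  move=> b h1 h2 h3 h4 h5; have /forallP/(_ b)/implyP := H a; apply.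
  by rewrite h1 h2 h3 h4.
by apply/forallP => b; apply/implyP => /and5P[]; apply: H.
Qed.

Lemma forced_inv x i j : forced x i j -> x j < x i.
Proof.
move=> fij; have ij : i < j by case/andP: fij.
by apply: (forcedP _ ij fij); rewrite ?eqxx.
Qed.

Lemma forced_trans x i j k : forced x i j -> forced x j k -> forced x i k.
Proof.
move=> fij fjk.
have ij : i < j by case/andP: fij. have jk : j < k by case/andP: fjk.
move/(forcedP _ ij): (fij) => h1; move/(forcedP _ jk): (fjk) => h2.
apply/forcedP; first lia; move=> a b ia ab bk ha hb.
case: (leqP b j) => bj.
  apply: h1 => //; case/orP: hb => [/eqP bk'|->]; last by rewrite orbT.
  by move: bj; rewrite bk'; lia.
case: (leqP j a) => ja.
  apply: h2 => //; case/orP: ha => [/eqP ak'|->]; last by rewrite orbT.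
  by move: ja; rewrite ak'; lia.
apply: (@ltn_trans (x j)); first by apply: h2 => //; rewrite ?eqxx //; lia.
by apply: h1 => //; rewrite ?eqxx //; lia.
Qed.

Lemma forced_split x i j k : i < j -> j < k -> forced x i k ->
  forced x i j || forced x j k.
Proof.
move=> ij jk fik; have ik : i < k by lia.
move/(forcedP _ ik): fik => h; apply/orP; case E: (up j.+1).
  right; apply/forcedP => // a b ja ab bk ha hb; apply: h => //; first lia.
  by case/orP: ha => [/eqP->|->]; rewrite ?E orbT.
left; apply/forcedP => // a b ja ab bk ha hb; apply: h => //; first lia.
by case/orP: hb => [/eqP->|->]; rewrite ?E orbT.
Qed.

Definition bforced x i j :=
  if i < j then ~~ forced x i j else (j < i) && forced x j i.

Lemma pid_exists x : exists z, forall i j, (z i < z j) = bforced x i j.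
Proof.
apply: perm_of_biclosed => i j k ij jk; first exact: forced_trans.
exact: forced_split.
Qed.
End Tri.
End Orders.

(** * Least elements of triangulation classes and compatibility with meets *)

Section PiDown.
Variables (N : nat) (up : nat -> bool).
Implicit Types (v w x y z m : 'S_N) (i j k : 'I_N).

(* The least element of the class of [x]. *)
Definition pid x : 'S_N :=
  odflt x [pick z : 'S_N | [forall i, forall j, (z i < z j) == bforced up x i j]].

Lemma pid_lt x i j : (pid x i < pid x j) = bforced up x i j.
Proof.
rewrite /pid; case: pickP => [z /forallP/(_ i)/forallP/(_ j)/eqP // | h].
have [z hz] := pid_exists up x; have /forallP[] := negbT (h z).
by move=> a; apply/forallP => b; rewrite hz.
Qed.

Lemma pid_inv x i j : i < j -> (pid x j < pid x i) = forced up x i j.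
Proof. by move=> ij; rewrite pid_lt /bforced ij ltnNge (ltnW ij). Qed.

Lemma pid_le x : wle (pid x) x.
Proof. by move=> i j ij; rewrite pid_inv // => /forced_inv. Qed.

Lemma pid_mono x y : wle x y -> wle (pid x) (pid y).
Proof.
move=> h i j ij; rewrite !pid_inv // => /(forcedP _ _ ij) f.
apply/forcedP => // a b ia ab bj ha hb; apply: h => //; exact: f.
Qed.

Lemma pid_teq x : teq up (pid x) x.
Proof.
move=> p q pq qN; apply/triP/triP => h; last first.
  move=> i j hi hj; rewrite /ordr pid_lt /bforced.
  case: (ltngtP i j) => [ij|ji|/val_inj e].
  - by apply/negP => /forced_inv; have := h i j hi hj; rewrite /ordr; lia.
  (* Here the tested labels [b] belong to [pre] and the tested labels [a] to [post]. *)
  - apply/forcedP => // a b ja ab bi ha hb; apply: h.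
      move: hb hi hj; rewrite /pre /post; have := up_eq up b.+1 i.+1.
      have := up_eq up b.+1 p; have := up_eq up b.+1 q; rewrite -val_eqE /=; lia.
    move: ha hi hj; rewrite /pre /post; have := up_eq up a.+1 j.+1.
    have := up_eq up a.+1 p; have := up_eq up a.+1 q; rewrite -val_eqE /=; lia.
  - by have := h i j hi hj; rewrite e /ordr ltnn.
(* Induction on the distance: an upper label between [i] and [j] is in [post] and a lower one in
   [pre], so that closer pairs show [x b <= x j < x i <= x a] whenever [(i, j)] is assumed
   inverted. *)
move=> i j; have [k] := ubnP (j - i); elim: k i j => // k IH i j ijk hi hj.
have := h i j hi hj; rewrite /ordr pid_lt /bforced.
case: (ltnP i j) => ij; last by case/andP => _ /forced_inv.
move=> nf; rewrite ltnNge; apply/negP => ji; case/negP: nf.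
have {}ji : x j < x i.
  by rewrite ltn_neqAle ji andbT; apply/eqP => /val_inj/perm_inj e; rewrite e ltnn in ij.
apply/forcedP => // a b ia ab bj ha hb.
have xa : (a == i) || (x i < x a).
  case/orP: ha => [->//|ua]; case: (eqVneq a i) => //= ai.
  have ia' : i < a by rewrite ltn_neqAle ia andbT eq_sym.
  apply: IH => //; first lia.
  by move: hi hj ua; rewrite /pre /post; lia.
have xb : (b == j) || (x b < x j).
  case/orP: hb => [->//|ub]; case: (eqVneq b j) => //= bj'.
  have bj2 : b < j by rewrite ltn_neqAle bj andbT.
  apply: IH => //; first lia.
  by move: hi hj ub; rewrite /pre /post; lia.
by case/orP: xa => [/eqP->|xa]; case/orP: xb => [/eqP->|xb]; lia.
Qed.

Hypothesis up0 : up 0 = false.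
Hypothesis upN : up N.+1 = false.

(** Suppose that a forced inversion [(i, j)] of [y] is missing in [x]. The path of the prefix of [x]
    ending with [i] separates [i] from [j] by a chord of [T(x) = T(y)], and suitable [pre] and
    [post] labels of this chord between [i] and [j] violate forcedness. *)
Lemma teq_pid_le x y : teq up x y -> wle (pid y) x.
Proof.
move=> xy i j ij; rewrite pid_inv // => fy; rewrite ltnNge; apply/negP => xij.
have {}xij : x i < x j.
  by rewrite ltn_neqAle xij andbT; apply/eqP => /val_inj/perm_inj e; rewrite e ltnn in ij.
pose a (v : nat) := [exists k : 'I_N, (k.+1 == v) && (x k <= x i)].
have aE k : a k.+1 = (x k <= x i).
  apply/existsP/idP => [[l /andP[/eqP[/val_inj->]]] //|h].
  by exists k; rewrite eqxx.
have iN : 0 < i.+1 <= N by have := ltn_ord i; lia.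
have jN : 0 < j.+1 <= N by have := ltn_ord j; lia.
have [||p [q [pq st bi bj]]] := path_separates up0 upN iN jN (a := a).
- by rewrite aE.
- by rewrite aE -ltnNge.
have /(step_pre_post _ up0 upN pq (ltn_ord q)) st' := st.
have : tri up (ordr x) p q.
  apply/triP => k l hk hl.
  have [h1 _] := st' k.+1 (ltn_ord k); have [_ h2] := st' l.+1 (ltn_ord l).
  by rewrite /ordr; apply: leq_ltn_trans (_ : x k <= x i) _; rewrite ?ltnNge -aE ?h1 ?h2.
rewrite xy // => /triP hy.
have [al [h1 h2 h3 h4]] : exists al : 'I_N,
    [/\ i <= al, (al == i) || up al.+1, pre up p q al.+1 & al < j /\ al.+1 < q].
  have := below_sep_pre pq (ij : i.+1 < j.+1) bi bj; case: ifP => pi /andP[h1 h2].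
    by exists i; rewrite eqxx leqnn.
  have p0 : 0 < p by move: (pi); clear; case: (nat_of_ord p).
  have p1 : p.-1 < N by move: p0 pq (ltn_ord q); clear; lia.
  exists (Ordinal p1); rewrite /= prednK // h1 orbT /pre h1 eqxx.
  by split=> //; move: pi h2 p0; clear; lia.
have [ga [g1 g2 g3 g4]] : exists ga : 'I_N,
    [/\ ga <= j, (ga == j) || ~~ up ga.+1, post up p q ga.+1 & al < ga].
  have := below_sep_post pq (ij : i.+1 < j.+1) bi bj; case: ifP => jq /andP[g1 g2].
    by exists j; rewrite eqxx leqnn; case: h4.
  have q0 : 0 < q by apply: leq_trans pq.
  have q1 : q.-1 < N.
    by move: jq (ltn_ord j) q0; clear; lia.
  exists (Ordinal q1); rewrite /= prednK // g1 orbT /post g1 eqxx orbT.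
  by case: h4 => _ h4; split=> //; move: jq h4; clear; lia.
have := hy al ga h3 g3; rewrite /ordr ltnNge => /negP; apply; apply: ltnW.
by have /(forcedP _ _ ij)/(_ al ga h1 g4 g1 h2 g2) := fy.
Qed.

Variable sy : bool.
Hypothesis ups : sy -> forall i, up (rev_ord i).+1 = ~~ up i.+1.

Lemma forced_sym x i j : sy -> symw x -> i < j -> forced up x i j ->
  forced up x (rev_ord j) (rev_ord i).
Proof.
move=> s sx ij /(forcedP _ _ ij) h; have iN := ltn_ord i; have jN := ltn_ord j.
apply/forcedP => /=; first lia.
move=> a b ja ab bi ha hb; have aN := ltn_ord a; have bN := ltn_ord b.
rewrite -(symw_lt _ _ sx); apply: h => /=; try (clear ha hb sx; lia).
  by rewrite ups // -(inj_eq (@rev_ord_inj N)) rev_ordK.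
by rewrite ups // negbK -(inj_eq (@rev_ord_inj N)) rev_ordK.
Qed.

Lemma pid_inW x : inW sy x -> inW sy (pid x).
Proof.
rewrite /inW; case E: sy => //= sx; apply: lt_symw => i j; rewrite !pid_lt /bforced /=.
have iN := ltn_ord i; have jN := ltn_ord j.
case: (ltngtP i j) => //= ij.
  have -> : N - j.+1 < N - i.+1 by lia.
  by apply: contra => /forced_sym; rewrite !rev_ordK; apply; rewrite ?E //=; lia.
move=> h; have e : N - i.+1 < N - j.+1 by lia.
by rewrite ltnNge (ltnW e) e /=; apply: forced_sym; rewrite ?E.
Qed.

(** [pid] is monotone and [pid y] is below the whole class of [y], so [pid n] is below [x] as well
    as below [z]. *)
Lemma teq_meet_le x y z m n : inW sy n -> teq up x y ->
  ismeet sy x z m -> ismeet sy y z n -> wle (pid n) (pid m).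
Proof.
move=> Wn xy [Wm mx mz hm] [_ ny nz hn].
have h : wle (pid n) m.
  apply: hm; first exact: pid_inW.
    by apply: wle_trans (pid_mono ny) _; apply: teq_pid_le.
  by apply: (@wle_trans _ n) => //; apply: pid_le.
apply: wle_trans (pid_mono h); apply: teq_pid_le.
exact: teq_trans (pid_teq _) (pid_teq _).
Qed.

Lemma teq_meet x y z m n : teq up x y ->
  ismeet sy x z m -> ismeet sy y z n -> teq up m n.
Proof.
move=> xy hm hn; have [Wm _ _ _] := hm; have [Wn _ _ _] := hn.
have e : pid m = pid n.
  apply: wle_anti; last exact: teq_meet_le xy hm hn.
  exact: teq_meet_le (teq_sym xy) hn hm.
by apply: teq_trans (pid_teq n); rewrite -e; apply: teq_sym; apply: pid_teq.
Qed.

End PiDown.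

(** * Compatibility with joins, by duality *)

Section Joins.
Variables (N : nat) (up : nat -> bool) (sy : bool).
Implicit Types (x y z m n : 'S_N).
Hypothesis ups : sy -> forall i : 'I_N, up (rev_ord i).+1 = ~~ up i.+1.

(* Reversing the order of the labels exchanges [pre] and [post], and so does
   exchanging the two hulls. *)
Definition flip (v : nat) := [&& 0 < v, v <= N & ~~ up v].

Lemma tri_flip (x : 'S_N) p q :
  tri flip (ordr (rv x)) p q = tri up (ordr x) p q.
Proof.
have h1 (i : 'I_N) : pre flip p q i.+1 = post up p q i.+1.
  rewrite /pre /post /flip; have := ltn_ord i; have := up_eq up p i.+1.
  by have := up_eq up q i.+1; lia.
have h2 (i : 'I_N) : post flip p q i.+1 = pre up p q i.+1.
  rewrite /pre /post /flip; have := ltn_ord i; have := up_eq up p i.+1.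
  by have := up_eq up q i.+1; lia.
apply/triP/triP => h i j hi hj.
  by rewrite /ordr -rv_lt; apply: h; rewrite ?h1 ?h2.
by rewrite /ordr rv_lt; apply: h; rewrite -?h1 -?h2.
Qed.

Lemma teq_join x y z m n : teq up x y ->
  isjoin sy x z m -> isjoin sy y z n -> teq up m n.
Proof.
move=> xy /rv_join hm /rv_join hn p q pq qN; rewrite -!tri_flip.
apply: teq_meet hm hn _ _ pq qN => //.
- by rewrite /flip ltnn andbF.
- move=> s i; rewrite /flip ups // /=; have := ltn_ord i.
  by case: (up i.+1) => /=; lia.
- by move=> a b ab bN; rewrite !tri_flip xy.
Qed.
End Joins.

(** * Contraction of covers by congruences *)

(* The values of the simple transposition [k, k+1], multiplied by its mirror image
   if [sy] holds. *)
Definition swk (N : nat) (sy : bool) (k v : nat) : nat :=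
  if v == k then k.+1 else if v == k.+1 then k
  else if sy && (v == N - k.+1) then N - k.+2
  else if sy && (v == N - k.+2) then N - k.+1 else v.

Section Swap.
Variables (N : nat) (sy : bool).
Hypothesis evenN : sy -> ~~ odd N.

(** For even [N] the pair [k, k+1] and its mirror image are equal or disjoint; for odd [N] they
    could share one element, and the map would not be an involution. *)
Lemma swk_lt k u v : k.+1 < N -> u < v -> v < N -> (swk N sy k v < swk N sy k u) =
  ((u == k) && (v == k.+1)) || [&& sy, u == N - k.+2 & v == N - k.+1].
Proof.
rewrite /swk => kN uv vN; case: sy evenN => /= [/(_ isT) h|_]; last first.
  by repeat (case: eqP => ? /=; try lia).
have [n hn] : exists n, N = n + n.
  by exists N./2; rewrite -[LHS]odd_double_half (negbTE h) -addnn.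
by subst N; clear h; repeat (case: eqP => ? /=; try lia).
Qed.

Lemma swk_bound k v : k.+1 < N -> v < N -> swk N sy k v < N.
Proof. by rewrite /swk => kN vN; do !case: ifP => ?; lia. Qed.

Lemma swkK k v : k.+1 < N -> v < N -> swk N sy k (swk N sy k v) = v.
Proof.
move=> kN vN; case: sy evenN => /= [/(_ isT) h|_]; last first.
  rewrite [X in swk _ _ _ X]/swk /=; do 2?(case: eqP => ? /=);
  by rewrite /swk /=; repeat (case: eqP => ? /=; try lia).
have [n hn] : exists n, N = n + n.
  by exists N./2; rewrite -[LHS]odd_double_half (negbTE h) -addnn.
subst N; clear h; rewrite [X in swk _ _ _ X]/swk /=.
by do 4?(case: eqP => ? /=); rewrite /swk /=; repeat (case: eqP => ? /=; try lia).
Qed.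

Lemma swk_rev k v : sy -> k.+1 < N -> v < N ->
  swk N sy k (N - v.+1) = N - (swk N sy k v).+1.
Proof.
rewrite /swk => s kN vN; move: (evenN s); rewrite s /= => h.
have [n hn] : exists n, N = n + n.
  by exists N./2; rewrite -[LHS]odd_double_half (negbTE h) -addnn.
by subst N; clear h; repeat (case: eqP => ? /=; try lia).
Qed.

Definition swo (k : nat) (v : 'I_N) : 'I_N :=
  if insub (swk N sy k v) is Some w then w else v.

Lemma swoE k (v : 'I_N) : k.+1 < N -> swo k v = swk N sy k v :> nat.
Proof. by move=> kN; rewrite /swo insubT //; apply: swk_bound. Qed.

Lemma swo_inj k : injective (if k.+1 < N then swo k else id).
Proof.
case: ltnP => kN; last exact: inj_id.
move=> u v /(congr1 (fun w : 'I_N => swk N sy k w)).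
by rewrite !swoE // !swkK // => /val_inj.
Qed.

Definition swp k : 'S_N := perm (@swo_inj k).

Lemma swpE k v : k.+1 < N -> swp k v = swk N sy k v :> nat.
Proof. by move=> kN; rewrite permE kN swoE. Qed.

Implicit Types (x : 'S_N) (i j : 'I_N).

Lemma swp_inW k x : k.+1 < N -> inW sy x -> inW sy (x * swp k)%g.
Proof.
move=> kN /implyP h; apply/implyP => s; move/symwP: (h s) => {}h; apply/symwP => i.
by apply: val_inj; rewrite !permM h /= !swpE //= swk_rev.
Qed.

Lemma swp_inv k x i j : k.+1 < N -> i < j -> x j < x i ->
  ((x * swp k)%g j < (x * swp k)%g i) =
  ~~ (((x j == k :> nat) && (x i == k.+1 :> nat)) ||
     [&& sy, x j == N - k.+2 :> nat & x i == N - k.+1 :> nat]).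
Proof.
move=> kN ij xji; rewrite perm_lt_total; last by rewrite neq_ltn ij orbT.
by rewrite !permM !swpE // swk_lt.
Qed.

Lemma swp_noninv k x i j : k.+1 < N -> i < j -> x i < x j ->
  ~~ (((x i == k :> nat) && (x j == k.+1 :> nat)) ||
     [&& sy, x i == N - k.+2 :> nat & x j == N - k.+1 :> nat]) ->
  (x * swp k)%g i < (x * swp k)%g j.
Proof.
move=> kN ij xij /negbTE h; rewrite perm_lt_total; last by rewrite neq_ltn ij.
by rewrite !permM !swpE // swk_lt // h.
Qed.
End Swap.

Section Contract.
Variables (N : nat) (sy : bool).
Implicit Types (v w x y z g m : 'S_N) (i j k : 'I_N).

Definition wcongr (Th : 'S_N -> 'S_N -> Prop) : Prop :=
  [/\ (forall x, inW sy x -> Th x x), (forall x y, Th x y -> Th y x),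
      (forall x y z, Th x y -> Th y z -> Th x z),
      (forall x y z m1 m2, inW sy x -> inW sy y -> inW sy z -> Th x y ->
         ismeet sy x z m1 -> ismeet sy y z m2 -> Th m1 m2) &
      (forall x y z m1 m2, inW sy x -> inW sy y -> inW sy z -> Th x y ->
         isjoin sy x z m1 -> isjoin sy y z m2 -> Th m1 m2)].

Lemma inv_split x i j k : i < j -> j < k -> x k < x i -> (x j < x i) || (x k < x j).
Proof. by move=> ij jk; lia. Qed.

(** The inversions of the join are the transitive closure of the union. The point is [Usp]: the
    complement of this closure is still closed, by cutting a chain of inversions at the element that
    passes over [j]. *)
Lemma join_exists x y : inW sy x -> inW sy y -> exists m, isjoin sy x y m.
Proof.
move=> Wx Wy.
pose U : rel 'I_N := fun i j => (i < j) && ((x j < x i) || (y j < y i)).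
have Ule i j : connect U i j -> i <= j.
  case/connectP => p; elim: p i => [|e p IH] i /=; first by move=> _ ->.
  by case/andP=> /andP[ie _] pp /(IH _ pp); lia.
have Usp i j k : i < j -> j < k -> connect U i k -> connect U i j || connect U j k.
  move=> ij jk /connectP[p]; elim: p i ij => [|e p IH] i ij /=.
    by move=> _ e; subst k; lia.
  case/andP=> Ue pp lst; have ce : connect U i e by apply: connect1.
  case: (ltngtP j e) => [je|ej|/val_inj->]; last by rewrite ce.
  - have h : U i j || U j e.
      case/andP: (Ue) => ie /orP[] h; have := inv_split ij je h;
      by case/orP => h2; rewrite /U ij je h2 ?orbT.
    case/orP: h => h; first by rewrite (connect1 h).
    have -> : connect U j k; last by rewrite orbT.
    by apply: connect_trans (connect1 h) _; apply/connectP; exists p.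
  - case/orP: (IH e ej pp lst) => h; last by rewrite h orbT.
    by rewrite (connect_trans ce h).
have [|m hm] := @perm_of_biclosed N (connect U) _ Usp.
  by move=> i j k _ _; apply: connect_trans.
have minv i j : i < j -> (m j < m i) = connect U i j.
  by move=> ij; rewrite hm ltnNge (ltnW ij) ij.
exists m; split.
- apply/implyP => s; have sx := implyP Wx s; have sy' := implyP Wy s.
  have Us i j : connect U i j -> connect U (rev_ord j) (rev_ord i).
    case/connectP => p; elim: p i => [|e p IH] i /=; first by move=> _ ->.
    case/andP=> Ue pp /(IH _ pp) h; apply: connect_trans h (connect1 _).
    move: Ue; rewrite /U !symw_lt // => /andP[ie ->]; rewrite andbT /=.
    by have := ltn_ord i; have := ltn_ord e; lia.
  have Us' i j : connect U (rev_ord j) (rev_ord i) = connect U i j.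
    by apply/idP/idP => /Us //; rewrite !rev_ordK.
  apply: lt_symw => i j; rewrite !hm !Us' /=.
  have := ltn_ord i; have := ltn_ord j; case: (ltngtP i j) => //= ij iN jN.
    by have -> : N - j.+1 < N - i.+1 by lia.
  have e : N - i.+1 < N - j.+1 by lia.
  by rewrite ltnNge (ltnW e) e.
- by move=> i j ij h; rewrite minv //; apply: connect1; rewrite /U ij h.
- by move=> i j ij h; rewrite minv //; apply: connect1; rewrite /U ij h orbT.
- move=> z _ xz yz i j ij; rewrite minv // => /connectP[p].
  elim: p i ij => [|e p IH] i ij /=; first by move=> _ e; subst j; lia.
  case/andP=> /andP[ie h] pp lst.
  have zei : z e < z i by case/orP: h; [apply: xz|apply: yz].
  case: (ltngtP e j) => [ej|je|/val_inj<-] //.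
    exact: ltn_trans (IH _ ej pp lst) zei.
  have : connect U e j by apply/connectP; exists p.
  by move/Ule; lia.
Qed.

Lemma perm_of_key (b f : 'I_N -> nat) : exists w, forall i j,
  (w i < w j) = (b i < b j) || (b i == b j) && ((f i < f j) || (f i == f j) && (i < j)).
Proof.
apply: perm_of_order => [i|j i k|i j]; first by rewrite !ltnn !eqxx.
  by lia.
by rewrite -val_eqE /=; lia.
Qed.

Lemma perm_of_key_inW (b f : 'I_N -> nat) (B F : nat) :
  (sy -> forall i, b (rev_ord i) + b i = B) ->
  (sy -> forall i, f (rev_ord i) + f i = F) ->
  exists w, inW sy w /\ forall i j, (w i < w j) =
    (b i < b j) || (b i == b j) && ((f i < f j) || (f i == f j) && (i < j)).
Proof.
move=> hb hf; have [w hw] := perm_of_key b f; exists w; split => //.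
apply/implyP => s; apply: lt_symw => i j; rewrite !hw /=.
have := hb s i; have := hb s j; have := hf s i; have := hf s j.
by have := ltn_ord i; have := ltn_ord j; lia.
Qed.

Variable Th : 'S_N -> 'S_N -> Prop.
Hypothesis congTh : wcongr Th.

(* From [g ~ h] we get [p ~ p v h], then, taking the meet with [q], [m ~ q], then
   [y' ~ y' v q], and finally [y ~ x] by taking the meet with [x]. *)
Lemma contract_gen g h p q m y' x y :
  inW sy g -> inW sy h -> inW sy p -> inW sy q -> inW sy m -> inW sy y' ->
  inW sy x -> inW sy y -> Th g h -> wle g p ->
  (forall z, inW sy z -> wle h z -> wle p z -> wle q z) ->
  (forall i j, i < j -> (m j < m i) = (p j < p i) && (q j < q i)) ->
  wle m y' -> (forall z, inW sy z -> wle q z -> wle y' z -> wle x z) ->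
  wle y x -> wle y y' -> (forall z, inW sy z -> wle z y' -> wle z x -> wle z y) ->
  Th y x.
Proof.
case: congTh => Trefl Tsym Ttrans Tmeet Tjoin Wg Wh Wp Wq Wm Wy' Wx Wy gh gp hpq mpq my qyx yx yy' my'x.
have [J HJ] := join_exists Wh Wp.
have [WJ hJ pJ _] := HJ.
have T1 : Th p J by apply: (Tjoin g h p) => //; split.
have T2 : Th m q.
  apply: (Tmeet p J q) => //; split => //.
  - by move=> i j ij; rewrite mpq // => /andP[].
  - by move=> i j ij; rewrite mpq // => /andP[].
  - by move=> z _ h1 h2 i j ij zij; rewrite mpq // h1 // h2.
  - exact: hpq.
have [K HK] := join_exists Wq Wy'.
have [WK qK yK _] := HK.
have T3 : Th y' K by apply: (Tjoin m q y') => //; split.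
apply: (Tmeet y' K x) => //; split => //.
exact: qyx.
Qed.

End Contract.

(** * Covers of the weak order and their effect on forced inversions *)

Section Cover.
Variables (N : nat) (sy : bool).
Hypothesis evenN : sy -> ~~ odd N.
Implicit Types (v w x y z g h m : 'S_N) (i j k : 'I_N).
Variables (x : 'S_N) (a c : 'I_N).
Hypotheses (Wx : inW sy x) (ac : a < c) (xac : x a = (x c).+1 :> nat).

(* When [x a = (x c).+1] with [a < c], this is the element covered by [x] that is
   obtained by removing the inversion [(a, c)] (and its mirror image). *)
Definition cov : 'S_N := (x * swp evenN (x c))%g.

Lemma covN : (x c).+1 < N. Proof. by rewrite -xac. Qed.

Lemma cov_inW : inW sy cov. Proof. exact: swp_inW covN Wx. Qed.

Lemma cov_le : wle cov x.
Proof.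
move=> i j ij h; rewrite perm_lt_total; last by rewrite neq_ltn ij orbT.
apply/negP => xij.
have := h; rewrite ltnNge => /negP; apply; apply: ltnW.
apply: swp_noninv => //; first exact: covN.
apply/negP => /orP[/andP[/eqP/val_inj/perm_inj e]|/and3P[s]].
  by rewrite -xac => /eqP/val_inj/perm_inj e2; move: ij ac; rewrite e e2; lia.
have /symwP sx := implyP Wx s.
have -> : N - (x c).+2 = x (rev_ord a) by rewrite sx /= xac.
have -> : N - (x c).+1 = x (rev_ord c) by rewrite sx.
move=> /eqP/val_inj/perm_inj e /eqP/val_inj/perm_inj e2.
move: ij; rewrite e e2 /=; have := ltn_ord c; lia.
Qed.

Lemma covP i j : i < j -> x j < x i ->
  [\/ cov j < cov i, i = a /\ j = c | [/\ sy, i = rev_ord c & j = rev_ord a]].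
Proof.
move=> ij xji; case E: (cov j < cov i); [by constructor 1|].
move: E; rewrite swp_inv //; last exact: covN.
move/negbT; rewrite negbK => /orP[/andP[/eqP/val_inj/perm_inj e]|/and3P[s]].
  by rewrite -xac => /eqP/val_inj/perm_inj e2; constructor 2.
have /symwP sx := implyP Wx s.
have -> : N - (x c).+2 = x (rev_ord a) by rewrite sx /= xac.
have -> : N - (x c).+1 = x (rev_ord c) by rewrite sx.
by move=> /eqP/val_inj/perm_inj e /eqP/val_inj/perm_inj e2; constructor 3.
Qed.

Lemma cov_ac : cov a < cov c.
Proof.
rewrite perm_lt_total; last by rewrite neq_ltn ac.
rewrite swp_inv //; last by rewrite xac.
  by rewrite eqxx xac eqxx.
exact: covN.
Qed.

Lemma cov_card : #|[set p : 'I_N * 'I_N | (p.1 < p.2) && (cov p.2 < cov p.1)]| <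
   #|[set p : 'I_N * 'I_N | (p.1 < p.2) && (x p.2 < x p.1)]|.
Proof.
apply: proper_card; apply/properP; split.
  by apply/subsetP => -[i j]; rewrite !inE /= => /andP[ij h]; rewrite ij cov_le.
by exists (a, c); rewrite !inE /= ac ?xac //= -leqNgt ltnW // cov_ac.
Qed.

Variable up : nat -> bool.
Hypothesis ups : sy -> forall i, up (rev_ord i).+1 = ~~ up i.+1.

(** No forced inversion of [x] relies on the removed pair: a test involving [(a, c)] would also test
    [(e, c)] or [(a, e)], according to the hull of [e], and would fail there. The mirror pair is
    handled with the mirror image of [e]. *)
Lemma pid_cov (e : 'I_N) : a < e -> e < c ->
  (if up e.+1 then x e < x c else x a < x e) -> pid up cov = pid up x.
Proof.
move=> ae ec he; apply: wle_anti; first exact: pid_mono cov_le.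
move=> i j ij; rewrite !pid_inv // => /(forcedP _ _ ij) f.
apply/forcedP => // u v iu uv vj hu hv.
case: (covP uv (f u v iu uv vj hu hv)) => // [[eu ev]|[s eu ev]]; subst u v.
  case E: (up e.+1) he => he.
    have : x c < x e by apply: f; rewrite ?E ?orbT //; lia.
    by lia.
  have : x e < x a by apply: f; rewrite ?E ?orbT //; lia.
  by lia.
have sx := implyP Wx s.
have [h1 h2] : rev_ord c < rev_ord e /\ rev_ord e < rev_ord a.
  by rewrite /=; have := ltn_ord c; lia.
case E: (up e.+1) he => he.
  have : x (rev_ord e) < x (rev_ord c).
    by apply: f => //; rewrite ?ups ?E ?orbT //; apply: ltnW; apply: leq_trans h2 vj.
  by rewrite symw_lt //; lia.
have : x (rev_ord a) < x (rev_ord e).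
  by apply: f => //; rewrite ?ups ?E ?orbT //; apply: ltnW; apply: leq_ltn_trans iu h1.
by rewrite symw_lt //; lia.
Qed.
End Cover.

Section Descent.
Variable N : nat.
Implicit Types (x z : 'S_N).

Lemma descent_exists z x : wle z x -> z <> x ->
  exists a c : 'I_N, [/\ a < c, x a = (x c).+1 :> nat & z a < z c].
Proof.
move=> zx zNx.
have [a [c [ac xca zac]]] : exists a c : 'I_N, [/\ a < c, x c < x a & z a < z c].
  case: (boolP [exists a : 'I_N, exists c : 'I_N, [&& a < c, x c < x a & z a < z c]]).
    by case/existsP=> a /existsP[c /and3P[h1 h2 h3]]; exists a, c.
  move/existsPn => h; case: zNx; apply: wle_anti => // i j ij xji.
  have /existsPn/(_ j) := h i; rewrite ij xji /= perm_lt_total ?negbK //.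
  by rewrite neq_ltn ij.
have [d] := ubnP (x a - x c); elim: d a c ac xca zac => // d IH a c ac xca zac xd.
case: (ltngtP (x a) (x c).+1) => h; [by lia| |by exists a, c].
have eN : (x c).+1 < N by apply: leq_trans (ltn_ord (x a)); apply: ltnW.
(* Take the label [e] placed right after [c]. Comparing it with [a] and [c] gives an inversion of
   [x] missing in [z] at smaller distance, or contradicts [wle z x]. *)
have [e xe] : exists e, x e = (x c).+1 :> nat.
  by exists (x^-1 (Ordinal eN))%g; rewrite permKV.
have Hac (u v : 'I_N) : u < v -> x v < x u -> x u - x v < x a - x c -> z u < z v ->
    exists a c : 'I_N, [/\ a < c, x a = (x c).+1 :> nat & z a < z c].
  by move=> uv xvu lt zuv; apply: (IH u v) => //; apply: leq_trans lt _.
have zne (u v : 'I_N) : u < v -> ~~ (z u < z v) -> z v < z u.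
  by move=> uv h1; rewrite perm_lt_total // neq_ltn uv orbT.
clear IH.
case: (ltngtP e c) => [ec|ce|/val_inj e2]; last by move: xe; rewrite e2; lia.
  have [zec|/(zne _ _ ec) zec] := boolP (z e < z c); first by apply: (Hac e c) => //; lia.
  case: (ltngtP e a) => [ea|ae|/val_inj e2]; last by move: xe h; rewrite e2; lia.
    by have := zx e a ea; lia.
  have [zae|/(zne _ _ ae) zae] := boolP (z a < z e); last by lia.
  by apply: (Hac a e) => //; lia.
have ae : a < e by lia.
have [zae|/(zne _ _ ae) zae] := boolP (z a < z e); first by apply: (Hac a e) => //; lia.
by have := zx c e ce; lia.
Qed.

End Descent.

Section Key.
Variables (N : nat) (sy : bool).
Hypothesis evenN : sy -> ~~ odd N.
Implicit Types (v w x y z g h m : 'S_N) (i j k : 'I_N).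
Variable Th : 'S_N -> 'S_N -> Prop.
Hypothesis congTh : wcongr sy Th.

(* Here [contract_gen] is used with permutations sorting the labels by the keys [b]
   and [f]: within the blocks of [b], resp. between the blocks of [f], everything
   is inverted. *)
Lemma contract_key x (a c : 'I_N) g h y' (b f : 'I_N -> nat) (B F : nat) :
  inW sy x -> a < c -> x a = (x c).+1 :> nat ->
  inW sy g -> inW sy h -> Th g h ->
  inW sy y' -> wle (cov evenN x c) y' -> y' a < y' c ->
  (sy -> forall i, b (rev_ord i) + b i = B) ->
  (sy -> forall i, f (rev_ord i) + f i = F) ->
  (forall i j, i < j -> b i <= b j) ->
  (forall i j, i < j -> g j < g i -> b i = b j) ->
  (forall z, inW sy z -> (forall i j, i < j -> b i = b j -> z j < z i) -> wle h z ->
     forall i j, i < j -> f j < f i -> z j < z i) ->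
  (forall i j, i < j -> b i = b j -> f j < f i -> y' j < y' i) ->
  (forall z, inW sy z -> (forall i j, i < j -> f j < f i -> z j < z i) ->
     wle y' z -> z c < z a) ->
  Th (cov evenN x c) x.
Proof.
move=> Wx ac xac Wg Wh gh Wy' yy' y'ac hb hf bmono gb hq mb qac.
(* The inversions of [p] are the pairs within a block of [b], those of [q] the pairs along which [f]
   decreases, and those of [m] the pairs with both properties. *)
have [p [Wp hp]] := perm_of_key_inW (f := fun i => N - i.+1) (F := N.-1) hb
  (fun _ i => ltac:(have := ltn_ord i; rewrite /=; lia)).
have [q [Wq hq']] := perm_of_key_inW (f := fun i => 0) (F := 0) hf
  (fun _ i => erefl).
have [m [Wm hm]] := perm_of_key_inW hb hf.
have pinv i j : i < j -> (p j < p i) = (b i == b j).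
  move=> ij; have := bmono _ _ ij; rewrite hp; have := ltn_ord j; lia.
have qinv i j : i < j -> (q j < q i) = (f j < f i).
  by move=> ij; rewrite hq'; lia.
have minv i j : i < j -> (m j < m i) = (b i == b j) && (f j < f i).
  by move=> ij; have := bmono _ _ ij; rewrite hm; lia.
have Wy := cov_inW evenN Wx xac.
apply: (contract_gen congTh Wg Wh Wp Wq Wm Wy' Wx Wy gh).
- by move=> i j ij h1; rewrite pinv //; apply/eqP; apply: gb.
- move=> z Wz hz pz i j ij; rewrite qinv // => h1; apply: (hq z) => // k l kl e.
  by apply: pz => //; rewrite pinv // e.
- by move=> i j ij; rewrite minv // pinv // qinv.
- by move=> i j ij; rewrite minv // => /andP[/eqP h1 h2]; apply: mb.
- move=> z Wz qz y'z i j ij xji.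
  have zac : z c < z a.
    by apply: qac => // k l kl fkl; apply: qz => //; rewrite qinv.
  case: (covP evenN Wx xac ij xji) => [h1|[-> ->] //|[s -> ->]].
    by apply: y'z => //; apply: yy'.
  by rewrite symw_lt //; apply: (implyP Wz).
- exact: (@cov_le _ _ evenN _ _ _ Wx ac xac).
- exact: yy'.
- move=> z Wz zy' zx i j ij zij.
  case: (covP evenN Wx xac ij (zx _ _ ij zij)) => [//|[e1 e2]|[s e1 e2]].
    by have := zy' _ _ ij zij; rewrite e1 e2 ltnNge (ltnW y'ac).
  have sz := implyP Wz s.
  have : y' c < y' a by apply: zy' => //; rewrite -(symw_lt _ _ sz) -e1 -e2.
  by rewrite ltnNge (ltnW y'ac).
Qed.

Variable up : nat -> bool.
Hypothesis up0 : up 0 = false.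
Hypothesis upN : up N.+1 = false.
Hypothesis ups : sy -> forall i, up (rev_ord i).+1 = ~~ up i.+1.

Hypothesis contract : forall x (a c e : 'I_N), inW sy x -> a < c ->
  x a = (x c).+1 :> nat -> a < e -> e < c ->
  (if up e.+1 then x e < x c else x a < x e) -> Th (cov evenN x c) x.

(** Induction on the number of inversions. A descent of [x] that [pid x] does not invert is not
    forced, which provides the label [e] needed by [contract], and contracting the cover does not
    change [pid]. *)
Lemma congr_pid x : inW sy x -> Th x (pid up x).
Proof.
case: congTh => Trefl Tsym Ttrans _ _.
have [d] := ubnP #|[set p : 'I_N * 'I_N | (p.1 < p.2) && (x p.2 < x p.1)]|.
elim: d x => // d IH x hd Wx.
case: (eqVneq (pid up x) x) => [->|/eqP zx]; first exact: Trefl.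
have [a [c [ac xac zac]]] := descent_exists (@pid_le _ up x) zx.
have [e [ae ec he]] : exists e : 'I_N,
    [/\ a < e, e < c & if up e.+1 then x e < x c else x a < x e].
  case: (boolP [exists e : 'I_N, [&& a < e, e < c &
     if up e.+1 then x e < x c else x a < x e]]).
    by case/existsP=> e /and3P[]; exists e.
  move/existsPn => h; exfalso.
  move: zac; rewrite pid_lt /bforced ac => /negP; apply.
  apply/forcedP => // u v au uv vc hu hv.
  (* Without a witness, an upper label in between does not come before [c]; since [a] directly
     follows [c], it does not come before [a] either. *)
  have hu' : x a <= x u.
    case: (eqVneq u a) hu => [->//|ua] /= upu.
    have au' : a < u by rewrite ltn_neqAle au andbT; move: ua; rewrite eq_sym.
    have uc : u < c by apply: leq_trans vc.
    have /negbTE xuc : x u != x c :> nat.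
      by rewrite val_eqE (inj_eq perm_inj) neq_ltn uc.
    have := h u; rewrite au' uc upu /= -leqNgt => h1.
    by rewrite xac ltn_neqAle eq_sym xuc h1.
  have hv' : x v <= x c.
    case: (eqVneq v c) hv => [->//|vc'] /= /negbTE upv.
    have vc2 : v < c by rewrite ltn_neqAle vc andbT.
    have av : a < v by apply: leq_ltn_trans uv.
    have /negbTE xva : x v != x a :> nat.
      by rewrite val_eqE (inj_eq perm_inj) neq_ltn av orbT.
    have := h v; rewrite av vc2 upv /= -leqNgt => h1.
    by rewrite -ltnS -xac ltn_neqAle xva h1.
  apply: leq_trans hu'; rewrite xac; exact: hv'.
apply: Ttrans (Tsym _ _ (contract Wx ac xac ae ec he)) _.
rewrite -(pid_cov evenN Wx ac xac ups ae ec he).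
apply: IH; last exact: (cov_inW evenN Wx xac).
exact: leq_trans (cov_card evenN Wx ac xac) hd.
Qed.

Lemma teq_congr x y : inW sy x -> inW sy y -> teq up x y -> Th x y.
Proof.
case: congTh => Trefl Tsym Ttrans _ _ Wx Wy xy.
apply: Ttrans (congr_pid Wx) _.
have -> : pid up x = pid up y.
  have h : forall x y, teq up x y -> wle (pid up y) (pid up x).
    move=> u v uv; apply: (teq_pid_le up0 upN).
    by apply: teq_trans (pid_teq up u) uv.
  by apply: wle_anti; [apply: h; apply: teq_sym | apply: h].
by apply: Tsym; apply: congr_pid.
Qed.

End Key.

(** * Contraction in type A *)

Section TypeA.
Variable N : nat.
Implicit Types (v w x y z g h m : 'S_N) (i j k : 'I_N).
Variable Th : 'S_N -> 'S_N -> Prop.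
Hypothesis congTh : wcongr false Th.
Hypothesis evenN : false -> ~~ odd N.
Variable up : nat -> bool.

Hypothesis gens : forall e : 'I_N, 0 < e -> e.+1 < N -> exists g h, [/\ Th g h,
  (forall i j, i < j -> g j < g i ->
    if up e.+1 then (i.+1 == e) && (j == e :> nat) else (i == e :> nat) && (j == e.+1 :> nat)) &
  (forall i j, i.+1 = e -> j = e.+1 :> nat -> h j < h i)].

(** The cut of [b] is placed next to [e] so that the inversion of [g] stays inside a block. Above
    [h] and the reversal of the blocks, [e + 1] precedes [e - 1], and so all labels right of [e]
    precede all labels left of it. The pairs of [e] across the cut are not reached, and by [he] the
    key [f] does not ask for them. *)
Lemma contractA x (a c e : 'I_N) : a < c -> x a = (x c).+1 :> nat ->
  a < e -> e < c -> (if up e.+1 then x e < x c else x a < x e) ->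
  Th (cov evenN x c) x.
Proof.
move=> ac xac ae ec he.
have [||g [h [gh hg hh]]] := gens (e := e); first by lia.
  by have := ltn_ord c; lia.
have em : e.-1 < N by have := ltn_ord e; lia.
have ep : e.+1 < N by have := ltn_ord c; lia.
pose f i : nat := x c < x i.
have fE i j : f j < f i -> x j <= x c /\ x c < x i by rewrite /f; lia.
have cfE i j : i < j -> ~ (i = a /\ j = c) -> f j < f i -> cov evenN x c j < cov evenN x c i.
  move=> ij ne /fE[h1 h2]; have xji : x j < x i by lia.
  by case: (covP evenN (isT : inW false x) xac ij xji) => // -[].
have zh z : wle h z -> z (Ordinal ep) < z (Ordinal em).
  by move=> hz; apply: hz => /=; [lia | apply: hh => /=; lia].
case E: (up e.+1) he hg => he hg.
  apply: (contract_key (b := fun i => (e < i : nat)) (f := f) (B := 0) (F := 0)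
    congTh _ ac xac _ _ gh (y' := cov evenN x c)) => //.
  - exact: (cov_ac evenN ac xac).
  - by move=> i j; lia.
  - by move=> i j ij /(hg _ _ ij); lia.
  - move=> z _ bz /zh hz i j ij /[dup] fij /fE[h1 h2].
    case: (ltnP e i) => ei; first by apply: bz => //; lia.
    case: (ltnP e j) => ej; last by apply: bz => //; lia.
    have ie : i != e by apply/eqP => e1; move: h2; rewrite e1; lia.
    have ie' : i < e by rewrite ltn_neqAle ie.
    have h3 : z j <= z (Ordinal ep).
      case: (ltngtP (Ordinal ep) j) => [l|l|/val_inj-> //].
        by apply/ltnW/bz => //; move: l => /=; lia.
      by move: l => /=; lia.
    have h4 : z (Ordinal em) <= z i.
      case: (ltngtP i (Ordinal em)) => [l|l|/val_inj-> //].
        by apply/ltnW/bz => //; move: l => /=; lia.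
      by move: l => /=; lia.
    by apply: leq_ltn_trans h3 (leq_trans hz h4).
  - by move=> i j ij bij; apply: cfE => // -[e1 e2]; move: bij; rewrite e1 e2; lia.
  - by move=> z _ qz yz; apply: qz => //; rewrite /f xac; lia.
apply: (contract_key (b := fun i => (e <= i : nat)) (f := f) (B := 0) (F := 0)
    congTh _ ac xac _ _ gh (y' := cov evenN x c)) => //.
- exact: (cov_ac evenN ac xac).
- by move=> i j; lia.
- by move=> i j ij /(hg _ _ ij); lia.
- move=> z _ bz /zh hz i j ij /[dup] fij /fE[h1 h2].
  case: (leqP e i) => ei; first by apply: bz => //; lia.
  case: (leqP e j) => ej; last by apply: bz => //; lia.
  have je : e != j by apply/eqP => e1; move: h1; rewrite -e1; lia.
  have je' : e < j by rewrite ltn_neqAle je.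
  have h3 : z j <= z (Ordinal ep).
    case: (ltngtP (Ordinal ep) j) => [l|l|/val_inj-> //].
      by apply/ltnW/bz => //; move: l => /=; lia.
    by move: l => /=; lia.
  have h4 : z (Ordinal em) <= z i.
    case: (ltngtP i (Ordinal em)) => [l|l|/val_inj-> //].
      by apply/ltnW/bz => //; move: l => /=; lia.
    by move: l => /=; lia.
  by apply: leq_ltn_trans h3 (leq_trans hz h4).
- by move=> i j ij bij; apply: cfE => // -[e1 e2]; move: bij; rewrite e1 e2; lia.
- by move=> z _ qz yz; apply: qz => //; rewrite /f xac; lia.
Qed.
End TypeA.

(** * Contraction in type B *)

Section Closure.
Variables (N : nat).
Implicit Types (w x y z g h m : 'S_N) (i j k u v : 'I_N).
Variables (n : nat) (e : 'I_N) (z h : 'S_N).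
Hypotheses (Nn : N = n + n) (e0 : 0 < e) (eN : e.+1 < N) (sz : symw z).
Let r := N - e.+1.
(** The labels are cut before [e] and after its mirror image [r], which gives symmetric blocks
    whichever of the two comes first. *)
Definition vblk i : nat := (e <= i) + (N - e.+1 < i).
Hypothesis bz : forall i j, i < j -> vblk i = vblk j -> z j < z i.
Hypothesis hz : wle h z.
Hypothesis hh : forall i j, i.+1 = e -> j = e.+1 :> nat -> h j < h i.
(** This concerns the central labels [e = n - 1] and [r = n]: the edge labeled 4 has a three-letter
    alternating word, with one more inversion. *)
Hypothesis hh2 : forall i j, i.+1 = e -> e.+1 = r -> j = e.+2 :> nat -> h j < h i.

Lemma vblk_le i j : i <= j -> vblk i = vblk j -> z j <= z i.
Proof.
by case: (ltngtP i j) => // [ij _|/val_inj-> //]; move/(bz ij)/ltnW.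
Qed.

Lemma chain i j u v : i <= u -> vblk i = vblk u -> v <= j -> vblk v = vblk j ->
  z v < z u -> z j < z i.
Proof.
move=> iu biu vj bvj vu.
exact: leq_ltn_trans (vblk_le vj bvj) (leq_trans vu (vblk_le iu biu)).
Qed.

Lemma z_mid u v : u.+1 = e -> v = e.+1 :> nat -> z v < z u.
Proof. by move=> h1 h2; apply: hz; [lia | apply: hh]. Qed.

Lemma z_mid_rev u v : u.+1 = r -> v = r.+1 :> nat -> z v < z u.
Proof.
move=> h1 h2; rewrite -(symw_lt _ _ sz); apply: z_mid; rewrite /=.
  by rewrite h2 /r; have := ltn_ord e; lia.
by move: h1; rewrite /r; have := ltn_ord u; lia.
Qed.

(* Above both the generator [h] and the permutation reversing all the blocks of
   [vblk e], almost everything is inverted. *)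
Lemma closureB i j : i < j -> (e == n :> nat) || (j != e :> nat) && (i != r :> nat) ->
  ~~ ((i == r :> nat) && (j == e :> nat)) -> z j < z i.
Proof.
move=> ij H1 H2.
have em : e.-1 < N by lia.
have ep : e.+1 < N by lia.
have rm : r.-1 < N by rewrite /r; lia.
have rp : r.+1 < N by rewrite /r; lia.
have m1 : z (Ordinal ep) < z (Ordinal em) by apply: z_mid => /=; lia.
have m2 : z (Ordinal rp) < z (Ordinal rm).
  by apply: z_mid_rev => //=; rewrite /r; lia.
case E: (vblk i == vblk j); first by apply: bz => //; apply/eqP.
have vE (k : 'I_N) : vblk k = (e <= k) + (r < k) by [].
have rE : r + e.+1 = N by rewrite /r; lia.
have [en|en] := eqVneq (nat_of_ord e) n.
  case: (ltnP e j) => ej.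
    by apply: (@chain _ _ (Ordinal em) (Ordinal ep)) => //; move: E; rewrite !vE /=; clear -rE en Nn ij ej e0; lia.
  apply: (@chain _ _ (Ordinal rm) (Ordinal rp)) => //; move: E H2; rewrite !vE /=; clear -rE en Nn ij ej e0; lia.
have {H1} /andP[je ir] : (j != e :> nat) && (i != r :> nat) by move: H1; rewrite (negbTE en).
clear H2.
case: (ltnP n e) => ne.
  case: (ltnP r i) => ri.
    by apply: (@chain _ _ (Ordinal em) (Ordinal ep)) => //; move: E; rewrite !vE /=; clear -rE en Nn ij e0 ne ri je ir; lia.
  case: (ltnP j e) => ej.
    by apply: (@chain _ _ (Ordinal rm) (Ordinal rp)) => //; move: E; rewrite !vE /=; clear -rE en Nn ij e0 ne ri je ir ej; lia.
  apply: (@chain _ _ (Ordinal rm) (Ordinal ep)) => //; try (move: E; rewrite !vE /=; clear -rE en Nn ij e0 ne ri je ir ej; lia).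
  apply: ltn_trans m1 (leq_ltn_trans _ m2); apply: vblk_le; rewrite ?vE /=; clear -rE en Nn e0 ne; lia.
have {en} ne : e < n by rewrite ltn_neqAle en ne.
case: (ltnP e i) => ei.
  by apply: (@chain _ _ (Ordinal rm) (Ordinal rp)) => //; move: E; rewrite !vE /=; clear -rE Nn ij e0 ne ei je ir; lia.
case: (ltnP r j) => rj; last first.
  by apply: (@chain _ _ (Ordinal em) (Ordinal ep)) => //; move: E; rewrite !vE /=; clear -rE Nn ij e0 ne ei je ir rj; lia.
case: (eqVneq (nat_of_ord i) e) => [ie|ie].
  by apply: (@chain _ _ (Ordinal rm) (Ordinal rp)) => //; move: E; rewrite !vE /=; clear -rE Nn ij e0 ne ei je ir rj ie; lia.
apply: (@chain _ _ (Ordinal em) (Ordinal rp)) => //; try (move: E; rewrite !vE /=; clear -rE Nn ij e0 ne ei je ir rj ie; lia).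
case: (eqVneq r e.+1) => re.
  by apply: hz => /=; [lia|]; apply: hh2 => /=; lia.
apply: ltn_trans m2 (leq_ltn_trans _ m1); apply: vblk_le; rewrite ?vE /=; clear -rE re Nn e0 ne; lia.
Qed.
End Closure.

Section TypeB.
Variables N n : nat.
Hypothesis Nn : N = n + n.
Implicit Types (w x y z g h m : 'S_N) (i j k : 'I_N).
Variable Th : 'S_N -> 'S_N -> Prop.
Hypothesis congTh : wcongr true Th.
Hypothesis evenN : true -> ~~ odd N.
Variable up : nat -> bool.
Hypothesis ups : forall i, up (rev_ord i).+1 = ~~ up i.+1.

Hypothesis gens : forall e : 'I_N, 0 < e -> e.+1 < N -> ~~ up e.+1 ->
  exists g h, [/\ inW true g, inW true h, Th g h &
  [/\ forall i j, i < j -> g j < g i -> (i = e :> nat /\ j = e.+1 :> nat) \/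
        (i = N - e.+2 :> nat /\ j = N - e.+1 :> nat),
      forall i j, i.+1 = e -> j = e.+1 :> nat -> h j < h i &
      forall i j, i.+1 = e -> e.+1 = N - e.+1 -> j = e.+2 :> nat -> h j < h i]].

Section OneCover.
Variables (x : 'S_N) (a c : 'I_N).
Hypotheses (Wx : inW true x) (ac : a < c) (xac : x a = (x c).+1 :> nat).
Local Notation y := (cov evenN x c).

(* The positions are cut into three symmetric blocks by the descent [(a, c)] and its
   mirror image. *)
Definition thr : nat := minn (x c) (N - (x c).+2).
Definition blk i : nat := (thr < x i) + (N - thr.+1 <= x i).

Lemma x_rev i : x (rev_ord i) = N - (x i).+1 :> nat.
Proof. by have /symwP -> := Wx. Qed.

Lemma xc_bound : (x c).+1 < N. Proof. by rewrite -xac. Qed.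

Lemma blk_rev i : blk (rev_ord i) + blk i = 2.
Proof.
rewrite /blk x_rev; have := ltn_ord (x i); have := xc_bound.
by rewrite /thr; clear; lia.
Qed.

Lemma blk_le i j : blk j < blk i -> x j < x i.
Proof. by rewrite /blk; clear; lia. Qed.

Lemma blk_c_lt_a : blk c < blk a.
Proof. by rewrite /blk /thr xac; have := xc_bound; clear -Nn; lia. Qed.

Lemma blk_after i : x a < x i -> 0 < blk i.
Proof. by rewrite xac /blk /thr; clear; lia. Qed.

Section Witness.
Variables (e : 'I_N).
Hypotheses (ae : a < e) (ec : e < c) (he : x a < x e) (dn : ~~ up e.+1).
Local Notation r := (N - e.+1).

Lemma e_bounds : 0 < e /\ e.+1 < N.
Proof. by have := ltn_ord c; clear -ae ec; lia. Qed.

Lemma mid_blk : blk e = 1 ->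
  [/\ thr = x c, x e < N - (x c).+1 & x c + (x c).+2 <= N].
Proof. by move: he xc_bound; rewrite /blk /thr xac => h1 h2 h3; split; move: h1 h2 h3; clear; lia. Qed.

Lemma ord_r i : i = r :> nat -> i = rev_ord e.
Proof. by move=> h; apply: val_inj. Qed.

Lemma vblk_rev i : vblk e (rev_ord i) + vblk e i = 2.
Proof.
by rewrite /vblk /=; have := ltn_ord i; have := ltn_ord e; clear; lia.
Qed.

Lemma vblk_mono i j : i < j -> vblk e i <= vblk e j.
Proof. by rewrite /vblk; clear; lia. Qed.

Lemma y_keep i j : i < j -> vblk e i = vblk e j -> x j < x i -> y j < y i.
Proof.
move=> ij bij xji; case: (covP evenN Wx xac ij xji) => // [[ei ej]|[_ ei ej]].
  by move: bij; rewrite ei ej /vblk; clear -ae ec; lia.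
have h1 := vblk_rev a; have h2 := vblk_rev c; have := vblk_mono ac.
move: bij h1 h2; rewrite ei ej /vblk /=; clear -ae ec; lia.
Qed.

(** [contract_key] for the blocks [vblk e]; the two conditions on the inversions of [f] exclude the
    pairs that [closureB] does not provide. *)
Lemma contractB_key y' (f : 'I_N -> nat) (F : nat) :
  inW true y' -> wle y y' -> y' a < y' c ->
  (forall i, f (rev_ord i) + f i = F) ->
  (forall i j, i < j -> f j < f i ->
     (e == n :> nat) || (j != e :> nat) && (i != r :> nat)) ->
  (forall i j, i = r :> nat -> j = e :> nat -> ~~ (f j < f i)) ->
  (forall i j, i < j -> vblk e i = vblk e j -> f j < f i -> y' j < y' i) ->
  (forall z, inW true z -> (forall i j, i < j -> f j < f i -> z j < z i) ->
     wle y' z -> z c < z a) ->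
  Th y x.
Proof.
move=> Wy' yy' y'ac fs f1 f2 fy fz; have [e0 eN] := e_bounds.
have [g [h [Wg Wh gh [hg hh hh2]]]] := gens e0 eN dn.
apply: (contract_key (b := vblk e) (f := f) (B := 2) (F := F)
    congTh Wx ac xac Wg Wh gh (y' := y')) => //.
- by move=> _ i; apply: vblk_rev.
- by move=> i j; apply: vblk_mono.
- move=> i j ij /(hg _ _ ij)[] [e1 e2]; rewrite /vblk e1 e2; clear -Nn e0 eN; lia.
- move=> z Wz bz hz i j ij fij.
  apply: (closureB Nn e0 eN (implyP Wz isT) bz hz hh hh2 ij); first exact: f1 fij.
  by apply/negP => /andP[/eqP e1 /eqP e2]; have := f2 i j e1 e2; rewrite fij.
Qed.

(** The key [blk] suffices. If [e] is in the last block of positions, then [r] is in the first one,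
    so that [blk] cannot decrease along a pair ending at [e] or starting at [r]; if [e] is [n],
    [closureB] allows such pairs, other than [(r, e)]. *)
Lemma contractB1 : blk e = 2 \/ e = n :> nat -> Th y x.
Proof.
move=> H; have [e0 eN] := e_bounds.
apply: (@contractB_key y blk 2) => //.
- exact: (cov_inW evenN Wx xac).
- exact: (cov_ac evenN ac xac).
- exact: blk_rev.
- move=> i j ij fij; case: H => H; last by rewrite H eqxx.
  apply/orP; right; apply/andP; split; apply/eqP.
    by move/val_inj => e1; move: fij; rewrite e1 H /blk; clear; lia.
  by move/ord_r => e1; have := blk_rev e; move: fij; rewrite e1 H; clear; lia.
- move=> i j /ord_r -> /val_inj ->; have := blk_after he; have := blk_rev e; clear; lia.
- by move=> i j ij bij /blk_le; apply: y_keep.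
- by move=> z _ fz _; apply: fz => //; apply: blk_c_lt_a.
Qed.

(* In this case [y] itself does not allow to conclude: the labels with positions
   strictly between the two descents are first put in decreasing order. *)
Lemma contractB_low : e < n -> blk e = 1 -> Th y x.
Proof.
move=> en be; have [e0 eN] := e_bounds.
have [thrE xe tb] := mid_blk be.
have bw k : blk k <= 2 by rewrite /blk; clear; lia.
(* The label [e] gets a larger key than all smaller labels, and [r] a smaller key than all larger
   ones, so that no inversion of [f] ends at [e] or starts at [r]. Mirror labels have keys with sum
   6. *)
pose f i : nat := if i < e then (if blk i == 0 then 0 else 3) else
  if r < i then (if blk i == 2 then 6 else 3) else
  if i == e then 4 else if i == r :> nat then 2 else
  if blk i == 0 then 1 else if blk i == 2 then 5 else 3.
pose M (i : 'I_N) := ((x c).+2 < (x i).+1) && ((x i).+1 < N - (x c).+1).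
have yM i : M i -> y i = x i.
  move=> Mi; apply: val_inj; rewrite /= /cov permM swpE ?xc_bound // /swk.
  move: Mi; rewrite /M; move: (nat_of_ord (x i)) (nat_of_ord (x c)) => u t.
  by clear; repeat (case: eqP => ? /=; try lia).
have yNM i : ~~ M i -> (y i <= (x c).+1) || (N - (x c).+2 <= y i).
  rewrite /cov permM swpE ?xc_bound // /swk /M; have := ltn_ord (x i); have := xc_bound.
  move: (nat_of_ord (x i)) (nat_of_ord (x c)) => u t.
  by clear; repeat (case: eqP => ? /=; try lia).
have [y' hy'] : exists y' : 'S_N, forall i j,
    (y' i < y' j) = if M i && M j then j < i else y i < y j.
  apply: perm_of_order => [i|j i k|i j].
  - by case: ifP; rewrite ltnn.
  - case: (boolP (M i)) => Mi; case: (boolP (M j)) => Mj;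
      case: (boolP (M k)) => Mk /=; try (clear; lia).
    + move: (yNM k Mk) (yM _ Mi) (yM _ Mj) (Mi) (Mj); rewrite /M.
      by move=> h1 -> ->; move: h1; clear; lia.
    + move: (yNM j Mj) (yM _ Mi) (yM _ Mk) (Mi) (Mk); rewrite /M.
      by move=> h1 -> ->; move: h1; clear; lia.
    + move: (yNM i Mi) (yM _ Mk) (yM _ Mj) (Mk) (Mj); rewrite /M.
      by move=> h1 -> ->; move: h1; clear; lia.
  - move=> ij; rewrite (andbC (M j)); case: ifP => _; first by rewrite orbC -neq_ltn.
    by rewrite -neq_ltn (inj_eq val_inj) (inj_eq perm_inj).
have Wy : inW true y := cov_inW evenN Wx xac.
have Mrev i : M (rev_ord i) = M i.
  by rewrite /M x_rev; have := ltn_ord (x i); clear; lia.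
apply: (@contractB_key y' f 6) => //.
- apply: lt_symw => i j; rewrite !hy' !Mrev (andbC (M j)).
  case: ifP => _; last by rewrite symw_lt.
  by rewrite /=; have := ltn_ord i; clear; lia.
- by move=> i j ij h; rewrite hy'; case: ifP.
- rewrite hy' /M xac [X in X && _]andbC ltnn andbF /=.
  exact: (cov_ac evenN ac xac).
- move=> i; rewrite /f -!val_eqE /=.
  have := blk_rev i; have := bw i; have := ltn_ord i; have := ltn_ord e.
  move: (blk i) (blk _) => u v.
  by clear -Nn en; repeat (case: ifP => /=); lia.
- move=> i j ij fij; apply/orP; right; apply/andP; split; apply/negP => /eqP e1.
    move: fij ij; rewrite /f (val_inj e1) ltnn eqxx -!val_eqE /=.
    have -> : r < e = false by clear -Nn en; lia.
    by clear; repeat (case: ifP => /=); lia.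
  move: fij ij; rewrite /f (ord_r e1) -!val_eqE /= ltnn eqxx.
  have -> : r < e = false by clear -Nn en; lia.
  have -> : (r == e) = false by clear -Nn en; lia.
  by clear -Nn en; repeat (case: ifP => /=); lia.
- move=> i j /ord_r -> /val_inj ->; rewrite /f -!val_eqE /= !ltnn !eqxx.
  have -> : r < e = false by clear -Nn en; lia.
  by have -> : (r == e) = false by clear -Nn en; lia.
- move=> i j ij bij fij; rewrite hy'.
  have Mblk k : M k -> blk k = 1.
    by rewrite /M /blk thrE; clear -tb; lia.
  have blkM k : k != a -> k != rev_ord a -> blk k = 1 -> M k.
    move=> ka kra; rewrite /M /blk thrE.
    have : x k != x a by rewrite (inj_eq perm_inj).
    have : x k != x (rev_ord a) by rewrite (inj_eq perm_inj).
    rewrite -!val_eqE /= x_rev xac; clear -tb; lia.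
  have Y : blk j < blk i -> (if M j && M i then i < j else y j < y i).
    move=> h; case: ifP => [/andP[/Mblk h1 /Mblk h2]|_]; first by move: h; rewrite h1 h2.
    by apply: y_keep => //; apply: blk_le.
  case: (ltnP (blk j) (blk i)) => [/Y //|bji].
  have [h1 h2] : (e <= i <= r) /\ (e <= j <= r).
    move: fij bij bji ij; rewrite /f /vblk -!val_eqE /=.
    have := bw i; have := bw j; move: (blk i) (blk j) => u v.
    by clear -Nn en; repeat (case: ifP => /=); lia.
  have bsr : blk (rev_ord e) = 1 by have := blk_rev e; rewrite be; clear; lia.
  have MM : blk i = 1 /\ blk j = 1.
    move: fij bji; rewrite /f -!val_eqE /=.
    case: (eqVneq (i : nat) e) => [/val_inj ei|ei]; case: (eqVneq (i : nat) r) => [/ord_r ei2|ei2];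
    case: (eqVneq (j : nat) e) => [/val_inj ej|ej]; case: (eqVneq (j : nat) r) => [/ord_r ej2|ej2];
    rewrite ?ei ?ei2 ?ej ?ej2 ?be ?bsr; have := bw i; have := bw j;
    move: (blk i) (blk j) => u v; clear -Nn en h1 h2; repeat (case: ifP => /=); lia.
  have ka (k : 'I_N) : e <= k <= r -> (k != a) && (k != rev_ord a).
    rewrite -!val_eqE /=; have := ltn_ord c; clear -ae ec en; lia.
  have /andP[i1 i2] := ka i h1; have /andP[j1 j2] := ka j h2.
  by rewrite !blkM //; case: MM.
- move=> z Wz fz yz.
  have fa : f a = 3.
    rewrite /f ae; case: eqP => // h.
    by have := blk_c_lt_a; rewrite h; clear; lia.
  have bc : blk c = 0.
    by rewrite /blk thrE ltnn; have := he; rewrite xac; clear -xe; lia.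
  (* For [c] beyond [r] the keys of [a] and [c] agree; the inversion is then composed of [(a, r)],
     from [f], and [(r, c)], from [y']. *)
  case: (ltnP r c) => rc.
    apply: (@ltn_trans (z (rev_ord e))).
      apply: yz => /=; first by clear -rc; lia.
      have nMc : M c = false by rewrite /M; clear; lia.
      rewrite hy' nMc /=.
      case: (covP evenN Wx xac (_ : rev_ord e < c)) => //=.
      + by apply: blk_le; rewrite bc; have := blk_rev e; rewrite be; clear; lia.
      + by case=> e1 _; move: (congr1 val e1) => /=; clear -ae en Nn; lia.
      + case=> _ /(congr1 val) /= e1 /(congr1 val) /= e2.
        by move: e1 e2; have := ltn_ord c; clear -ae ec en; lia.
    apply: fz => /=; first by clear -ae en Nn; lia.
    rewrite fa /f /= -!val_eqE /= ltnn eqxx.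
    have -> : r < e = false by clear -Nn en; lia.
    by have -> : (r == e) = false by clear -Nn en; lia.
  apply: fz => //; rewrite fa /f bc -!val_eqE /=.
  have -> : c < e = false by clear -ec; lia.
  have -> : r < c = false by clear -rc; lia.
  have -> : (c == e :> nat) = false by clear -ec; lia.
  by case: ifP.
Qed.

(** The two central labels are mirror images, so exactly one of them is lower. Neither is in block 0
    and their blocks add up to 2, hence both are in the middle block; the lower one replaces [e]. *)
Lemma contractB_high : n < e -> blk e = 1 ->
  ~~ (r < a) -> (forall k : 'I_N, r < k -> k < e -> blk k != 0) ->
  exists e' : 'I_N, [/\ a < e', e' < c, x a < x e', ~~ up e'.+1 &
    (e' = n :> nat) \/ (e' < n /\ blk e' = 1)].
Proof.
move=> en be ra hk.
have [thrE xe tb] := mid_blk be.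
have eN := ltn_ord e.
have n1 : n < N by clear -Nn en eN; lia.
have n2 : n.-1 < N by clear -n1; lia.
have rv : rev_ord (Ordinal n1) = Ordinal n2.
  by apply: val_inj => /=; clear -Nn; lia.
have b1 : 0 < blk (Ordinal n1) by rewrite lt0n; apply: hk => /=; clear -Nn en eN; lia.
have b2 : 0 < blk (Ordinal n2) by rewrite lt0n; apply: hk => /=; clear -Nn en eN; lia.
have := blk_rev (Ordinal n1); rewrite rv => b12.
have after (k : 'I_N) : a < k -> blk k = 1 -> x a < x k.
  move=> ak bk; have : x k != x a by rewrite (inj_eq perm_inj) neq_ltn ak orbT.
  by move: bk; rewrite -val_eqE /= xac /blk thrE; clear -tb; lia.
have a1 : a < n.-1 by clear -ra Nn en eN; lia.
have := ups (Ordinal n1); rewrite rv => ue.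
case E: (up n.+1).
  exists (Ordinal n2); split => //=.
  - by clear -en ec; lia.
  - by apply: after => //; clear -b1 b2 b12; lia.
  - by move: ue; rewrite /= E => ->.
  - by right; split; clear -b1 b2 b12 en Nn eN; lia.
exists (Ordinal n1); split => //=.
- by clear -a1; lia.
- by clear -en ec; lia.
- by apply: after => /=; clear -a1 b1 b2 b12; lia.
- by rewrite E.
- by left.
Qed.

Lemma contractB_mid : n < e -> blk e = 1 ->
  r < a \/ (exists k : 'I_N, [/\ r < k, k < e & blk k = 0]) -> Th y x.
Proof.
move=> en be H; have [e0 eN] := e_bounds.
have [thrE xe tb] := mid_blk be.
have bw k : blk k <= 2 by rewrite /blk; clear; lia.
have br : blk (rev_ord e) = 1 by have := blk_rev e; rewrite be; clear; lia.
(* The extreme keys 4 of [e] and 0 of [r] prevent inversions of [f] ending at [e] or starting at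
   [r]. The labels strictly between [r] and [e] get a larger key than [c]: either [a] is one of
   them, or [k] is, and [k] already precedes [a] in [y]. *)
pose f i : nat := if i <= r then (if blk i == 2 then 3 else 0) else
  if i < e then 2 else if blk i == 0 then 1 else 4.
have Wy : inW true y := cov_inW evenN Wx xac.
apply: (@contractB_key y f 4) => //.
- exact: (cov_ac evenN ac xac).
- move=> i; rewrite /f /=.
  have := blk_rev i; have := bw i; have := ltn_ord i; have := ltn_ord e.
  move: (blk i) (blk _) => u v.
  by clear -Nn en; repeat (case: ifP => /=); lia.
- move=> i j ij fij; apply/orP; right; apply/andP; split; apply/negP => /eqP e1.
    move: fij; rewrite /f e1 (val_inj e1) be ltnn.
    have -> : e <= r = false by clear -Nn en; lia.
    by clear; repeat (case: ifP => /=); lia.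
  by move: fij; rewrite /f (ord_r e1) br /= leqnn ltn0.
- move=> i j /ord_r -> /val_inj ->; rewrite /f br be /= leqnn ltnn.
  by have -> : e <= r = false by clear -Nn en; lia.
- move=> i j ij bij fij; apply: y_keep => //; apply: blk_le.
  move: fij bij ij; rewrite /f /vblk.
  have := bw i; have := bw j; move: (blk i) (blk j) => u v.
  by clear -Nn en; repeat (case: ifP => /=); lia.
- move=> z Wz fz yz.
  have bc : blk c = 0.
    by rewrite /blk thrE ltnn; have := he; rewrite xac; clear -xe; lia.
  have fc : f c = 1.
    rewrite /f bc eqxx.
    have -> : c <= r = false by clear -Nn en ec; lia.
    by have -> : c < e = false by clear -ec; lia.
  case: (ltnP r a) => ra.
    apply: fz => //; rewrite fc /f ae.
    by have -> : a <= r = false by clear -ra; lia.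
  case: H => [|[k [rk ke bk]]]; first by rewrite ltnNge ra.
  have kc : k < c by apply: ltn_trans ec.
  have ak : a < k by apply: leq_ltn_trans rk.
  apply: (@ltn_trans (z k)).
    apply: fz => //; rewrite fc /f ke.
    by have -> : k <= r = false by clear -rk; lia.
  apply: yz => //.
  have xk : x k < x a.
    by move: bk; rewrite /blk thrE xac; clear; lia.
  case: (covP evenN Wx xac ak xk) => // [[_ e1]|[_ e1 e2]].
    by move: kc; rewrite e1 ltnn.
  have e3 : x a = N - (x c).+1 :> nat by rewrite e1 x_rev.
  by move: e3 xe he; clear; lia.
Qed.
End Witness.

Lemma contractB_down (e : 'I_N) : a < e -> e < c -> x a < x e -> ~~ up e.+1 -> Th y x.
Proof.
move=> ae ec he dn.
have : 0 < blk e by apply: blk_after.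
have : blk e <= 2 by rewrite /blk; clear; lia.
have low (k : 'I_N) : a < k -> k < c -> x a < x k -> ~~ up k.+1 ->
    k = n :> nat \/ (k < n /\ blk k = 1) -> Th y x.
  move=> ak kc xk uk [kn|[kn bk]]; first by apply: (@contractB1 k) => //; right.
  exact: (@contractB_low k).
case: (ltngtP (blk e) 1) => [|b2|b1]; first by clear; lia.
  by move=> h _; apply: (@contractB1 e) => //; left; clear -b2 h; lia.
case: (ltngtP e n) => [en|en|en] _ _; first exact: (@contractB_low e).
  have mid := contractB_mid ae ec he dn en b1.
  case: (ltnP (N - e.+1) a) => ra; first by apply: mid; left.
  case: (boolP [exists k : 'I_N, [&& N - e.+1 < k, k < e & blk k == 0]]).
    by case/existsP=> k /and3P[h1 h2 /eqP h3]; apply: mid; right; exists k.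
  move/existsPn => hk.
  have [|k h1 h2|e' [h1 h2 h3 h4 h5]] := contractB_high ec he en b1.
  - by rewrite -leqNgt.
  - by have := hk k; rewrite h1 h2.
  - exact: (low e').
by apply: (low e) => //; left.
Qed.
End OneCover.

(** A descent and its mirror image define the same cover, and mirroring turns an upper witness that
    comes early into a lower one that comes late. *)
Lemma contractB x (a c e : 'I_N) : inW true x -> a < c ->
  x a = (x c).+1 :> nat -> a < e -> e < c ->
  (if up e.+1 then x e < x c else x a < x e) -> Th (cov evenN x c) x.
Proof.
move=> Wx ac xac ae ec; case E: (up e.+1) => he; last first.
  by apply: (contractB_down Wx ac xac ae ec he); rewrite E.
have sx := implyP Wx isT.
have sw : cov evenN x c = cov evenN x (rev_ord a).
  have k1 : (x c).+1 < N by rewrite -xac.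
  have k2 : (x (rev_ord a)).+1 < N.
    by rewrite (x_rev Wx) xac; clear -k1; lia.
  apply/permP => i; apply: val_inj; rewrite /= !permM !swpE // (x_rev Wx) xac.
  have := ltn_ord (x i); rewrite /swk.
  move: k1; move: (nat_of_ord (x i)) (nat_of_ord (x c)) => u v; clear -Nn.
  by repeat (case: eqP => ? /=; try lia).
rewrite sw; apply: (@contractB_down _ (rev_ord c) _ _ _ _ (rev_ord e)) => //.
- by rewrite /=; have := ltn_ord c; clear -ac; lia.
- by rewrite !(x_rev Wx) xac; have := ltn_ord (x a); rewrite xac; clear; lia.
- by rewrite /=; have := ltn_ord c; clear -ec; lia.
- by rewrite /=; have := ltn_ord e; clear -ae; lia.
- by rewrite symw_lt.
- by rewrite ups E.
Qed.
End TypeB.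

(** * Cones of chords *)

Import Order.TTheory GRing.Theory Num.Theory.

Section Geometry.
Variables (R : realFieldType) (N : nat) (up : nat -> bool).
Hypothesis up0 : up 0 = false.
Hypothesis upN : up N.+1 = false.
Implicit Types (w : 'S_N) (i j k : 'I_N) (y : 'I_N -> R) (p q r s : 'I_(N + 2)).

Definition vdiag (p q : nat) : bool :=
  [&& p < q, [exists i : 'I_N, pre up p q i.+1] & [exists j : 'I_N, post up p q j.+1]].

Definition ltr y : rel 'I_N := fun i j => (y i < y j)%R.

Lemma tri_noncross (t : rel 'I_N) p q r s :
  (forall i j, t i j -> ~~ t j i) -> p < q -> r < s ->
  tri up t p q -> tri up t r s -> ~~ vcross up p q r s.
Proof.
move=> asym pq rs /triP t1 /triP t2; apply/negP => /(cross_witness pq rs).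
case=> i [j [[h1 h2 h3 h4] [a1 a2 a3 a4]]].
(* The witnesses are vertices. They are not the end vertices, which lie on the lower hull and thus
   belong to no [pre]. *)
have lab (v : nat) : p <= v <= q -> r <= v <= s -> pre up p q v || post up p q v ->
    pre up r s v || post up r s v -> exists i : 'I_N, i.+1 = v.
  have pN := ltn_ord p; have qN := ltn_ord q; have rN := ltn_ord r; have sN := ltn_ord s.
  move=> e1 e2 e3 e4; have v0 : 0 < v.
    rewrite lt0n; apply/negP => /eqP v0.
    move: e1 e2 a1 a2 a3 a4 h1 h2 h3 h4; rewrite v0 /pre /post => e1 e2.
    have p0 : p = 0 :> nat by lia. have r0 : r = 0 :> nat by lia.
    rewrite p0 r0 up0 /=; have := up_eq up i j; have := up_eq up i q; have := up_eq up i s.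
    have := up_eq up j q; have := up_eq up j s; have := up_eq up i 0; have := up_eq up j 0.
    rewrite up0; clear -qN sN pq rs p0 r0; lia.
  have vN : v <= N.
    rewrite leqNgt; apply/negP => vN.
    have qv : q = N.+1 :> nat by clear -e1 qN vN; lia.
    have sv : s = N.+1 :> nat by clear -e2 sN vN; lia.
    move: a1 a2 a3 a4 h1 h2 h3 h4; rewrite /pre /post qv sv upN /=.
    have := up_eq up i j; have := up_eq up i p; have := up_eq up i r.
    have := up_eq up j p; have := up_eq up j r; have := up_eq up i N.+1; have := up_eq up j N.+1.
    rewrite upN; clear -pN rN pq rs qv sv; lia.
  have vN' : v.-1 < N by rewrite prednK.
  by exists (Ordinal vN'); rewrite /= prednK.
have [i' ei] : exists i' : 'I_N, i'.+1 = i by apply: lab => //; rewrite ?a1 ?a2 ?orbT.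
have [j' ej] : exists i' : 'I_N, i'.+1 = j by apply: lab => //; rewrite ?a3 ?a4 ?orbT.
have h5 : t i' j' by apply: t1; rewrite ?ei ?ej.
have h6 : t j' i' by apply: t2; rewrite ?ei ?ej.
by have := asym _ _ h5; rewrite h6.
Qed.

Lemma level_set w (k : nat) : exists a : nat -> bool, [/\ a 0 = false, a N.+1 = false &
  forall i, a i.+1 = (w i <= k)].
Proof.
exists (fun v => [exists i : 'I_N, (i.+1 == v) && (w i <= k)]); split.
- by apply/existsP => -[i].
- by apply/existsP => -[i /andP[/eqP[e _]]]; have := ltn_ord i; rewrite e ltnn.
- move=> i; apply/existsP/idP => [[l /andP[/eqP[/val_inj->]]] //|h].
  by exists i; rewrite eqxx.
Qed.

(* The two triangles on both sides of the chord [p q] of the triangulation of [w]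
   have middle vertices [i] and [j]. *)
Lemma dual_pair w p q : vdiag p q -> tri up (ordr w) p q ->
  exists i j, [/\ pre up p q i.+1, post up p q j.+1, w i < w j &
    forall r s, vdiag r s -> tri up (ordr w) r s -> (p != r) || (q != s) ->
      below up r s i.+1 = below up r s j.+1].
Proof.
case/and3P => pq /existsP[i0 hi0] /existsP[j0 hj0] tw.
case: (@arg_maxnP _ i0 (fun i : 'I_N => pre up p q i.+1) (fun i => nat_of_ord (w i)) hi0) => i hi imax.
case: (@arg_minnP _ j0 (fun j : 'I_N => post up p q j.+1) (fun i => nat_of_ord (w i)) hj0) => j hj jmin.
have /triP tpq := tw; have wij : w i < w j := tpq _ _ hi hj.
exists i, j; split => // r s /and3P[rs /existsP[k0 hk0] _] trs ne.
apply/idP/idP; last first.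
  move=> bj; apply: noncross_below (pq) (rs) _ hi hj bj.
  apply: tri_noncross tw trs => // u v; rewrite /ordr; lia.
(* The path of the prefix ending with the last [pre] label [k] of [r s] contains [r s]. The cases
   below are those of [below_before], [below_after] and [below_same]. *)
case: (@arg_maxnP _ k0 (fun i : 'I_N => pre up r s i.+1) (fun i => nat_of_ord (w i)) hk0) => k hk kmax.
have /triP trs' := trs.
have [a [a0 aN aE]] := level_set w (w k).
have pre_lab (u v l : nat) : u < v -> v < N + 2 -> pre up u v l ->
    exists i : 'I_N, i.+1 = l.
  move=> uv vN h; have l0 : 0 < l.
    rewrite lt0n; apply/negP => /eqP e; move: h; rewrite e /pre.
    by have := up_eq up u 0; have := up_eq up v 0; rewrite up0; move: uv; clear; lia.
  have lN : l.-1 < N.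
    move: h; rewrite /pre; have := up_eq up u N.+1; have := up_eq up v N.+1; rewrite upN.
    by move: uv vN l0; clear; lia.
  by exists (Ordinal lN); rewrite /= prednK.
have post_lab (u v l : nat) : v < N + 2 -> post up u v l -> u < v ->
    ~~ a l \/ exists i : 'I_N, i.+1 = l.
  move=> vN h uv; case: (posnP l) => [->|l0]; first by left; rewrite a0.
  case: (eqVneq l N.+1) => [->|lN]; first by left; rewrite aN.
  have lN' : l.-1 < N by move: h uv vN l0 lN; rewrite /post; clear; lia.
  by right; exists (Ordinal lN'); rewrite /= prednK.
have e1 v : pre up r s v -> a v.
  move=> h; have [l el] := pre_lab _ _ _ rs (ltn_ord s) h; rewrite -el in h *.
  by rewrite aE; apply: kmax.
have e2 v : post up r s v -> ~~ a v.
  move=> h; have [//|[l el]] := post_lab _ _ _ (ltn_ord s) h rs; rewrite -el in h *.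
  by rewrite aE -ltnNge; apply: trs' hk h.
case: (leqP (w j) (w k)) => jk.
  apply: (below_before pq rs hi hj e2); last by rewrite aE.
  move=> v h; have [l el] := pre_lab _ _ _ pq (ltn_ord q) h; rewrite -el in h *.
  by rewrite aE; apply: leq_trans (ltnW (tpq _ _ h hj)) jk.
have d2 v : post up p q v -> ~~ a v.
  move=> h; have [//|[l el]] := post_lab _ _ _ (ltn_ord q) h pq; rewrite -el in h *.
  by rewrite aE -ltnNge; apply: leq_trans jk (jmin _ h).
case: (ltnP (w k) (w i)) => ik.
  by apply: (below_after pq rs hi hj e1 d2); rewrite aE -ltnNge.
apply: (below_same pq rs hi hj e1 e2 _ d2 ne).
move=> v h; have [l el] := pre_lab _ _ _ pq (ltn_ord q) h; rewrite -el in h *.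
by rewrite aE; apply: leq_trans (imax _ h) ik.
Qed.

End Geometry.

(** * Decomposition of vectors along chords *)

Section Fan.
Variables (R : realFieldType) (N : nat) (up : nat -> bool).
Hypothesis up0 : up 0 = false.
Hypothesis upN : up N.+1 = false.
Implicit Types (w : 'S_N) (i j k : 'I_N) (y : 'I_N -> R) (p q r s : 'I_(N + 2)).

Lemma pre_below (u v l : nat) : u < v -> pre up u v l -> below up u v l.
Proof. by rewrite /pre /below; clear; lia. Qed.

Lemma post_below (u v l : nat) : u < v -> post up u v l -> ~~ below up u v l.
Proof.
rewrite /post /below; have := up_eq up l u; have := up_eq up l v.
by clear; lia.
Qed.

Lemma sort_perm y w : exists w', forall i j,
  (w' i < w' j) = (y i < y j)%R || (y i == y j) && (w i < w j).
Proof.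
apply: perm_of_order => [i|j i k|i j].
- by rewrite ltxx ltnn andbF.
- case/orP => [h1|/andP[/eqP-> h1]]; case/orP => [h2|/andP[/eqP<- h2]].
  + by rewrite (lt_trans h1 h2).
  + by rewrite h1.
  + by rewrite h2.
  + by rewrite eqxx (ltn_trans h1 h2) orbT.
- move=> ij; case: (ltgtP (y i) (y j)) => //= _.
  by rewrite -neq_ltn (inj_eq val_inj) (inj_eq perm_inj).
Qed.

Lemma sort_perm_sym y w w' : symw w ->
  (forall i, y (rev_ord i) = - y i)%R ->
  (forall i j, (w' i < w' j) = (y i < y j)%R || (y i == y j) && (w i < w j)) ->
  symw w'.
Proof.
move=> sw ys h; apply: lt_symw => i j; rewrite !h !ys.
by rewrite ltrN2 eqr_opp symw_lt // [y j == _]eq_sym.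
Qed.

Definition isbelow p q i : R := (below up p q i.+1)%:R%R.

Definition comb (c : 'I_(N + 2) -> 'I_(N + 2) -> R) y := forall i j,
  (y j - y i = \sum_p \sum_q c p q * (isbelow p q i - isbelow p q j))%R.

(** An edge of the polygon has all labels on one side and contributes a constant, so that
    coefficients can be supported on [vdiag]. *)
Lemma below_nondiag p q i j : p < q -> ~~ vdiag N up p q ->
  below up p q i.+1 = below up p q j.+1.
Proof.
move=> pq; rewrite /vdiag pq /= negb_and.
have lab (v : nat) : 0 < v <= N -> exists k : 'I_N, k.+1 = v.
  move=> /andP[v0 vN]; have vN' : v.-1 < N by rewrite prednK.
  by exists (Ordinal vN'); rewrite /= prednK.
case/orP => /existsPn h.
  suff {i j} e i : below up p q i.+1 = false by rewrite !e.
  apply/negP => b; move: (h i) b; rewrite /below /pre => hi.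
  have iN := ltn_ord i; have qN := ltn_ord q.
  case: (ltnP i.+1 p) => ip.
    have [|k kp] := lab p; first by clear -ip pq qN; lia.
    by move: (h k) hi; rewrite kp /pre eqxx; clear -ip pq; lia.
  case: (ltnP q i.+1) => iq.
    have [|k kp] := lab q; first by clear -iq iN pq; lia.
    by move: (h k) hi; rewrite kp /pre eqxx; clear -iq pq; lia.
  by move: hi ip iq; clear; lia.
suff {i j} e i : below up p q i.+1 = true by rewrite !e.
apply/negPn/negP => b; move: (h i) b; rewrite /below /post => hi.
have iN := ltn_ord i; have qN := ltn_ord q.
case: (ltnP i.+1 p) => ip.
  have [|k kp] := lab p; first by clear -ip pq qN; lia.
  by move: (h k) hi; rewrite kp /post eqxx; clear -ip pq; lia.
case: (ltnP q i.+1) => iq.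
  have [|k kp] := lab q; first by clear -iq iN pq; lia.
  by move: (h k) hi; rewrite kp /post eqxx; clear -iq pq; lia.
by move: hi ip iq; have := up_eq up p i.+1; have := up_eq up q i.+1; clear; lia.
Qed.

(* Sort [y] and add up the paths of the initial segments, weighted by the jumps. *)
Lemma decomp y : exists c, [/\ forall p q, (0 <= c p q)%R,
  forall p q, ~~ vdiag N up p q -> c p q = 0%R,
  forall p q, vdiag N up p q -> (0 < c p q)%R = tri up (ltr y) p q & comb c y].
Proof.
have [w hw] := sort_perm y 1%g.
have yw i j : w i <= w j -> (y i <= y j)%R.
  by move=> h; rewrite leNgt; apply/negP => h2; have := hw j i; rewrite h2 /= ltnNge h.
(* The values of [y] in increasing order; the default is outside the range of the sums. *)
pose s (k : nat) : R := if insub k is Some o then y (w^-1%g o) else 0%R.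
have sE i : s (w i) = y i.
  by rewrite /s insubT //= => h; rewrite (_ : Sub _ _ = w i) ?permK //; apply: val_inj.
have smono (k : nat) : k.+1 < N -> (s k <= s k.+1)%R.
  move=> kN; have kN' : k < N by apply: ltnW.
  have := sE (w^-1 (Ordinal kN))%g; have := sE (w^-1 (Ordinal kN'))%g.
  by rewrite !permKV /= => -> ->; apply: yw; rewrite !permKV /=.
pose a (k : nat) : nat -> bool := fun v => [exists i : 'I_N, (i.+1 == v) && (w i <= k)].
have aE (k : nat) i : a k i.+1 = (w i <= k).
  apply/existsP/idP => [[l /andP[/eqP[/val_inj->]]] //|h].
  by exists i; rewrite eqxx.
pose c p q : R := (\sum_(0 <= k < N.-1)
   (s k.+1 - s k) * (vdiag N up p q && step N up (a k) p q)%:R)%R.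
have cterm p q (k : nat) : k < N.-1 -> (0 <= (s k.+1 - s k) * (vdiag N up p q && step N up (a k) p q)%:R)%R.
  by move=> kN; rewrite mulr_ge0 ?ler0n // subr_ge0 smono //; clear -kN; lia.
have stepE (k : nat) p q : p < q -> step N up (a k) p q ->
    (forall i, pre up p q i.+1 -> w i <= k) /\ (forall i, post up p q i.+1 -> k < w i).
  move=> pq /(step_pre_post _ up0 upN pq (ltn_ord q)) h; split=> i hi.
    by rewrite -aE; have [] := h i.+1 (ltn_ord i) => h1 _; apply: h1.
  by rewrite ltnNge -aE; have [] := h i.+1 (ltn_ord i) => _; apply.
exists c; split.
- by move=> p q; rewrite /c big_nat_cond sumr_ge0 // => k; rewrite andbT => /andP[_]; apply: cterm.
- by move=> p q /negbTE h; rewrite /c h big1 // => k _; rewrite mulr0.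
- move=> p q vd; have /and3P[pq /existsP[i0 hi0] /existsP[j0 hj0]] := vd.
  have -> : (0 < c p q)%R = (c p q != 0%R).
    rewrite lt_def andb_idr // => _.
    by rewrite /c big_nat_cond sumr_ge0 // => k; rewrite andbT => /andP[_]; apply: cterm.
  rewrite /c big_nat_cond psumr_neq0; last first.
    by move=> k; rewrite andbT => /andP[_]; apply: cterm.
  apply/hasP/triP => [[k]|].
    rewrite mem_index_iota andbT => kN; rewrite kN vd /=.
    case E: (step _ _ _ _ _); rewrite ?mulr1 ?mulr0 ?ltxx // subr_gt0 => sk i j hi hj.
    have [h1 h2] := stepE k p q pq E.
    have e1 : (y i <= s k)%R.
      have kN' : k < N by clear -kN; lia.
      have := sE (w^-1 (Ordinal kN'))%g; rewrite permKV /= => ->.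
      by apply: yw; rewrite permKV /=; apply: h1.
    have e2 : (s k.+1 <= y j)%R.
      have kN' : k.+1 < N by clear -kN; lia.
      have := sE (w^-1 (Ordinal kN'))%g; rewrite permKV /= => ->.
      by apply: yw; rewrite permKV /=; apply: h2.
    by apply: le_lt_trans e1 (lt_le_trans sk e2).
  move=> t.
  case: (@arg_maxnP _ i0 (fun i : 'I_N => pre up p q i.+1) (fun i => nat_of_ord (w i)) hi0) => i hi imax.
  case: (@arg_minnP _ j0 (fun j : 'I_N => post up p q j.+1) (fun i => nat_of_ord (w i)) hj0) => j hj jmin.
  have yij : (y i < y j)%R := t _ _ hi hj.
  have wij : w i < w j by rewrite hw yij.
  (* The values increase strictly from the last [pre] label to the first [post] label, so one of the
     jumps in between is positive. *)
  have : (0 < \sum_(w i <= k < w j) (s k.+1 - s k))%R.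
    by rewrite telescope_sumr ?sE ?subr_gt0 // ltnW.
  rewrite big_nat_cond => /lt0r_neq0; rewrite psumr_neq0; last first.
    move=> k; rewrite andbT => /andP[_ kj]; rewrite subr_ge0 smono //.
    exact: leq_ltn_trans kj (ltn_ord _).
  case/hasP => k; rewrite mem_index_iota => /andP[ik kj] /andP[_ sk].
  have kN : k < N.-1 by have := ltn_ord (w j); clear -kj; lia.
  exists k; rewrite ?mem_index_iota // andbT kN vd /=.
  suff -> : step N up (a k) p q by rewrite mulr1.
  apply/(step_pre_post _ up0 upN pq (ltn_ord q)) => v /andP[v0 vN].
  have vN' : v.-1 < N by rewrite prednK.
  have -> : v = (Ordinal vN').+1 by rewrite /= prednK.
  split=> hv; rewrite aE.
    exact: leq_trans (imax _ hv) ik.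
  by rewrite -ltnNge; apply: leq_trans kj (jmin _ hv).
- move=> i j.
  have E l : (\sum_p \sum_q c p q * isbelow p q l = \sum_(0 <= k < N.-1) (s k.+1 - s k) *
      (\sum_(p < N + 2) \sum_(q < N + 2) (vdiag N up p q && step N up (a k) p q && below up p q l.+1 : nat))%:R)%R.
    under eq_bigr do under eq_bigr do rewrite mulr_suml.
    under eq_bigr do rewrite exchange_big.
    rewrite exchange_big; apply: eq_bigr => k _ /=; rewrite natr_sum mulr_sumr.
    apply: eq_bigr => p _; rewrite natr_sum mulr_sumr; apply: eq_bigr => q _.
    by rewrite -mulrA -natrM mulnb.
  have -> : (\sum_p \sum_q c p q * (isbelow p q i - isbelow p q j) =
     \sum_p \sum_q c p q * isbelow p q i - \sum_p \sum_q c p q * isbelow p q j)%R.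
    rewrite -sumrB; apply: eq_bigr => p _; rewrite -sumrB; apply: eq_bigr => q _.
    by rewrite mulrBr.
  rewrite !E -sumrB.
  have D (k : nat) : k < N.-1 -> ((s k.+1 - s k) *
      (\sum_(p < N + 2) \sum_(q < N + 2) (vdiag N up p q && step N up (a k) p q && below up p q i.+1 : nat))%:R -
      (s k.+1 - s k) *
      (\sum_(p < N + 2) \sum_(q < N + 2) (vdiag N up p q && step N up (a k) p q && below up p q j.+1 : nat))%:R
      = (s k.+1 - s k) * (w i <= k)%:R - (s k.+1 - s k) * (w j <= k)%:R)%R.
    move=> kN; rewrite -!mulrBr; congr (_ * _)%R.
    (* The steps along edges contribute equally to all labels and are evaluated at [i] throughout,
       so that they cancel. *)
    have split_sum (l : 'I_N) : \sum_(p < N + 2) \sum_(q < N + 2) (step N up (a k) p q && below up p q l.+1) =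
       \sum_(p < N + 2) \sum_(q < N + 2) (vdiag N up p q && step N up (a k) p q && below up p q l.+1) +
       \sum_(p < N + 2) \sum_(q < N + 2) (~~ vdiag N up p q && step N up (a k) p q && below up p q i.+1).
      rewrite -big_split; apply: eq_bigr => p _; rewrite -big_split; apply: eq_bigr => q _ /=.
      case vd: (vdiag N up p q) => /=; first by rewrite addn0.
      case st: (step _ _ _ _ _) => //=.
      have pq : p < q by case/and4P: st.
      by rewrite (below_nondiag l i pq) ?vd.
    have hi := split_sum i; have hj := split_sum j.
    rewrite (sum_path_below (a k) up0 upN (ltn_ord i : 0 < i.+1 <= N)) aE in hi.
    rewrite (sum_path_below (a k) up0 upN (ltn_ord j : 0 < j.+1 <= N)) aE in hj.
    move: (\sum_p _) (\sum_p _) (\sum_p _) (\sum_p _) hi hj => A1 A2 A3 A4 h1 h2.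
    apply/eqP; rewrite subr_eq addrAC eq_sym subr_eq -!natrD eqr_nat.
    by clear -h1 h2; lia.
  have T (m : nat) : m <= N.-1 ->
      (\sum_(0 <= k < N.-1) (s k.+1 - s k) * (m <= k)%:R = s N.-1 - s m)%R.
    move=> mN; rewrite (big_cat_nat (leq0n m) mN) /=.
    rewrite big_nat_cond big1 ?add0r; last first.
      by move=> k; rewrite andbT => /andP[_]; rewrite ltnNge => /negbTE->; rewrite mulr0.
    rewrite -(telescope_sumr s mN); apply: eq_big_nat => k /andP[-> _].
    by rewrite mulr1.
  rewrite (eq_big_nat _ _ (D : forall k : nat, 0 <= k < N.-1 -> _)) sumrB.
  have hi : w i <= N.-1 by have := ltn_ord (w i); clear; lia.
  have hj : w j <= N.-1 by have := ltn_ord (w j); clear; lia.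
  have -> := T _ hi; have -> := T _ hj; rewrite !sE.
  by rewrite opprB [RHS]addrC addrA subrK.
Qed.

(** In [y j - y i] all chords of [T(w)] other than [p q] cancel by [dual_pair]. *)
Lemma dual_functional w p q : vdiag N up p q -> tri up (ordr w) p q ->
  exists i j, [/\ pre up p q i.+1, post up p q j.+1, w i < w j &
    forall c y, (forall r s, c r s != 0%R -> vdiag N up r s && tri up (ordr w) r s) ->
      comb c y -> (y j - y i = c p q)%R].
Proof.
move=> vd tw; have [i [j [hi hj wij dual]]] := dual_pair up0 upN vd tw.
have pq : p < q by case/and3P: vd.
exists i, j; split => // c y csup cy; rewrite cy.
rewrite (bigD1 p) //= [X in (_ + X)%R]big1 ?addr0; last first.
  move=> r rp; apply: big1 => s _; case: (eqVneq (c r s) 0%R) => [->|/csup/andP[h1 h2]].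
    by rewrite mul0r.
  rewrite /isbelow (dual r s h1 h2) ?subrr ?mulr0 //.
  by rewrite eq_sym rp.
rewrite (bigD1 q) //= [X in (_ + X)%R]big1 ?addr0; last first.
  move=> s sq; case: (eqVneq (c p s) 0%R) => [->|/csup/andP[h1 h2]].
    by rewrite mul0r.
  rewrite /isbelow (dual p s h1 h2) ?subrr ?mulr0 //.
  by rewrite [q == s]eq_sym sq orbT.
by rewrite /isbelow (pre_below pq hi) (negbTE (post_below pq hj)) subr0 mulr1.
Qed.

(** A chord with positive coefficient is a chord of [y], since the others contribute nonnegatively
    to the differences by [noncross_below]. Conversely, let [w] sort [y]: the chords of [c] are in
    [T(w)], and the dual functional of a chord of [y] equates its coefficient with a positive
    difference. *)
Lemma comb_tri c y : (forall p q, (0 <= c p q)%R) ->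
  (forall p q, ~~ vdiag N up p q -> c p q = 0%R) ->
  (forall p q r s, (0 < c p q)%R -> (0 < c r s)%R -> ~~ vcross up p q r s) ->
  comb c y -> forall p q, vdiag N up p q -> tri up (ltr y) p q = (0 < c p q)%R.
Proof.
move=> c0 cd cn cy.
have pos p q : (0 < c p q)%R -> vdiag N up p q.
  by move=> h; apply/negPn/negP => /cd e; rewrite e ltxx in h.
have geP p q : (0 < c p q)%R -> tri up (ltr y) p q.
  move=> cpq; have vd := pos _ _ cpq; have pq : p < q by case/and3P: vd.
  apply/triP => i j hi hj; rewrite /ltr -subr_gt0 cy.
  have ge r s : (0 <= c r s * (isbelow r s i - isbelow r s j))%R.
    have [crs|crs] := boolP (0 < c r s)%R; last first.
      have /eqP-> : c r s == 0%R by rewrite eq_le c0 andbT leNgt.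
      by rewrite mul0r.
    apply: mulr_ge0 => //; rewrite subr_ge0 ler_nat.
    have rs : r < s by case/and3P: (pos _ _ crs).
    have := noncross_below pq rs (cn _ _ _ _ cpq crs) hi hj.
    by case: (below _ _ _ j.+1) => // ->.
  rewrite (bigD1 p) //= (bigD1 q) //= -!addrA ltr_pwDl //.
    by rewrite /isbelow (pre_below pq hi) (negbTE (post_below pq hj)) subr0 mulr1.
  by rewrite addr_ge0 // sumr_ge0 // => r _; rewrite sumr_ge0.
move=> p q vd; apply/idP/idP; last exact: geP.
move=> t; have [w hw] := sort_perm y 1%g.
have tw r s : tri up (ltr y) r s -> tri up (ordr w) r s.
  by move=> /triP h; apply/triP => i j hi hj; rewrite /ordr hw; have := h _ _ hi hj; rewrite /ltr => ->.
have [i [j [hi hj wij dual]]] := dual_functional vd (tw _ _ t).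
rewrite -(dual c y) // ?subr_gt0.
  by move/triP: t; apply.
move=> r s crs; have h : (0 < c r s)%R by rewrite lt_def crs c0.
by rewrite (pos _ _ h) tw // geP.
Qed.

Lemma comb_below_le c y i j : (forall p q, (0 <= c p q)%R) -> comb c y ->
  (forall p q, (0 < c p q)%R -> below up p q j.+1 -> below up p q i.+1) ->
  (y i <= y j)%R.
Proof.
move=> c0 cy h; rewrite -subr_ge0 cy; apply: sumr_ge0 => p _; apply: sumr_ge0 => q _.
have [cpq|cpq] := boolP (0 < c p q)%R; last first.
  have /eqP-> : c p q == 0%R by rewrite eq_le c0 andbT leNgt.
  by rewrite mul0r.
apply: mulr_ge0 => //; rewrite subr_ge0 ler_nat.
by have := h _ _ cpq; case: (below _ _ _ j.+1) => // ->.
Qed.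

(** The positions of [w] form a vector decomposing along [T(w)]. The dual functional of a chord of
    [T(w')] is nonzero on it, as the positions are distinct; hence the chord has a positive
    coefficient and lies in [T(w)]. *)
Lemma tri_max w w' :
  (forall p q, vdiag N up p q -> tri up (ordr w) p q -> tri up (ordr w') p q) ->
  teq up w w'.
Proof.
move=> ww'.
have nd (p q : 'I_(N + 2)) (z : 'S_N) : p < q -> ~~ vdiag N up p q -> tri up (ordr z) p q.
  move=> pq; rewrite /vdiag pq /= => h; apply/triP => i j hi hj; case/negP: h.
  by apply/andP; split; apply/existsP; [exists i|exists j].
move=> p q pq qN; have pN : p < N + 2 by apply: ltn_trans qN.
pose p' := Ordinal pN; pose q' := Ordinal qN.
rewrite -[p]/(nat_of_ord p') -[q]/(nat_of_ord q').
have [vd|vd] := boolP (vdiag N up p' q'); last by rewrite !nd.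
apply/idP/idP; first exact: ww'.
move=> t'; have [i [j [hi hj wij dual]]] := dual_functional vd t'.
pose y i : R := (w i)%:R%R.
have tE r s : tri up (ltr y) r s = tri up (ordr w) r s.
  by apply/triP/triP => h u v hu hv; have := h u v hu hv; rewrite /ltr /ordr ltr_nat.
have [c [c0 cd ct cy]] := decomp y.
rewrite -tE -ct // lt_def c0 andbT -(dual c y _ cy).
  rewrite subr_eq0 eqr_nat; apply/eqP => /val_inj/perm_inj ji.
  by rewrite ji ltnn in wij.
move=> r s crs; have [h|h] := boolP (vdiag N up r s); last by rewrite cd // eqxx in crs.
by rewrite ww' // -tE -ct // lt_def crs c0.
Qed.
End Fan.

(** * From hull coordinates to the convex polygon *)

Section Polygon.
Variables (N : nat) (up : nat -> bool).
Hypothesis up0 : up 0 = false.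
Hypothesis upN : up N.+1 = false.
Implicit Types (p q r s u v : 'I_(N + 2)).

(* Counterclockwise order starting at the vertex [0]: first the lower hull from left
   to right, then the upper hull from right to left. *)
Definition prec (u v : nat) : bool :=
  (~~ up u && (up v || (u < v))) || [&& up u, up v & v < u].

Lemma pos_exists : exists f : 'S_(N + 2), forall u v, (f u < f v) = prec u v.
Proof.
apply: perm_of_order => [u|v u w|u v].
- by rewrite /prec; case: (up u); rewrite /= ?ltnn.
- by rewrite /prec; case: (up u); case: (up v); case: (up w) => /=; clear; lia.
- by rewrite -val_eqE /prec; case: (up u); case: (up v) => //=; clear; lia.
Qed.

Variable pos : 'S_(N + 2).
Hypothesis posE : forall u v, (pos u < pos v) = prec u v.

Definition code p q : 'I_(N + 2) * 'I_(N + 2) :=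
  if prec p q then (pos p, pos q) else (pos q, pos p).

Lemma prec_total p q : p < q -> prec q p = ~~ prec p q.
Proof. by rewrite /prec; case: (up p); case: (up q) => //=; clear; lia. Qed.

Lemma code_cross p q r s : p < q -> r < s ->
  crossing (code p q) (code r s) = vcross up p q r s.
Proof.
move=> pq rs; rewrite /crossing /code.
have := prec_total pq; have := prec_total rs.
case: ifP => h1; case: ifP => h2 /=; rewrite !posE; move: h1 h2; rewrite /prec /vcross;
have := up_eq up p r; have := up_eq up p s; have := up_eq up q r; have := up_eq up q s;
move: pq rs; clear; case: (up p); case: (up q); case: (up r); case: (up s) => /=; lia.
Qed.

Lemma code_lt p q : p < q -> (code p q).1 < (code p q).2.
Proof.
move=> pq; rewrite /code; case: ifP => h /=; rewrite posE //.
by rewrite prec_total // h.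
Qed.

Lemma code_inj p q r s : p < q -> r < s -> code p q = code r s -> p = r /\ q = s.
Proof.
move=> pq rs; rewrite /code; case: ifP => h1; case: ifP => h2 [/perm_inj e1 /perm_inj e2]; subst.
- by [].
- by move: pq rs; clear; lia.
- by move: pq rs; clear; lia.
- by [].
Qed.

Lemma code_surj (d : 'I_(N + 2) * 'I_(N + 2)) : d.1 < d.2 ->
  exists p q, p < q /\ code p q = d.
Proof.
case: d => x y /= xy; pose u := (pos^-1 x)%g; pose v := (pos^-1 y)%g.
have ex : pos u = x by rewrite permKV.
have ey : pos v = y by rewrite permKV.
case: (ltngtP u v) => [uv|vu|/val_inj e]; last by move: xy; rewrite -ex -ey e ltnn.
  by exists u, v; rewrite /code -posE ex ey xy.
exists v, u; rewrite /code -posE ex ey; split => //.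
by rewrite ltnNge (ltnW xy).
Qed.

Lemma is_diagE (x y : 'I_(N + 2)) : x < y -> is_diag (x, y) =
  [exists z : 'I_(N + 2), x < z < y] && [exists z : 'I_(N + 2), (z < x) || (y < z)].
Proof.
move=> xy; rewrite /is_diag /= xy /=; congr (_ && _).
  apply/idP/existsP => [h|[z]]; last by clear; lia.
  have xN : x.+1 < N + 2 by have := ltn_ord y; clear -xy; lia.
  by exists (Ordinal xN) => /=; move: xy h; clear; lia.
apply/idP/existsP => [h|[z]]; last by have := ltn_ord z; clear; lia.
have z0 : 0 < N + 2 by clear; lia.
have zN : N.+1 < N + 2 by clear; lia.
case: (posnP x) => x0; last by exists (Ordinal z0); rewrite /= x0.
by exists (Ordinal zN) => /=; move: h (ltn_ord y); rewrite x0; clear; lia.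
Qed.

Definition side p q (u : nat) : bool :=
  [|| up p && (u < p), up q && (q < u) | [&& ~~ up u, p < u & u < q]].

(** The vertices numbered between the endpoints are those on the lower side if the left endpoint is
    on the lower hull, and those on the upper side otherwise. *)
Lemma side_between p q u : p < q -> u != p -> u != q ->
  (if prec p q then prec p u && prec u q else prec q u && prec u p) =
  (side p q u (+) up p).
Proof.
rewrite -!val_eqE /= /prec /side => pq up' uq.
by case: (up p); case: (up q); case: (up u); rewrite ?addbT ?addbF /=; move: pq up' uq; clear;
  try case: ifP; lia.
Qed.

Lemma code_between p q (z : 'I_(N + 2)) :
  (code p q).1 < z < (code p q).2 =
  (if prec p q then prec p (pos^-1 z)%g && prec (pos^-1 z)%g q
   else prec q (pos^-1 z)%g && prec (pos^-1 z)%g p).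
Proof.
rewrite -!posE permKV /code posE; case: ifP => _ //=.
Qed.

Lemma code_outside p q (z : 'I_(N + 2)) : p < q ->
  (z < (code p q).1) || ((code p q).2 < z) =
  [&& (pos^-1 z)%g != p, (pos^-1 z)%g != q & ~~ ((code p q).1 < z < (code p q).2)].
Proof.
move=> pq; have lt := code_lt pq.
have E v : ((pos^-1 z)%g != v) = (z != pos v :> nat).
  by rewrite -[in RHS](permKV pos z) val_eqE (inj_eq perm_inj).
rewrite !E; move: lt; rewrite /code; case: ifP => _ /=; clear; lia.
Qed.

Lemma code_diag p q : p < q -> is_diag (code p q) = vdiag N up p q.
Proof.
move=> pq; rewrite [code p q]surjective_pairing is_diagE ?code_lt // /vdiag pq /=.
have pN := ltn_ord p; have qN := ltn_ord q.
have E : [exists z : 'I_(N + 2), (code p q).1 < z < (code p q).2] =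
   [exists u : 'I_(N + 2), [&& u != p, u != q & side p q u (+) up p]].
  apply/existsP/existsP => [[z hz]|[u /and3P[h1 h2 h3]]].
    exists (pos^-1 z)%g; move: (hz); rewrite code_between.
    have h1 : (pos^-1 z)%g != p.
      apply/eqP => e; move: hz; rewrite code_between e /prec.
      by case: (up p); case: (up q) => /=; move: pq; clear; try case: ifP; lia.
    have h2 : (pos^-1 z)%g != q.
      apply/eqP => e; move: hz; rewrite code_between e /prec.
      by case: (up p); case: (up q) => /=; move: pq; clear; try case: ifP; lia.
    by rewrite h1 h2 side_between.
  by exists (pos u); rewrite code_between permK side_between.
have F : [exists z : 'I_(N + 2), (z < (code p q).1) || ((code p q).2 < z)] =
   [exists u : 'I_(N + 2), [&& u != p, u != q & ~~ (side p q u (+) up p)]].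
  apply/existsP/existsP => [[z]|[u /and3P[h1 h2 h3]]].
    rewrite code_outside // => /and3P[h1 h2]; rewrite code_between side_between // => h3.
    by exists (pos^-1 z)%g; rewrite h1 h2.
  by exists (pos u); rewrite code_outside // permK h1 h2 code_between permK side_between.
have lab (v : nat) : 0 < v <= N -> exists k : 'I_N, k.+1 = v.
  move=> /andP[v0 vN]; have vN' : v.-1 < N by rewrite prednK.
  by exists (Ordinal vN'); rewrite /= prednK.
have z0 : 0 < N + 2 by clear; lia.
have zN : N.+1 < N + 2 by clear; lia.
have upl v : up v -> 0 < v <= N.
  have := up_eq up v 0; have := up_eq up v N.+1; rewrite up0 upN.
  by have := ltn_ord v; clear; lia.
have dnl v : p < v -> v < q -> 0 < v <= N by move: qN; clear; lia.
(* A side contains a further vertex iff the corresponding family of labels is nonempty: an endpoint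
   counted in the family guarantees that [0] or [N.+1] lies on that side, and vice versa. *)
have G (b : bool) : [exists u : 'I_(N + 2), [&& u != p, u != q & side p q u == b]] =
    if b then [exists i : 'I_N, pre up p q i.+1] else [exists j : 'I_N, post up p q j.+1].
  case: b.
    apply/existsP/existsP => [[u /and3P[h1 h2 /eqP h3]]|[i]].
      move: h1 h2 h3; rewrite -!val_eqE /side /= => h1 h2 /or3P[/andP[a b]|/andP[a b]|/and3P[a b c]].
      - by have [k e] := lab _ (upl _ a); exists k; rewrite e /pre a eqxx.
      - by have [k e] := lab _ (upl _ a); exists k; rewrite e /pre a eqxx orbT.
      - by have [k e] := lab _ (dnl _ b c); exists k; rewrite e /pre a b c !orbT.
    case/or3P => [/andP[a /eqP b]|/andP[a /eqP b]|/and3P[a b c]].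
    - exists (Ordinal z0); rewrite -!val_eqE /side a /=.
      by have := upl _ a; move: pq; clear; lia.
    - exists (Ordinal zN); rewrite -!val_eqE /side a /=.
      by have := upl _ a; move: pq; clear; lia.
    - have iN : i.+1 < N + 2 by have := ltn_ord i; clear; lia.
      by exists (Ordinal iN); rewrite -!val_eqE /side /= a b c !orbT; move: b c; clear; lia.
  apply/existsP/existsP => [[u /and3P[h1 h2 /eqP h3]]|[i]].
    move: h1 h2 h3; rewrite -!val_eqE /side /=.
    case: (ltngtP u p) => // [ap _ h2 h3|pu _ h2 h3].
      have pl : 0 < p <= N by move: ap pq qN; clear; lia.
      have [k e] := lab _ pl; exists k; rewrite e /post eqxx.
      by move: h3 ap; clear; lia.
    case: (ltngtP u q) h2 => // [uq _|qu _].
      have [k e] := lab _ (dnl _ pu uq); exists k; rewrite e /post pu uq.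
      by move: h3 pu uq; clear; lia.
    have ql : 0 < q <= N by move: qu pq (ltn_ord u); clear; lia.
    have [k e] := lab _ ql; exists k; rewrite e /post eqxx.
    by move: h3 qu; clear; lia.
  case/or3P => [/andP[a /eqP b]|/andP[a /eqP b]|/and3P[a b c]].
  - exists (Ordinal z0); rewrite -!val_eqE /side /= (negbTE a) up0 /=.
    by move: b pq; clear; lia.
  - exists (Ordinal zN); rewrite -!val_eqE /side /= (negbTE a) upN /=.
    by move: b pq (ltn_ord i); clear; lia.
  - have iN : i.+1 < N + 2 by have := ltn_ord i; clear; lia.
    exists (Ordinal iN); rewrite -!val_eqE /side /= a /=; move: b c; clear; lia.
have Gt := G true; have Gf := G false.
rewrite E F -Gt -Gf; case: (up p).
  rewrite andbC; congr (_ && _); apply: eq_existsb => u; by case: (side p q u).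
by congr (_ && _); apply: eq_existsb => u; case: (side p q u).
Qed.

Section HalfTurn.
Hypothesis evenN : ~~ odd N.
Hypothesis ups : forall v : nat, 0 < v <= N -> up (N.+1 - v) = ~~ up v.

(** The first half in counterclockwise order; [N.+1] opens the second half. *)
Let lower v := ~~ up v && (v != N.+1 :> nat).

Lemma rev_val v : rev_ord v = N.+1 - v :> nat.
Proof. by rewrite /=; clear; lia. Qed.

Lemma lower_rev v : lower (rev_ord v) = ~~ lower v.
Proof.
rewrite /lower rev_val; case: (posnP v) => [->|v0].
  by rewrite subn0 upN up0 eqxx.
case: (eqVneq (v : nat) N.+1) => [->|vN].
  by rewrite subnn up0 andbF.
have vN' : v <= N by move: vN (ltn_ord v); clear; lia.
rewrite ups ?v0 // andbT negbK; case: (up v) => //=.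
by apply/eqP; move: v0; clear; lia.
Qed.

Lemma card_lower : #|[set u | lower u]| = (N + 2)./2.
Proof.
have e : #|[set u | ~~ lower u]| = #|[set u | lower u]|.
  rewrite -(card_imset _ (@rev_ord_inj (N + 2))); apply: eq_card => u; rewrite !inE.
  apply/imsetP/idP => [[v]|lu]; first by rewrite inE => h ->; rewrite lower_rev.
  by exists (rev_ord u); rewrite ?rev_ordK // inE lower_rev lu.
have := cardsC [set u | lower u]; rewrite card_ord.
have -> : #|~: [set u | lower u]| = #|[set u | ~~ lower u]|.
  by apply: eq_card => u; rewrite !inE.
by rewrite e addnn => /(congr1 half); rewrite doubleK.
Qed.

(** By counting predecessors: those of [rev_ord v] are the whole lower half and the mirror images of
    the predecessors of [v]. *)
Lemma pos_rev_lower v : lower v -> pos (rev_ord v) = pos v + (N + 2)./2 :> nat.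
Proof.
move=> lv; have e1 := card_ltn_perm pos (rev_ord v); have e2 := card_ltn_perm pos v.
rewrite -e1 -e2 -card_lower [RHS]addnC.
rewrite -(cardsID [set u | lower u] [set j | pos j < pos (rev_ord v)]); congr (_ + _).
  apply: eq_card => u; rewrite !inE posE; apply: andb_idl => /andP[/negbTE nu uN].
  move: lv; rewrite -[v]rev_ordK lower_rev rev_ordK negb_and negbK /lower /prec nu /=.
  case: (up _) => //=; move: uN (ltn_ord u) (ltn_ord v); clear; lia.
rewrite -[RHS](card_imset _ (@rev_ord_inj (N + 2))); apply: eq_card => u; rewrite !inE posE.
have P u' : lower u' -> prec (rev_ord u') (rev_ord v) = prec u' v.
  move: lv; rewrite /lower /prec !rev_val.
  case: (posnP v) => [->|v0]; case: (posnP u') => [->|u0].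
  - by rewrite !subn0 upN up0 !ltnn.
  - case: (eqVneq (u' : nat) N.+1) => [->|uN]; first by rewrite andbF.
    rewrite !subn0 upN up0 ups ?u0 /=; last by move: uN (ltn_ord u'); clear; lia.
    by case: (up u') => //= _ _; clear; lia.
  - case: (eqVneq (v : nat) N.+1) => [->|vN]; first by rewrite andbF.
    rewrite !subn0 upN up0 ups ?v0 /=; last by move: vN (ltn_ord v); clear; lia.
    by case: (up v) => //= _ _; rewrite v0.
  - case: (eqVneq (v : nat) N.+1) => [->|vN]; first by rewrite andbF.
    case: (eqVneq (u' : nat) N.+1) => [->|uN]; first by rewrite andbF.
    have vl : 0 < v <= N by move: vN v0 (ltn_ord v); clear; lia.
    have ul : 0 < u' <= N by move: uN u0 (ltn_ord u'); clear; lia.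
    rewrite (ups vl) (ups ul); move: vl ul; clear.
    by case: (up v); case: (up u') => //=; lia.
rewrite andbC; apply/andP/imsetP => [[h1 h2]|[u' h ->]].
  have lu : lower (rev_ord u) by rewrite lower_rev.
  by exists (rev_ord u); rewrite ?rev_ordK // inE posE -P // rev_ordK.
move: h; rewrite inE posE => h.
have lu : lower u'.
  move: lv h; rewrite /lower /prec => /andP[/negbTE-> vN].
  by case: (up u') => //=; rewrite ?andbF //= orbF; move: vN (ltn_ord v); clear; lia.
by rewrite lower_rev lu P.
Qed.

Lemma pos_rev v : rot_half (N + 2) (pos v) = pos (rev_ord v).
Proof.
rewrite /rot_half; case lv: (lower v).
  by have := pos_rev_lower lv => <-; rewrite modn_small.
have lr : lower (rev_ord v) by rewrite lower_rev lv.
have := pos_rev_lower lr; rewrite rev_ordK => ->.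
rewrite -addnA addnn; have -> : (N + 2)./2.*2 = N + 2.
  by rewrite -[RHS]odd_double_half oddD (negbTE evenN).
by rewrite modnDr modn_small.
Qed.

Lemma code_rev p q : p < q ->
  ((code (rev_ord q) (rev_ord p)).1 : nat, (code (rev_ord q) (rev_ord p)).2 : nat) =
  (minn (rot_half (N + 2) (code p q).1) (rot_half (N + 2) (code p q).2),
   maxn (rot_half (N + 2) (code p q).1) (rot_half (N + 2) (code p q).2)).
Proof.
move=> pq.
have E (b : bool) (x y : 'I_(N + 2)) : rot_half (N + 2) (if b then (x, y) else (y, x)).1 =
   if b then rot_half (N + 2) x else rot_half (N + 2) y by case: b.
have F (b : bool) (x y : 'I_(N + 2)) : rot_half (N + 2) (if b then (x, y) else (y, x)).2 =
   if b then rot_half (N + 2) y else rot_half (N + 2) x by case: b.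
rewrite /code E F !pos_rev -posE.
case: (prec p q); case: ltngtP; rewrite ?minnE ?maxnE //=; clear.
all: move: (nat_of_ord (pos _)) (nat_of_ord (pos _)) => x y *; congr (_, _); lia.
Qed.
End HalfTurn.
End Polygon.

(** * The Coxeter weak order as containment of inversions *)

Section SwapMore.
Variables (N : nat) (sy : bool).
Hypothesis evenN : sy -> ~~ odd N.

Lemma evenE : sy -> exists n, N = n + n.
Proof.
by move=> s; exists N./2; rewrite -[LHS]odd_double_half (negbTE (evenN s)) -addnn.
Qed.

Lemma swk_flip k u v : k.+1 < N -> u < v -> v < N ->
  ~~ (swk N sy k u < swk N sy k v) -> swk N sy k u = v.
Proof.
move=> kN uv vN h.
have vu : swk N sy k v < swk N sy k u.
  rewrite -leqNgt in h.
  have : swk N sy k v != swk N sy k u.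
    apply/eqP => e; have := swkK evenN kN vN; rewrite e swkK //; last exact: ltn_trans uv vN.
    by move=> e2; rewrite e2 ltnn in uv.
  by move: h; clear; lia.
move: vu; rewrite swk_lt // => /orP[/andP[/eqP-> /eqP->]|/and3P[s /eqP-> /eqP->]].
  by rewrite /swk eqxx.
have [n Nn] := evenE s; rewrite /swk s /=; move: kN; clear -Nn.
by repeat (case: eqP => ? /=; try lia).
Qed.

Lemma swk_pair k x y z : k.+1 < N -> x < N -> swk N sy k x = y -> x <> y ->
  swk N sy k z = if z == x then y else if z == y then x
    else if sy && (z == N - x.+1) then N - y.+1
    else if sy && (z == N - y.+1) then N - x.+1 else z.
Proof.
move=> kN xN <- {y}; case s: sy; last first.
  by rewrite /swk /=; do 2?(case: eqP => ? /=); repeat (case: eqP => ? /=; try lia).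
have [n Nn] := evenE s; rewrite [X in x <> X]/swk /=.
case: eqP => [->|n1].
  move=> _; have -> : swk N true k k = k.+1 by rewrite /swk eqxx.
  by rewrite /swk /=; clear -Nn kN; repeat (case: eqP => ? /=; try lia).
case: eqP => [->|n2].
  move=> _; have -> : swk N true k k.+1 = k.
    by rewrite /swk eqxx; case: eqP => //; lia.
  by rewrite /swk /=; clear -Nn kN; repeat (case: eqP => ? /=; try lia).
case: eqP => [e|n3].
  have -> : swk N true k x = N - k.+2.
    by rewrite /swk /= e; clear -Nn kN n1 n2 e; repeat (case: eqP => ? /=; try lia).
  move=> _; rewrite e /swk /=; clear -Nn kN n1 n2 e; repeat (case: eqP => ? /=; try lia).
case: eqP => [e|n4] //.
have -> : swk N true k x = N - k.+1.
  by rewrite /swk /= e; clear -Nn kN n1 n2 e n3; repeat (case: eqP => ? /=; try lia).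
by move=> _; rewrite e /swk /=; clear -Nn kN n1 n2 n3 e; repeat (case: eqP => ? /=; try lia).
Qed.

Lemma inW1 : inW sy (1%g : 'S_N).
Proof. by apply/implyP => _; apply/symwP => i; rewrite !perm1. Qed.

Lemma inWM (x y : 'S_N) : inW sy x -> inW sy y -> inW sy (x * y)%g.
Proof.
move=> /implyP hx /implyP hy; apply/implyP => s; apply/symwP => i.
by rewrite !permM (symwP _ (hx s)) (symwP _ (hy s)).
Qed.

Lemma inWV (x : 'S_N) : inW sy x -> inW sy (x^-1)%g.
Proof.
move=> /implyP hx; apply/implyP => s; apply/symwP => i.
by apply: (@perm_inj _ x); rewrite (symwP _ (hx s)) !permKV.
Qed.

Lemma swp_inW1 k : k.+1 < N -> inW sy (swp evenN k).
Proof. by move=> kN; rewrite -[swp _ _]mul1g; apply: swp_inW kN inW1. Qed.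

Lemma swp_sq k : k.+1 < N -> (swp evenN k * swp evenN k)%g = 1%g.
Proof.
move=> kN; apply/permP => i; apply: val_inj.
by rewrite /= permM !swpE // swkK // perm1.
Qed.
End SwapMore.

Lemma bigminn_le (I : eqType) (r : seq I) (P : pred I) (F : I -> nat) (x : nat) k :
  k \in r -> P k -> \big[minn/x]_(i <- r | P i) F i <= F k.
Proof.
elim: r => // a r IH; rewrite inE big_cons => /orP[/eqP<-|kr] Pk.
  by rewrite Pk geq_minl.
by case: ifP => _; rewrite ?geq_min IH ?orbT.
Qed.

Section WeakOrder.
Variables (gT : finGroupType) (W S : {set gT}) (N : nat) (sy : bool).
Hypothesis evenN : sy -> ~~ odd N.
Variable phi : gT -> 'S_N.
Hypothesis phiM : forall x y, phi (x * y)%g = (phi x * phi y)%g.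
Hypothesis phi_inj : injective phi.
Hypothesis WE : forall x, (x \in W) = inW sy (phi x).
Hypothesis S_swap : forall s, s \in S -> exists k, k.+1 < N /\ phi s = swp evenN k.
Hypothesis swap_S : forall k, k.+1 < N -> exists s, s \in S /\ phi s = swp evenN k.
Implicit Types (w x y t s : gT) (i j : 'I_N).

Lemma phi1 : phi 1%g = 1%g.
Proof. by apply: (mulgI (phi 1%g)); rewrite -phiM !mulg1. Qed.

Lemma phiV x : phi (x^-1)%g = (phi x)^-1%g.
Proof. by apply: (mulgI (phi x)); rewrite -phiM !mulgV phi1. Qed.

Lemma W1 : 1%g \in W. Proof. by rewrite WE phi1; apply: inW1. Qed.

Lemma WM x y : x \in W -> y \in W -> (x * y)%g \in W.
Proof. by rewrite !WE phiM; apply: inWM. Qed.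

Lemma WV x : x \in W -> (x^-1)%g \in W.
Proof. by rewrite !WE phiV; apply: inWV. Qed.

Lemma S_W s : s \in S -> s \in W.
Proof. by case/S_swap => k [kN e]; rewrite WE e; apply: swp_inW1. Qed.

Lemma S_sq s : s \in S -> (s * s)%g = 1%g.
Proof. by case/S_swap => k [kN e]; apply: phi_inj; rewrite phiM e swp_sq // phi1. Qed.

Lemma refl_W t : t \in refl W S -> t \in W.
Proof.
case/imset2P => s u sS uW ->; rewrite conjgE; apply: WM; first exact: WV.
by apply: WM => //; apply: S_W.
Qed.

Lemma refl_sq t : t \in refl W S -> (t * t)%g = 1%g.
Proof. by case/imset2P => s u sS uW ->; rewrite -conjMg S_sq // conj1g. Qed.

Lemma refl_val t i j : t \in refl W S -> i != j -> phi t i = j -> forall v : 'I_N,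
  phi t v = if v == i then j else if v == j then i
    else if sy && (v == rev_ord i) then rev_ord j
    else if sy && (v == rev_ord j) then rev_ord i else v.
Proof.
case/imset2P => s u sS uW -> ij; have [k [kN es]] := S_swap sS.
rewrite conjgE !phiM phiV es => tij v.
have symu : sy -> symw (phi u)^-1%g.
  by move=> h; apply: (implyP (inWV _) h); rewrite -WE.
set a := (phi u)^-1%g in tij symu *.
have E l : (a * (swp evenN k * phi u))%g l = (a^-1)%g (swp evenN k (a l)).
  by rewrite !permM /a invgK.
rewrite mulgA in tij *; rewrite -mulgA in tij *; rewrite E in tij *.
have aij : swk N sy k (a i) = a j.
  by rewrite -(swpE evenN _ kN) -tij permKV.
have ne : nat_of_ord (a i) <> a j by move/val_inj/perm_inj => e; rewrite e eqxx in ij.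
have aeq (x y : 'I_N) : ((a x : nat) == a y) = (x == y) by rewrite val_eqE (inj_eq perm_inj).
apply: (@perm_inj _ a); rewrite E permKV; apply: val_inj => /=.
rewrite swpE // (swk_pair evenN _ kN (ltn_ord _) aij ne) !aeq.
case: eqP => // _; case: eqP => // _.
case: (boolP sy) => s1 //=.
have ar (x : 'I_N) : N - (a x).+1 = a (rev_ord x) by rewrite (symwP _ (symu s1)).
by rewrite !ar !aeq; case: eqP => // _; case: eqP.
Qed.

Lemma refl_pair t : t \in refl W S -> exists i j, i < j /\ phi t i = j.
Proof.
move=> tr; have := tr; case/imset2P => s u sS uW e; have [k [kN es]] := S_swap sS.
have kN' : k < N by apply: ltnW.
pose i := phi u (Ordinal kN'); pose j := phi u (Ordinal kN).
have tij : phi t i = j.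
  rewrite e conjgE !phiM phiV es !permM permK /j; congr (phi u _).
  by apply: val_inj; rewrite /= swpE //= /swk eqxx.
have ij : i != j by rewrite (inj_eq perm_inj) -val_eqE /= neq_ltn ltnSn.
case: (ltngtP i j) => [lt|lt|/val_inj e2]; last by rewrite e2 eqxx in ij.
  by exists i, j.
exists j, i; split => //; rewrite (refl_val tr ij tij) eqxx.
by case: eqP => // e2; rewrite e2 eqxx in ij.
Qed.

(** The combinatorial counterpart of [t] shortening [w]; by [tinvE] any pair exchanged by [t] may be
    used for the test. *)
Definition tinv w t : bool :=
  [exists i : 'I_N, exists j : 'I_N, [&& i < j, phi t i == j & phi w j < phi w i]].

Lemma tinvE w t i j : w \in W -> t \in refl W S -> i < j -> phi t i = j ->
  tinv w t = (phi w j < phi w i).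
Proof.
move=> wW tr ij tij; apply/existsP/idP => [[i' /existsP[j' /and3P[ij' /eqP tij' h]]]|h].
  have ne : i != j by rewrite neq_ltn ij.
  move: tij'; rewrite (refl_val tr ne tij).
  case: eqP => [e1 e2|_]; first by rewrite e1 -e2 in h.
  case: eqP => [e1 e2|_]; first by move: ij'; rewrite e1 -e2; clear -ij; lia.
  case: (boolP sy) => s /=; last by move=> e; rewrite e ltnn in ij'.
  have := wW; rewrite WE => /implyP/(_ s) sw.
  case: eqP => [e1 e2|_].
    by move: ij'; rewrite e1 -e2 /=; have := ltn_ord j; clear -ij; lia.
  case: eqP => [e1 e2|_ e]; last by rewrite e ltnn in ij'.
  by move: h; rewrite e1 -e2 symw_lt.
by exists i; apply/existsP; exists j; rewrite ij tij eqxx.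
Qed.

Lemma refl_eq t t' i j : t \in refl W S -> t' \in refl W S -> i != j ->
  phi t i = j -> phi t' i = j -> t = t'.
Proof.
move=> tr tr' ij e e'; apply: phi_inj; apply/permP => v.
by rewrite (refl_val tr ij e) (refl_val tr' ij e').
Qed.

Lemma conj_refl w s : w \in W -> s \in S -> (w * s * w^-1)%g \in refl W S.
Proof.
move=> wW sS; apply/imset2P; exists s (w^-1)%g => //; first exact: WV.
by rewrite conjgE invgK mulgA.
Qed.

Lemma flip_conj w s i j : w \in W -> s \in S -> i < j ->
  (phi (w * s)%g j < phi (w * s)%g i) != (phi w j < phi w i) ->
  phi (w * s * w^-1)%g i = j.
Proof.
move=> wW sS ij; have [k [kN es]] := S_swap sS.
rewrite !phiM phiV es !permM => h.
have ne : phi w i != phi w j by rewrite (inj_eq perm_inj) neq_ltn ij.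
suff -> : swp evenN k (phi w i) = phi w j by rewrite permK.
apply: val_inj => /=; rewrite swpE //; move: h; rewrite !swpE //.
case: (ltngtP (phi w i) (phi w j)) => [lt|gt|/val_inj e]; last by rewrite e eqxx in ne.
  rewrite eqbF_neg negbK => h; apply: swk_flip => //.
  by rewrite -leqNgt ltnW.
rewrite eqb_id => h.
have e : swk N sy k (phi w j) = phi w i by apply: swk_flip.
by rewrite -e swkK.
Qed.

(** Multiplication by [s] exchanges two adjacent positions, so only the pair of labels standing
    there, up to mirror image, changes its order. *)
Lemma tinv_flip w s t : w \in W -> s \in S -> t \in refl W S ->
  tinv (w * s)%g t != tinv w t -> t = (w * s * w^-1)%g.
Proof.
move=> wW sS tr; have [i [j [ij tij]]] := refl_pair tr.
rewrite (tinvE (WM wW (S_W sS)) tr ij tij) (tinvE wW tr ij tij) => h.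
have ne : i != j by rewrite neq_ltn ij.
by apply: (refl_eq tr (conj_refl wW sS) ne tij); apply: flip_conj.
Qed.

Lemma tinv_mul w t : w \in W -> t \in refl W S -> tinv (t * w)%g t = ~~ tinv w t.
Proof.
move=> wW tr; have [i [j [ij tij]]] := refl_pair tr.
have tW := refl_W tr; have ne : i != j by rewrite neq_ltn ij.
rewrite (tinvE (WM tW wW) tr ij tij) (tinvE wW tr ij tij) phiM !permM tij.
have -> : phi t j = i.
  by rewrite (refl_val tr ne tij) eqxx; case: eqP => // e; rewrite e eqxx in ne.
by rewrite perm_lt_total.
Qed.

Lemma tinv1 t : ~~ tinv 1%g t.
Proof.
apply/existsP => -[i /existsP[j /and3P[ij _]]]; rewrite phi1 !perm1.
by move: ij; clear; lia.
Qed.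

Definition isword (l : seq gT) w : Prop := all (mem S) l /\ (\prod_(x <- l) x)%g = w.

Lemma word_W l w : isword l w -> w \in W.
Proof.
case=> lS <-; elim: l lS => [|s l IH] /=; first by rewrite big_nil W1.
by case/andP=> sS lS; rewrite big_cons; apply: WM; [apply: S_W|apply: IH].
Qed.

Lemma word_rcons l w s : isword l w -> s \in S -> isword (rcons l s) (w * s)%g.
Proof. by case=> lS e sS; split; [rewrite all_rcons lS andbT | rewrite big_rcons /= e]. Qed.

(* The strong exchange property. *)
Lemma word_del l w t : isword l w -> t \in refl W S -> tinv w t ->
  exists l', isword l' (t * w)%g /\ (size l').+1 = size l.
Proof.
move=> + tr; elim/last_ind: l w => [|l s IH] w [].
  by rewrite big_nil => _ <-; rewrite (negbTE (tinv1 t)).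
rewrite all_rcons big_rcons => /andP[sS lS] <- h.
pose w' := (\prod_(x <- l) x)%g; have lw' : isword l w' by [].
have w'W := word_W lw'.
have [h1|h1] := boolP (tinv w' t).
  have [l' [hl' sl']] := IH w' lw' h1.
  exists (rcons l' s); rewrite !size_rcons -sl'; split => //.
  by rewrite mulgA; apply: word_rcons.
exists l; rewrite size_rcons; split => //.
have -> : (t * (w' * s))%g = w'; last by [].
have := tinv_flip w'W sS tr; rewrite h (negbTE h1) => /(_ isT) ->.
by rewrite mulgA mulgKV -mulgA S_sq // mulg1.
Qed.

Lemma word_exists w : w \in W -> exists l, isword l w /\
  size l <= #|[set t in refl W S | tinv w t]|.
Proof.
have [d] := ubnP #|[set t in refl W S | tinv w t]|.
elim: d w => // d IH w hd wW.
case: (eqVneq w 1%g) => [->|w1].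
  by exists [::]; split => //; split => //; rewrite big_nil.
have [|e|a [c [ac xac _]]] := descent_exists (z := 1%g : 'S_N) (x := phi w).
- by move=> i j; rewrite !perm1; clear; lia.
- by case/eqP: w1; apply: phi_inj; rewrite phi1.
have kN : (phi w c).+1 < N by rewrite -xac.
have [s [sS es]] := swap_S kN.
pose t0 := (w * s * w^-1)%g.
have t0r : t0 \in refl W S by apply: conj_refl.
have t0ac : phi t0 a = c.
  rewrite /t0 !phiM phiV es !permM.
  suff -> : swp evenN (phi w c) (phi w a) = phi w c by rewrite permK.
  apply: val_inj; rewrite /= swpE // /swk xac eqxx.
  by case: eqP => // e; move: e; clear; lia.
have t0w : tinv w t0 by rewrite (tinvE wW t0r ac t0ac) xac.
have wsW : (w * s)%g \in W by apply: WM => //; apply: S_W.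
have lt : #|[set t in refl W S | tinv (w * s)%g t]| < #|[set t in refl W S | tinv w t]|.
  apply: proper_card; apply/properP; split.
    apply/subsetP => t; rewrite 2!in_set => /andP[tr h]; apply/andP; split => //.
    have [//|h1] := boolP (tinv w t).
    have := tinv_flip wW sS tr; rewrite h (negbTE h1) => /(_ isT) e.
    by move: h1; rewrite e -/t0 t0w.
  exists t0; rewrite in_set t0r //=.
  have -> : (w * s)%g = (t0 * w)%g by rewrite /t0 mulgKV.
  by rewrite tinv_mul // t0w.
have [|l [hl sl]] := IH _ _ wsW; first exact: leq_trans lt hd.
exists (rcons l s); rewrite size_rcons; split; last exact: leq_ltn_trans sl lt.
by have := word_rcons hl sS; rewrite -mulgA S_sq // mulg1.
Qed.

Lemma card_refl : #|refl W S| < #|W|.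
Proof.
apply: proper_card; apply/properP; split; first by apply/subsetP => t; apply: refl_W.
exists 1%g; first exact: W1.
by apply/negP => /refl_pair[i [j [ij]]]; rewrite phi1 perm1 => e; rewrite e ltnn in ij.
Qed.

Lemma wordlenP k w : reflect (exists l, isword l w /\ size l = k) (wordlen S k w).
Proof.
apply: (iffP existsP) => [[t /andP[h /eqP e]]|[l [[lS e] sl]]].
  by exists t; rewrite size_tuple.
by exists (Tuple (introT eqP sl)); rewrite /= lS e eqxx.
Qed.

Lemma coxlen_le l w : w \in W -> isword l w -> coxlen W S w <= size l.
Proof.
move=> wW hl; case: (ltnP (size l) #|W|) => [lt|le].
  rewrite -[size l]/(nat_of_ord (Ordinal lt)); apply: bigminn_le.
    by rewrite mem_index_enum.
  by apply/wordlenP; exists l.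
apply: leq_trans le; rewrite /coxlen.
elim/big_rec: _ => // i x _ h; rewrite geq_min; apply/orP; by right.
Qed.

Lemma coxlen_word w : w \in W -> exists l, isword l w /\ size l = coxlen W S w.
Proof.
move=> wW; have [l [hl sl]] := word_exists wW.
(* Lengths are bounded by the number of reflections, hence the default value [#|W|] in [coxlen] is
   not reached. *)
have lt : coxlen W S w < #|W|.
  apply: leq_ltn_trans (coxlen_le wW hl) (leq_ltn_trans sl _).
  apply: leq_ltn_trans card_refl; apply: subset_leq_card.
  by apply/subsetP => t; rewrite inE => /andP[].
have : coxlen W S w = #|W| \/ wordlen S (coxlen W S w) w.
  rewrite /coxlen; elim/big_rec: _ => [|i x Pi h]; first by left.
  rewrite /minn; case: ifP => _; first by right.
  exact: h.
case=> [e|/wordlenP[l' [h1 h2]]]; first by rewrite e ltnn in lt.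
by exists l'.
Qed.

Lemma coxlen_tinv w t : w \in W -> t \in refl W S -> tinv w t ->
  coxlen W S (t * w)%g < coxlen W S w.
Proof.
move=> wW tr h; have [l [hl sl]] := coxlen_word wW.
have [l' [hl' sl']] := word_del hl tr h.
by rewrite -sl -sl'; apply: coxlen_le => //; apply: WM => //; apply: refl_W.
Qed.

Lemma invsetE w t : w \in W -> (t \in invset W S w) = (t \in refl W S) && tinv w t.
Proof.
move=> wW; rewrite in_set; case tr: (t \in refl W S); last by [].
rewrite !andTb; apply/idP/idP => [h|]; last exact: coxlen_tinv.
have [//|h1] := boolP (tinv w t); have tW := refl_W tr.
(* Otherwise [t] shortens [t * w] to [w], against the assumption. *)
have h2 : tinv (t * w)%g t by rewrite tinv_mul.
have := coxlen_tinv (WM tW wW) tr h2; rewrite mulgA refl_sq // mul1g.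
by rewrite ltnNge (ltnW h).
Qed.

(** A letter of the word at which the pair becomes inverted provides the reflection. *)
Lemma inv_refl l w i j : isword l w -> i < j -> phi w j < phi w i ->
  exists t, t \in refl W S /\ phi t i = j.
Proof.
move=> + ij; elim/last_ind: l w => [|l s IH] w [].
  by rewrite big_nil => _ <-; rewrite phi1 !perm1; move: ij; clear; lia.
rewrite all_rcons big_rcons => /andP[sS lS] <- h.
pose w' := (\prod_(x <- l) x)%g; have lw' : isword l w' by [].
have [h1|h1] := boolP (phi w' j < phi w' i); first exact: IH w' lw' h1.
have w'W := word_W lw'.
exists (w' * s * w'^-1)%g; split; first exact: conj_refl.
by apply: flip_conj => //; rewrite h (negbTE h1).
Qed.

Lemma weak_leE x y : x \in W -> y \in W -> weak_le W S x y <-> wle (phi x) (phi y).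
Proof.
move=> xW yW; split.
  move/subsetP => h i j ij xij; have [l [hl _]] := word_exists xW.
  have [t [tr tij]] := inv_refl hl ij xij.
  by have := h t; rewrite !invsetE // tr !(tinvE _ tr ij tij) // => /(_ xij).
move=> h; apply/subsetP => t; rewrite !invsetE // => /andP[tr].
have [i [j [ij tij]]] := refl_pair tr; rewrite tr !(tinvE _ tr ij tij) //.
exact: h.
Qed.

End WeakOrder.

(** * The Cambrian congruence *)

Section Cambrian.
Variables (gT : finGroupType) (W S : {set gT}) (N : nat) (sy : bool).
Hypothesis evenN : sy -> ~~ odd N.
Variable phi : gT -> 'S_N.
Hypothesis phiM : forall x y, phi (x * y)%g = (phi x * phi y)%g.
Hypothesis phi_inj : injective phi.
Hypothesis phi_surj : forall z, inW sy z -> exists x, phi x = z.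
Hypothesis WE : forall x, (x \in W) = inW sy (phi x).
Hypothesis S_swap : forall s, s \in S -> exists k, k.+1 < N /\ phi s = swp evenN k.
Hypothesis swap_S : forall k, k.+1 < N -> exists s, s \in S /\ phi s = swp evenN k.
Variable up : nat -> bool.
Hypothesis up0 : up 0 = false.
Hypothesis upN : up N.+1 = false.
Hypothesis ups : sy -> forall i : 'I_N, up (rev_ord i).+1 = ~~ up i.+1.
Variable o : rel gT.
Hypothesis gens_W : forall s t, o s t -> t \in W /\ alt t s (mcox s t).-1 \in W.
Hypothesis gens_teq : forall s t, o s t ->
  teq up (phi t) (phi (alt t s (mcox s t).-1)).
Hypothesis contract : forall Th : 'S_N -> 'S_N -> Prop, wcongr sy Th ->
  (forall s t, o s t -> Th (phi t) (phi (alt t s (mcox s t).-1))) ->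
  forall x (a c e : 'I_N), inW sy x -> a < c ->
  x a = (x c).+1 :> nat -> a < e -> e < c ->
  (if up e.+1 then x e < x c else x a < x e) -> Th (cov evenN x c) x.
Implicit Types (x y z m : gT).

Lemma weakE x y : x \in W -> y \in W -> weak_le W S x y <-> wle (phi x) (phi y).
Proof. exact: (weak_leE phiM phi_inj WE S_swap swap_S). Qed.

Lemma phi_onto (z : 'S_N) : inW sy z -> exists x, x \in W /\ phi x = z.
Proof. by move=> h; have [x e] := phi_surj h; exists x; rewrite WE e. Qed.

Lemma meetE x y m : x \in W -> y \in W -> is_meet W S x y m <->
  m \in W /\ ismeet sy (phi x) (phi y) (phi m).
Proof.
move=> xW yW; split.
  case/and4P => mW /(weakE mW xW) mx /(weakE mW yW) my /forall_inP h.
  split => //; split => //; first by rewrite -WE.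
  move=> z /phi_onto[z' [zW <-]] /(weakE zW xW) zx /(weakE zW yW) zy.
  by apply/(weakE zW mW); have := h z' zW; rewrite zx zy.
case=> mW [_ mx my h]; apply/and4P; split => //.
- by apply/(weakE mW xW).
- by apply/(weakE mW yW).
apply/forall_inP => z zW; apply/implyP => /andP[/(weakE zW xW) zx /(weakE zW yW) zy].
by apply/(weakE zW mW); apply: h => //; rewrite -WE.
Qed.

Lemma joinE x y m : x \in W -> y \in W -> is_join W S x y m <->
  m \in W /\ isjoin sy (phi x) (phi y) (phi m).
Proof.
move=> xW yW; split.
  case/and4P => mW /(weakE xW mW) mx /(weakE yW mW) my /forall_inP h.
  split => //; split => //; first by rewrite -WE.
  move=> z /phi_onto[z' [zW <-]] /(weakE xW zW) zx /(weakE yW zW) zy.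
  by apply/(weakE mW zW); have := h z' zW; rewrite zx zy.
case=> mW [_ mx my h]; apply/and4P; split => //.
- by apply/(weakE xW mW).
- by apply/(weakE yW mW).
apply/forall_inP => z zW; apply/implyP => /andP[/(weakE xW zW) zx /(weakE yW zW) zy].
by apply/(weakE mW zW); apply: h => //; rewrite -WE.
Qed.

Lemma camb_teq x y : x \in W -> y \in W ->
  camb W S o x y <-> teq up (phi x) (phi y).
Proof.
move=> xW yW; split.
  move=> /(_ (fun x y => [/\ x \in W, y \in W & teq up (phi x) (phi y)])) h.
  case: h => //.
  - split.
    + by move=> z zW; split.
    + by move=> u v [uW vW h]; split => //; apply: teq_sym.
    + by move=> u v z [uW vW h] [_ zW h2]; split => //; apply: teq_trans h h2.
    + move=> u v z m n uW vW zW [_ _ uv] /(meetE _ uW zW)[mW hm] /(meetE _ vW zW)[nW hn].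
      by split => //; apply: (teq_meet up0 upN ups) uv hm hn.
    + move=> u v z m n uW vW zW [_ _ uv] /(joinE _ uW zW)[mW hm] /(joinE _ vW zW)[nW hn].
      by split => //; apply: (teq_join ups) uv hm hn.
  - by move=> s t st; have [h1 h2] := gens_W st; split => //; apply: gens_teq.
move=> xy Th [Hr Hs Ht Hm Hj] Hg.
pose Th' (u v : 'S_N) := exists x y, [/\ x \in W, y \in W, phi x = u, phi y = v & Th x y].
have Hc : wcongr sy Th'.
  split.
  - by move=> u /phi_onto[u' [uW <-]]; exists u', u'; split => //; apply: Hr.
  - by move=> u v [u' [v' [h1 h2 h3 h4 h5]]]; exists v', u'; split => //; apply: Hs.
  - move=> u v z [u' [v' [h1 h2 h3 h4 h5]]] [v2 [z' [k1 k2 k3 k4 k5]]].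
    have e : v2 = v' by apply: phi_inj; rewrite k3 h4.
    by exists u', z'; split => //; apply: Ht h5 _; rewrite -e.
  - move=> u v z m n _ _ Wz [u' [v' [h1 h2 <- <- h5]]] hm hn.
    have [z' [zW ez]] := phi_onto Wz; rewrite -{}ez in hm hn.
    have [Wm _ _ _] := hm; have [m' [mW em]] := phi_onto Wm; rewrite -em in hm *.
    have [Wn _ _ _] := hn; have [n' [nW en]] := phi_onto Wn; rewrite -en in hn *.
    exists m', n'; split => //; apply: (Hm u' v' z') => //; by apply/meetE.
  - move=> u v z m n _ _ Wz [u' [v' [h1 h2 <- <- h5]]] hm hn.
    have [z' [zW ez]] := phi_onto Wz; rewrite -{}ez in hm hn.
    have [Wm _ _ _] := hm; have [m' [mW em]] := phi_onto Wm; rewrite -em in hm *.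
    have [Wn _ _ _] := hn; have [n' [nW en]] := phi_onto Wn; rewrite -en in hn *.
    exists m', n'; split => //; apply: (Hj u' v' z') => //; by apply/joinE.
have [u [v [uW vW /phi_inj eu /phi_inj ev h]]] : Th' (phi x) (phi y).
- apply: (teq_congr Hc up0 upN ups _ _ _ xy); rewrite -?WE //.
  apply: contract => // s t st; have [h1 h2] := gens_W st.
  by exists t, (alt t s (mcox s t).-1); split => //; apply: Hg.
by rewrite -eu -ev.
Qed.

End Cambrian.

(** * The Cambrian fan *)

Section Dotp.
Variables (R : realType) (n : nat).
Implicit Types (a b x y : 'rV[R]_n).

Lemma dotpDl a b x : (dotp (a + b) x = dotp a x + dotp b x)%R.
Proof. by rewrite /dotp -big_split; apply: eq_bigr => i _; rewrite mxE mulrDl. Qed.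

Lemma dotpDr a x y : (dotp a (x + y) = dotp a x + dotp a y)%R.
Proof. by rewrite /dotp -big_split; apply: eq_bigr => i _; rewrite mxE mulrDr. Qed.

Lemma dotpZr a k x : (dotp a (k *: x) = k * dotp a x)%R.
Proof. by rewrite /dotp mulr_sumr; apply: eq_bigr => i _; rewrite mxE mulrCA. Qed.

Lemma dotp0l x : (dotp 0 x = 0)%R.
Proof. by rewrite /dotp big1 // => i _; rewrite mxE mul0r. Qed.

Lemma dotp0r a : (dotp a 0 = 0)%R.
Proof. by rewrite /dotp big1 // => i _; rewrite mxE mulr0. Qed.
End Dotp.

Section Main.
Variables (N : nat) (sy : bool).
Variable up : nat -> bool.
Hypothesis up0 : up 0 = false.
Hypothesis upN : up N.+1 = false.
Hypothesis evenN : sy -> ~~ odd N.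
Hypothesis ups : sy -> forall i : 'I_N, up (rev_ord i).+1 = ~~ up i.+1.

Variables (gT : finGroupType) (W S : {set gT}) (phi : gT -> 'S_N) (o : rel gT).
Hypothesis phi_surj : forall z, inW sy z -> exists x, phi x = z.
Hypothesis WE : forall x, (x \in W) = inW sy (phi x).
Hypothesis cambE : forall x y, x \in W -> y \in W ->
  camb W S o x y <-> teq up (phi x) (phi y).

Variables (R : realType) (n : nat).
Implicit Types (x y z : 'rV[R]_n) (i j : 'I_N) (p q r s : 'I_(N + 2)).
Variables (act : gT -> 'rV[R]_n -> 'rV[R]_n) (B : 'rV[R]_n -> Prop).
(** [ext] lists the coordinates at all labels, in type B with opposite values at mirror labels; [V]
    is the subspace filled by the fan, namely sum zero in type A and everything in type B. *)
Variables (ext : 'rV[R]_n -> 'I_N -> R) (V : 'rV[R]_n -> Prop).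
Hypothesis extD : forall x y i, (ext (x + y) i = ext x i + ext y i)%R.
Hypothesis extZ : forall k x i, (ext (k *: x) i = k * ext x i)%R.
Hypothesis VD : forall x y, V x -> V y -> V (x + y)%R.
Hypothesis VZ : forall k x, V x -> V (k *: x)%R.
Hypothesis ext_sym : sy -> forall y i, (ext y (rev_ord i) = - ext y i)%R.
Hypothesis ext_onto : forall f : 'I_N -> R, (\sum_i f i = 0)%R ->
  (sy -> forall i, f (rev_ord i) = - f i)%R -> exists y, V y /\ forall i, ext y i = f i.
Hypothesis ext_functional : forall i j, exists a : 'rV[R]_n,
  forall y, (dotp a y = ext y j - ext y i)%R.
Hypothesis regionE : forall w y, w \in W ->
  region act B w y <-> V y /\ forall i j, phi w i <= phi w j -> (ext y i <= ext y j)%R.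

Variable P : {set 'I_(N + 2) * 'I_(N + 2)} -> Prop.
Hypothesis PE : forall T, P T <-> partial_tri T /\
  (sy -> forall d, d \in T -> exists2 e, e \in T &
     let a := rot_half (N + 2) d.1 in let b := rot_half (N + 2) d.2 in
     ((e.1 : nat), (e.2 : nat)) = (minn a b, maxn a b)).

Variable pos : 'S_(N + 2).
Hypothesis posE : forall u v, (pos u < pos v) = prec up u v.
Local Notation cod := (code up pos).
Implicit Types (T : {set 'I_(N + 2) * 'I_(N + 2)}) (w : gT).

Lemma ups_nat : sy -> forall v : nat, 0 < v <= N -> up (N.+1 - v) = ~~ up v.
Proof.
move=> h v /andP[v0 vN]; have vN' : v.-1 < N by rewrite prednK.
have := ups h (Ordinal vN'); rewrite /= prednK // => <-; congr (up _).
by move: v0 vN; clear; lia.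
Qed.

Lemma ups_end p : sy ->
  (p == 0 :> nat) || (p == N.+1 :> nat) || (up (N.+1 - p) == ~~ up p).
Proof.
move=> h; case: (posnP p) => //= p0; case: (eqVneq (p : nat) N.+1) => //= pN.
by rewrite (ups_nat h) ?eqxx //; move: p0 pN (ltn_ord p); clear; lia.
Qed.

Lemma below_rev p q i : sy -> p < q ->
  below up (rev_ord q) (rev_ord p) (rev_ord i).+1 = ~~ below up p q i.+1.
Proof.
move=> h pq; have Up := ups_end p h; have Uq := ups_end q h.
have ui := ups h i; rewrite /= in ui.
have iN := ltn_ord i; have qN := ltn_ord q.
have u1 := up_eq up p i.+1; have u2 := up_eq up q i.+1.
have v0 := up_eq up p 0; have v1 := up_eq up q N.+1; rewrite up0 upN in v0 v1.
have v2 := up_eq up (N.+1 - p) N.+1; have v3 := up_eq up (N.+1 - q) 0; rewrite up0 upN in v2 v3.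
rewrite /below !rev_val /= ui.
by move: Up Uq pq iN qN u1 u2 v0 v1 v2 v3; clear; lia.
Qed.

Lemma pre_rev p q i : sy -> p < q ->
  pre up (rev_ord q) (rev_ord p) (rev_ord i).+1 = post up p q i.+1.
Proof.
move=> h pq; have Up := ups_end p h; have Uq := ups_end q h.
have ui := ups h i; rewrite /= in ui.
have iN := ltn_ord i; have qN := ltn_ord q.
rewrite /pre /post !rev_val /= ui.
move: Up Uq pq iN qN; clear; lia.
Qed.

Lemma post_rev p q i : sy -> p < q ->
  post up (rev_ord q) (rev_ord p) (rev_ord i).+1 = pre up p q i.+1.
Proof.
move=> h pq; have qN := ltn_ord q; rewrite -pre_rev //; last by rewrite /=; clear -pq qN; lia.
by rewrite !rev_ordK.
Qed.

Lemma tri_rev (t : rel 'I_N) p q : sy -> p < q ->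
  (forall i j, t (rev_ord j) (rev_ord i) = t i j) ->
  tri up t (rev_ord q) (rev_ord p) = tri up t p q.
Proof.
move=> h pq ts; apply/triP/triP => H i j hi hj.
  by rewrite -ts; apply: H; rewrite ?pre_rev ?post_rev.
rewrite -ts; apply: H; rewrite -?(pre_rev i) -?(post_rev j) ?rev_ordK //.
  by rewrite -(post_rev _ h pq) rev_ordK.
by rewrite -(pre_rev _ h pq) rev_ordK.
Qed.

Lemma vdiag_rev p q : sy -> vdiag N up p q -> vdiag N up (rev_ord q) (rev_ord p).
Proof.
move=> h /and3P[pq /existsP[i hi] /existsP[j hj]]; have qN := ltn_ord q.
apply/and3P; split; first by rewrite /=; clear -pq qN; lia.
  by apply/existsP; exists (rev_ord j); rewrite pre_rev.
by apply/existsP; exists (rev_ord i); rewrite post_rev.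
Qed.

Lemma vdiag_lt p q : vdiag N up p q -> p < q. Proof. by case/and3P. Qed.

Definition tset (t : rel 'I_N) : {set 'I_(N + 2) * 'I_(N + 2)} :=
  [set d | [exists p : 'I_(N + 2), exists q : 'I_(N + 2),
     [&& vdiag N up p q, tri up t p q & cod p q == d]]].

Lemma mem_tset t p q : vdiag N up p q -> (cod p q \in tset t) = tri up t p q.
Proof.
move=> vd; rewrite in_set; apply/existsP/idP => [[r /existsP[s /and3P[vrs trs /eqP e]]]|h].
  by have [<- <-] := code_inj (vdiag_lt vrs) (vdiag_lt vd) e.
by exists p; apply/existsP; exists q; rewrite vd h eqxx.
Qed.

Lemma mem_tsetP t d : d \in tset t ->
  exists p q, [/\ vdiag N up p q, tri up t p q & d = cod p q].
Proof.
rewrite in_set => /existsP[p /existsP[q /and3P[h1 h2 /eqP h3]]]; by exists p, q.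
Qed.

Lemma P_chord T d : P T -> d \in T -> exists p q, vdiag N up p q /\ d = cod p q.
Proof.
move=> /PE[[h _] _] dT; have dd := h d dT; have d12 : d.1 < d.2 by case/and3P: dd.
have [p [q [pq e]]] := code_surj posE d12.
by exists p, q; split => //; rewrite -(code_diag up0 upN posE pq) e.
Qed.

Lemma P_noncross T p q r s : P T -> p < q -> r < s -> cod p q \in T -> cod r s \in T ->
  ~~ vcross up p q r s.
Proof.
by move=> /PE[[_ h] _] pq rs h1 h2; rewrite -(code_cross posE pq rs); apply: h.
Qed.

Lemma P_rev T p q : sy -> P T -> p < q -> cod p q \in T ->
  cod (rev_ord q) (rev_ord p) \in T.
Proof.
move=> h /PE[_ /(_ h) hr] pq hT; have [[e1 e2] eT /= e] := hr _ hT.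
have := code_rev up0 upN posE (evenN h) (ups_nat h) pq; rewrite -e => -[/val_inj a /val_inj b].
by rewrite [cod _ _]surjective_pairing a b.
Qed.

Lemma P_sub T T' : P T -> T' \subset T ->
  (sy -> forall p q, vdiag N up p q -> cod p q \in T' -> cod (rev_ord q) (rev_ord p) \in T') ->
  P T'.
Proof.
move=> PT /subsetP sub hr; have /PE[[h1 h2] _] := PT; apply/PE; split; first split.
- by move=> d /sub; apply: h1.
- by move=> d e /sub hd /sub he; apply: h2.
move=> h d dT; have [p [q [vd e]]] := P_chord PT (sub _ dT).
rewrite e in dT *; exists (cod (rev_ord q) (rev_ord p)); first exact: hr.
exact: (code_rev up0 upN posE (evenN h) (ups_nat h) (vdiag_lt vd)).
Qed.

Lemma P_tset (w : 'S_N) : inW sy w -> P (tset (ordr w)).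
Proof.
move=> Ww; apply/PE; split; first split.
- by move=> d /mem_tsetP[p [q [h1 h2 ->]]]; rewrite (code_diag up0 upN posE (vdiag_lt h1)).
- move=> d e /mem_tsetP[p [q [h1 h2 ->]]] /mem_tsetP[r [s [h3 h4 ->]]].
  rewrite (code_cross posE (vdiag_lt h1) (vdiag_lt h3)).
  apply: (tri_noncross up0 upN _ (vdiag_lt h1) (vdiag_lt h3) h2 h4).
  by move=> i j; rewrite /ordr; clear; lia.
move=> h d /mem_tsetP[p [q [h1 h2 ->]]].
exists (cod (rev_ord q) (rev_ord p)).
  rewrite mem_tset ?vdiag_rev // tri_rev ?vdiag_lt // => i j.
  by rewrite /ordr symw_lt //; apply: (implyP Ww).
exact: (code_rev up0 upN posE (evenN h) (ups_nat h) (vdiag_lt h1)).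
Qed.

(* The vectors all of whose chords are in [T]. *)
Definition cone T y : Prop := V y /\ forall p q, vdiag N up p q ->
  tri up (ltr (ext y)) p q -> cod p q \in T.

Lemma tri0 p q : vdiag N up p q -> ~~ tri up (ltr (ext 0%R)) p q.
Proof.
case/and3P => _ /existsP[i hi] /existsP[j hj]; apply/negP => /triP/(_ i j hi hj).
by rewrite /ltr -[0%R](scale0r 0%R) !extZ !mul0r ltxx.
Qed.

Lemma coneP T y : P T -> cone T y -> exists c, [/\ forall p q, (0 <= c p q)%R,
  forall p q, ~~ vdiag N up p q -> c p q = 0%R,
  forall p q, vdiag N up p q -> (0 < c p q)%R = tri up (ltr (ext y)) p q,
  forall p q, (0 < c p q)%R -> cod p q \in T & comb up c (ext y)].
Proof.
move=> PT [Vy hy]; have [c [c0 cd ct cy]] := decomp up0 upN (ext y).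
exists c; split => // p q cpq; have [vd|/cd e] := boolP (vdiag N up p q); last by rewrite e ltxx in cpq.
by apply: hy => //; rewrite -ct.
Qed.

Lemma comb_cone T c y : P T -> V y -> (forall p q, (0 <= c p q)%R) ->
  (forall p q, ~~ vdiag N up p q -> c p q = 0%R) ->
  (forall p q, (0 < c p q)%R -> cod p q \in T) -> comb up c (ext y) ->
  cone T y /\ forall p q, vdiag N up p q -> tri up (ltr (ext y)) p q = (0 < c p q)%R.
Proof.
move=> PT Vy c0 cd cT cy.
have ct : forall p q, vdiag N up p q -> tri up (ltr (ext y)) p q = (0 < c p q)%R.
  apply: (comb_tri up0 upN c0 cd _ cy) => p q r s h1 h2.
  have vd (u v : 'I_(N + 2)) : (0 < c u v)%R -> vdiag N up u v.
    by move=> h; apply/negPn/negP => /cd e; rewrite e ltxx in h.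
  by apply: (P_noncross PT); rewrite ?(vdiag_lt (vd _ _ _)) ?cT // vdiag_lt ?vd.
split => //; split => // p q vd; rewrite ct //; exact: cT.
Qed.

Lemma combD c d x y : comb up c (ext x) -> comb up d (ext y) ->
  comb up (fun p q => c p q + d p q)%R (ext (x + y)%R).
Proof.
move=> cx dy i j; rewrite !extD opprD addrACA cx dy -big_split; apply: eq_bigr => p _.
by rewrite -big_split; apply: eq_bigr => q _; rewrite /= mulrDl.
Qed.

Lemma combZ k c x : comb up c (ext x) ->
  comb up (fun p q => k * c p q)%R (ext (k *: x)%R).
Proof.
move=> cx i j; rewrite !extZ -mulrBr cx mulr_sumr; apply: eq_bigr => p _.
by rewrite mulr_sumr; apply: eq_bigr => q _; rewrite /= mulrA.
Qed.

(** The coefficients add up, and since the chords of [T] do not cross, [comb_tri] recognizes their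
    supports as the chords of the sum. *)
Lemma coneD T x y : P T -> cone T x -> cone T y -> cone T (x + y)%R /\
  forall p q, vdiag N up p q -> tri up (ltr (ext (x + y)%R)) p q =
    tri up (ltr (ext x)) p q || tri up (ltr (ext y)) p q.
Proof.
move=> PT Kx Ky; have [c [c0 cd ct cT cx]] := coneP PT Kx.
have [d [d0 dd dt dT dy]] := coneP PT Ky.
have pos_add p q : (0 < c p q + d p q)%R = (0 < c p q)%R || (0 < d p q)%R.
  by rewrite !lt_def paddr_eq0 // addr_ge0 // c0 d0 !andbT negb_and.
have [||p q h|p q|h1 h2] := @comb_cone T (fun p q => c p q + d p q)%R (x + y)%R PT _ _ _ _ (combD cx dy).
- by apply: VD; [case: Kx|case: Ky].
- by move=> p q; rewrite addr_ge0.
- by rewrite cd // dd // addr0.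
- by rewrite pos_add => /orP[/cT|/dT].
by split => // p q vd; rewrite h2 // pos_add ct // dt.
Qed.

Lemma cone0 T : cone T 0%R.
Proof.
split; last by move=> p q /tri0/negP.
have [||y [Vy _]] := @ext_onto (fun _ => 0%R).
- by rewrite big1.
- by move=> _ i; rewrite oppr0.
by rewrite -(scale0r y); apply: VZ.
Qed.

Lemma cone_generic T : P T -> exists y, cone T y /\
  forall p q, vdiag N up p q -> tri up (ltr (ext y)) p q = (cod p q \in T).
Proof.
move=> PT; pose c p q : R := (vdiag N up p q && (cod p q \in T))%:R%R.
pose F i : R := (\sum_p \sum_q c p q * isbelow R up p q i)%R.
pose f i : R := ((\sum_j F j) / N%:R - F i)%R.
case: (posnP N) => [N0|N0].
  exists 0%R; split; first exact: cone0.
  by move=> p q /and3P[_ /existsP[i]]; have := ltn_ord i; rewrite {2}N0.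
have Nr : (N%:R != 0 :> R)%R by rewrite pnatr_eq0 -lt0n.
have [||y [Vy ey]] := ext_onto (f := f).
- by rewrite sumrB sumr_const card_ord -[(_ / _ *+ _)%R]mulr_natr mulfVK // subrr.
- move=> h; pose C : R := (\sum_p \sum_q c p q)%R.
  have Frev i : (F (rev_ord i) = C - F i)%R.
    have e1 : (F (rev_ord i) = \sum_p \sum_q c p q * (1 - isbelow R up p q i))%R.
      rewrite /F (reindex_inj (@rev_ord_inj (N + 2))) exchange_big.
      rewrite (reindex_inj (@rev_ord_inj (N + 2))); apply: eq_bigr => p _.
      apply: eq_bigr => q _ /=; rewrite /c.
      have [vd|nvd] := boolP (vdiag N up p q); last first.
        have -> : vdiag N up (rev_ord q) (rev_ord p) = false.
          by apply/negP => /(vdiag_rev h); rewrite !rev_ordK (negbTE nvd).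
        by rewrite !mul0r.
      rewrite vdiag_rev //= (_ : (cod (rev_ord q) (rev_ord p) \in T) = (cod p q \in T)); last first.
        apply/idP/idP; last exact: P_rev h PT (vdiag_lt vd).
        move/(P_rev h PT (vdiag_lt (vdiag_rev h vd))); by rewrite !rev_ordK.
      congr (_ * _)%R; rewrite /isbelow.
      rewrite (below_rev i h (vdiag_lt vd)).
      by case: (below _ _ _ _); rewrite /= ?subrr ?subr0.
    rewrite e1 /C /F -sumrB; apply: eq_bigr => p _; rewrite -sumrB; apply: eq_bigr => q _.
    by rewrite mulrBr mulr1.
  have S2 : ((\sum_j F j) *+ 2 = C * N%:R)%R.
    rewrite mulr2n {1}(reindex_inj (@rev_ord_inj N)) (eq_bigr _ (fun i _ => Frev i)).
    by rewrite sumrB subrK sumr_const card_ord mulr_natr.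
  move=> i; rewrite /f Frev.
  have -> : (C = (\sum_j F j) / N%:R + (\sum_j F j) / N%:R)%R.
    by rewrite -mulrDl -mulr2n S2 mulfK.
  by rewrite !opprD !opprK !addrA subrr sub0r addrC.
have cy : comb up c (ext y).
  move=> i j; rewrite !ey /f opprB addrC addrA subrK -sumrB; apply: eq_bigr => p _.
  by rewrite -sumrB; apply: eq_bigr => q _; rewrite mulrBr.
have [||p q|h1 h2] := @comb_cone T c y PT Vy _ _ _ cy.
- by move=> p q; rewrite ler0n.
- by move=> p q /negbTE vd; rewrite /c vd.
- by rewrite ltr0n lt0b => /andP[].
by exists y; split => // p q vd; rewrite h2 // ltr0n lt0b vd.
Qed.

Lemma tri_sorted y (w0 w1 : 'S_N) p q :
  (forall i j, (w1 i < w1 j) = (ext y i < ext y j)%R || (ext y i == ext y j) && (w0 i < w0 j)) ->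
  tri up (ltr (ext y)) p q -> tri up (ordr w1) p q.
Proof.
by move=> h /triP t; apply/triP => i j hi hj; rewrite /ordr h; have := t i j hi hj; rewrite /ltr => ->.
Qed.

Lemma sorted_W y (w0 w1 : 'S_N) : inW sy w0 ->
  (forall i j, (w1 i < w1 j) = (ext y i < ext y j)%R || (ext y i == ext y j) && (w0 i < w0 j)) ->
  inW sy w1.
Proof.
move=> W0 h; apply/implyP => hs.
exact: sort_perm_sym (implyP W0 hs) (ext_sym hs y) h.
Qed.

Lemma maxcone_cone w y : w \in W ->
  camb_maxcone W S act B o w y <-> cone (tset (ordr (phi w))) y.
Proof.
move=> wW; have Ww : inW sy (phi w) by rewrite -WE.
split.
  case=> w' [w'W /(cambE wW w'W) tww' /(regionE y w'W)[Vy hy]].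
  split => // p q vd t; rewrite mem_tset // tww' ?vdiag_lt //.
  move/triP: t => t; apply/triP => i j hi hj; rewrite /ordr ltnNge; apply/negP => /hy.
  by rewrite leNgt (t i j hi hj : (ext y i < ext y j)%R).
move=> Ky; have PT := P_tset Ww; have Vy : V y by case: Ky.
have [c [c0 cd ct cT cy]] := coneP PT Ky.
(* Breaking ties as in [w] makes the triangulation of [w'] contain that of [w], and [tri_max] gives
   equality. *)
have [w1 h1] := sort_perm (ext y) (phi w).
have W1 := sorted_W Ww h1; have [w' ew] := phi_surj W1.
have w'W : w' \in W by rewrite WE ew.
exists w'; split => //; last first.
  apply/regionE => //; split => // i j; rewrite ew => hij.
  by rewrite leNgt; apply/negP => lt; have := h1 j i; rewrite lt /= ltnNge hij.
apply/cambE => //; rewrite ew; apply: (tri_max R up0 upN) => p q vd t.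
move/triP: (t) => t'; apply/triP => i j hi hj; rewrite /ordr h1.
have wij : phi w i < phi w j := t' i j hi hj.
have : (ext y i <= ext y j)%R.
  apply: comb_below_le c0 cy _ => r s crs bj.
  have vrs : vdiag N up r s by apply/negPn/negP => /cd e; rewrite e ltxx in crs.
  apply: noncross_below (vdiag_lt vd) (vdiag_lt vrs) _ hi hj bj.
  by apply: (P_noncross PT (vdiag_lt vd) (vdiag_lt vrs)); [rewrite mem_tset | apply: cT].
by rewrite le_eqVlt wij andbT orbC.
Qed.

Lemma P_complete T : P T -> exists2 w, w \in W & T \subset tset (ordr (phi w)).
Proof.
move=> PT; have [y [Ky gy]] := cone_generic PT.
have [w1 h1] := sort_perm (ext y) 1%g.
have W0 : inW sy (1%g : 'S_N) by apply/implyP => _; apply/symwP => i; rewrite !perm1.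
have [w ew] := phi_surj (sorted_W W0 h1).
exists w; first by rewrite WE ew (sorted_W W0 h1).
apply/subsetP => d dT; have [p [q [vd e]]] := P_chord PT dT.
by rewrite e mem_tset // ew; apply: tri_sorted h1 _; rewrite gy // -e.
Qed.

Lemma cone_le T T' y : P T -> P T' -> T \subset T' -> cone T y -> cone T' y.
Proof. by move=> _ _ /subsetP sub [Vy h]; split => // p q vd t; apply/sub/h. Qed.

(** [T'] collects the chords of all vectors of the face, and a sum of such vectors gives [z] in the
    face using all of them. For [x] in the cone of [T'], a large [m] keeps [m z - x] in this cone;
    the functional vanishes on [z] and is nonnegative on [x] and on [m z - x], hence vanishes on
    [x]. *)
Lemma face_cone T D : P T -> face_of (cone T) D ->
  exists T', P T' /\ forall y, cone T' y <-> D y.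
Proof.
move=> PT [a [a0 aD]].
pose T' := [set d in T | `[< exists y p q,
  [/\ D y, vdiag N up p q, tri up (ltr (ext y)) p q & cod p q = d] >]].
have subT : T' \subset T by apply/subsetP => d; rewrite inE => /andP[].
have PT' : P T'.
  apply: (P_sub PT subT) => h p q vd; rewrite !inE => /andP[h1 /asboolP[y [r [s [Dy vrs t e]]]]].
  have [er es] := code_inj (vdiag_lt vrs) (vdiag_lt vd) e; rewrite {}er {}es in t e vrs.
  rewrite (P_rev h PT) ?vdiag_lt //; apply/asboolP.
  exists y, (rev_ord q), (rev_ord p); split => //; first exact: vdiag_rev.
  rewrite tri_rev ?vdiag_lt // => i j.
  by rewrite /ltr !ext_sym // ltrN2.
have Dadd x y : D x -> D y -> D (x + y)%R.
  move=> /aD[Kx ax] /aD[Ky ay]; apply/aD; split; last by rewrite dotpDr ax ay addr0.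
  by have [] := coneD PT Kx Ky.
exists T'; split => // x; split; last first.
  move=> Dx; have /aD[[Vx hx] ax] := Dx; split => // p q vd t.
  rewrite inE hx //=; apply/asboolP; by exists x, p, q.
move=> Kx.
have [z [Dz gz]] : exists z, D z /\ forall p q, vdiag N up p q -> cod p q \in T' ->
    tri up (ltr (ext z)) p q.
  suff H (l : seq ('I_(N + 2) * 'I_(N + 2))) : {subset l <= T'} -> exists z, D z /\
      forall p q, vdiag N up p q -> cod p q \in l -> tri up (ltr (ext z)) p q.
    have [|z [Dz gz]] := H (enum T'); first by move=> d; rewrite mem_enum.
    by exists z; split => // p q vd h; apply: gz => //; rewrite mem_enum.
  elim: l => [_|d l IH sub].
    exists 0%R; split => //; apply/aD; split; [exact: cone0 | exact: dotp0r].
  have [e el|z [Dz gz]] := IH; first by apply: sub; rewrite inE el orbT.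
  have := sub d (mem_head _ _); rewrite inE => /andP[_ /asboolP[y [p [q [Dy vd t e]]]]].
  exists (y + z)%R; split; first exact: Dadd.
  move=> r s vrs; have /aD[Ky _] := Dy; have /aD[Kz _] := Dz.
  have [_ ->] := coneD PT Ky Kz => //; rewrite inE -e => /orP[/eqP h|h].
    by have [-> ->] := code_inj (vdiag_lt vrs) (vdiag_lt vd) h; rewrite t.
  by rewrite gz ?orbT.
have /aD[[Vz hz] az] := Dz.
have Kz : cone T' z.
  split => // p q vd t; rewrite inE hz //=; apply/asboolP; by exists z, p, q.
have KTx : cone T x by apply: cone_le Kx.
have [c [c0 cd ct cT cx]] := coneP PT' Kx.
have [b [b0 bd bt bT bz]] := coneP PT' Kz.
have bpos p q : (0 < c p q)%R -> (0 < b p q)%R.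
  move=> cpq; have vd : vdiag N up p q by apply/negPn/negP => /cd e; rewrite e ltxx in cpq.
  by rewrite bt // gz // cT.
(* A bound for all ratios; where [b] vanishes, [c] vanishes by [bpos]. *)
pose m : R := (1 + \sum_p \sum_q c p q / b p q)%R.
have t0 p q : (0 <= c p q / b p q)%R by rewrite divr_ge0.
have m0 : (0 < m)%R by rewrite ltr_pwDl // sumr_ge0 // => p _; rewrite sumr_ge0.
have mle p q : (c p q <= m * b p q)%R.
  have [cpq|cpq] := boolP (0 < c p q)%R; last first.
    have /eqP-> : c p q == 0%R by rewrite eq_le c0 andbT leNgt.
    by rewrite mulr_ge0 // ltW.
  rewrite -ler_pdivrMr ?bpos // /m (bigD1 p) //= (bigD1 q) //= !addrA [(1 + _)%R]addrC -!addrA.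
  rewrite lerDl addr_ge0 // addr_ge0 //; first by rewrite sumr_ge0.
  by rewrite sumr_ge0 // => r _; rewrite sumr_ge0.
apply/aD; split => //; apply/eqP; rewrite eq_le a0 // andbT.
have [||p q h|p q h|K _] := @comb_cone T' (fun p q => m * b p q + -1 * c p q)%R (m *: z + -1 *: x)%R PT'
    _ _ _ _ (combD (combZ m bz) (combZ (-1) cx)).
- by case: Kx => Vx _; apply: VD; apply: VZ.
- by move=> p q; rewrite mulN1r subr_ge0.
- by rewrite cd // bd // !mulr0 addr0.
- apply: bT; rewrite -(pmulr_rgt0 _ m0); apply: lt_le_trans h _.
  by rewrite mulN1r gerDl oppr_le0.
have := a0 _ (cone_le PT' PT subT K).
by rewrite dotpDr !dotpZr az mulr0 add0r mulN1r oppr_ge0.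
Qed.

(** The supporting functional is the sum of the dual functionals of the chords of [T(w)] that are
    missing in [T]; on the cone it adds up their coefficients. *)
Lemma cone_face w T : w \in W -> P T -> T \subset tset (ordr (phi w)) ->
  face_of (cone (tset (ordr (phi w)))) (cone T).
Proof.
move=> wW PT sub; have Ww : inW sy (phi w) by rewrite -WE.
have PTw := P_tset Ww.
pose good c y := [/\ forall p q, (0 <= c p q)%R,
  forall p q, ~~ vdiag N up p q -> c p q = 0%R,
  forall p q, (0 < c p q)%R -> cod p q \in tset (ordr (phi w)) & comb up c (ext y)].
have [a ha] : exists a, forall c y, good c y -> dotp a y =
    (\sum_(d <- enum [pred d : 'I_(N + 2) * 'I_(N + 2) | [&& vdiag N up d.1 d.2,
       tri up (ordr (phi w)) d.1 d.2 & cod d.1 d.2 \notin T]]) c d.1 d.2)%R.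
  set l := enum _; have : forall d, d \in l -> vdiag N up d.1 d.2 /\ tri up (ordr (phi w)) d.1 d.2.
    by move=> d; rewrite mem_enum inE => /and3P[].
  elim: l => [_|[p q] l IH hl].
    by exists 0%R => c y _; rewrite dotp0l big_nil.
  have [d dl|a ha] := IH; first by apply: hl; rewrite inE dl orbT.
  have /= [vd t] := hl _ (mem_head _ _).
  have [i [j [hi hj wij dual]]] := dual_functional R up0 upN vd t.
  have [b hb] := ext_functional i j.
  exists (b + a)%R => c y gcy; rewrite dotpDl (ha _ _ gcy) hb big_cons; congr (_ + _)%R.
  case: gcy => c0 cd cT cy; apply: (dual c (ext y) _ cy) => r s crs.
  have vrs : vdiag N up r s by apply/negPn/negP => /cd e; rewrite e eqxx in crs.
  by rewrite vrs -mem_tset // cT // lt_def crs c0.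
exists a; split => [y Ky|y].
  have [c [c0 cd ct cT cy]] := coneP PTw Ky.
  by rewrite (ha c y) //; apply: sumr_ge0 => d _.
split.
  move=> Ky; have Ky' := cone_le PT PTw sub Ky; split => //.
  have [c [c0 cd ct cT cy]] := coneP PTw Ky'.
  rewrite (ha c y) // big_seq big1 // => -[p q]; rewrite mem_enum inE /= => /and3P[vd _ nT].
  apply/eqP; rewrite eq_le c0 andbT leNgt ct //; apply: contra nT.
  by case: Ky => _; apply.
case=> Ky ay; case: (Ky) => Vy _; split => // p q vd t.
have [c [c0 cd ct cT cy]] := coneP PTw Ky.
move: ay; rewrite (ha c y) // => /eqP; rewrite psumr_eq0 // => /allP h.
have cpq : (0 < c p q)%R by rewrite ct.
apply/negPn/negP => nT; have := h (p, q); rewrite mem_enum inE /= vd nT -mem_tset // cT //=.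
by move=> /(_ isT) /eqP e; rewrite e ltxx in cpq.
Qed.

Lemma cambrian_fan_iso : poset_iso P (@normal_fan_le (N + 2)) (camb_fan_cone W S act B o).
Proof.
have ext_face w D : w \in W -> face_of (camb_maxcone W S act B o w) D <->
    face_of (cone (tset (ordr (phi w)))) D.
  move=> wW; split=> -[a [h1 h2]]; exists a; split => y.
  - by move=> Ky; apply: h1; apply/maxcone_cone.
  - by split=> [/h2[/(maxcone_cone y wW)]|[/(maxcone_cone y wW) k1 k2]] //; apply/h2.
  - by move=> Ky; apply: h1; apply/maxcone_cone.
  - split=> [/h2[k1 k2]|[/(maxcone_cone y wW) k1 k2]]; last by apply/h2.
    by split => //; apply/maxcone_cone.
exists cone; split.
- move=> T PT; have [w wW sub] := P_complete PT.
  by exists w => //; apply/ext_face => //; apply: cone_face.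
- move=> C [w wW /(ext_face _ _ wW) h]; apply: face_cone h.
  by apply: P_tset; rewrite -WE.
move=> T1 T2 P1 P2; split=> [sub y|sub].
  exact: cone_le.
have [y [Ky gy]] := cone_generic P1.
apply/subsetP => d dT; have [p [q [vd e]]] := P_chord P1 dT.
by have [_ h] := sub _ Ky; rewrite e; apply: h => //; rewrite gy // -e.
Qed.
End Main.

(** * Generators *)

Section SwpOrder.
Variables (N h : nat) (sy : bool).
Hypothesis evenN : sy -> ~~ odd N.
(** [h] is the least index of a simple reflection: [n - 1] in type B, where [swp] at [h] exchanges
    the two central positions, and 0 in type A. *)
Hypothesis hB : sy -> N = h.+1 + h.+1.
Local Notation sw := (swk N sy).

Lemma swk_other k v : v != k -> v != k.+1 ->
  (sy -> v != N - k.+1) -> (sy -> v != N - k.+2) -> sw k v = v.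
Proof.
rewrite /swk => /negbTE-> /negbTE->; case: sy => //= h1 h2.
by rewrite (negbTE (h1 isT)) (negbTE (h2 isT)).
Qed.

Lemma swkl k : sw k k = k.+1. Proof. by rewrite /swk eqxx. Qed.
Lemma swkr k : sw k k.+1 = k.
Proof. by rewrite /swk eqxx; case: eqP => //; lia. Qed.

Definition sw2 k l v := sw l (sw k v).

Lemma sw2_rev k l v : sy -> k.+1 < N -> l.+1 < N -> v < N ->
  sw2 k l (N - v.+1) = N - (sw2 k l v).+1.
Proof.
by move=> s kN lN vN; rewrite /sw2 !(swk_rev evenN) // swk_bound.
Qed.

Lemma sw2_bound k l v : k.+1 < N -> l.+1 < N -> v < N -> sw2 k l v < N.
Proof. by move=> kN lN vN; rewrite /sw2 !swk_bound. Qed.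

Lemma iter_sw2_rev k l v m : sy -> k.+1 < N -> l.+1 < N -> v < N ->
  iter m (sw2 k l) (N - v.+1) = N - (iter m (sw2 k l) v).+1 /\ iter m (sw2 k l) v < N.
Proof.
move=> s kN lN vN; elim: m => [|m [IH1 IH2]] //=.
by rewrite IH1 sw2_rev // sw2_bound.
Qed.

(* Both sides commute with the central symmetry, hence only the positive
   half has to be inspected. *)
Lemma iter_sw2_half k l m : k.+1 < N -> l.+1 < N ->
  (forall v, v < N -> (sy -> h < v) -> iter m (sw2 k l) v = v) ->
  forall v, v < N -> iter m (sw2 k l) v = v.
Proof.
move=> kN lN H v vN; case s: sy; last by apply: H => //; rewrite s.
case: (ltnP h v) => hv; first exact: H.
have e : v = N - (N - v.+1).+1 by move: vN; clear; lia.
have v'N : N - v.+1 < N by move: vN; clear; lia.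
rewrite e (iter_sw2_rev m s kN lN v'N).1 H // => _.
by move: hv; rewrite (hB s); clear; lia.
Qed.

Lemma swp_pow k l m : k.+1 < N -> l.+1 < N ->
  (forall v, v < N -> iter m (sw2 k l) v = v) ->
  ((swp evenN k * swp evenN l) ^+ m = 1)%g.
Proof.
move=> kN lN H; apply/permP => i; apply: val_inj; rewrite perm1 /=.
rewrite -[RHS]H //; elim: m {H} i => [|m IH] i; first by rewrite expg0 perm1.
by rewrite expgS permM IH iterSr /sw2 permM !swpE.
Qed.

Lemma swp_order3 k : k.+2 < N -> (sy -> h < k) ->
  #[(swp evenN k * swp evenN k.+1)%g]%g = 3.
Proof.
move=> kN hk; have kN' := ltnW kN.
have e1 : sw2 k k.+1 k = k.+2 by rewrite /sw2 swkl swkl.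
apply: (prime_nt_dvdP (isT : prime 3)); last first.
  rewrite order_dvdn; apply/eqP; apply: swp_pow => //; apply: iter_sw2_half => // v vN hv /=.
  have e2 : sw2 k k.+1 k.+1 = k.
    rewrite /sw2 swkr swk_other //; try (by move: kN; clear; lia).
      by move=> s; move: (hk s) kN; rewrite (hB s); clear; lia.
    by move=> s; move: (hk s) kN; rewrite (hB s); clear; lia.
  have e3 : sw2 k k.+1 k.+2 = k.+1.
    rewrite /sw2 [sw k k.+2]swk_other ?swkr //; try (by move: kN; clear; lia).
      by move=> s; move: (hk s) kN; rewrite (hB s); clear; lia.
    by move=> s; move: (hk s) kN; rewrite (hB s); clear; lia.
  case: (eqVneq v k) => [->|n1]; first by rewrite e1 e3 e2.
  case: (eqVneq v k.+1) => [->|n2]; first by rewrite e2 e1 e3.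
  case: (eqVneq v k.+2) => [->|n3]; first by rewrite e3 e2 e1.
  suff e : sw2 k k.+1 v = v by rewrite !e.
  have d m (s : sy) : h < m.+1 -> v != N - m.+2.
    by move: (hv s); rewrite (hB s); clear; lia.
  rewrite /sw2 !swk_other // => s; apply/eqP; move: (hv s) (hk s) kN; rewrite (hB s); clear; lia.
rewrite order_eq1; apply/eqP => /permP/(_ (Ordinal (ltnW kN')))/(congr1 val) /=.
by rewrite perm1 permM !swpE //= -[sw _ (sw _ _)]/(sw2 k k.+1 k) e1; clear; lia.
Qed.

Lemma swh_fix v : sy -> v != h -> v != h.+1 -> sw h v = v.
Proof.
by move=> s n1 n2; rewrite swk_other // => _; rewrite (hB s); move: n1 n2; clear; lia.
Qed.

Lemma swh1_fix v : sy -> h.+2 < N -> h.+2 < v -> sw h.+1 v = v.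
Proof.
by move=> s hN hv; rewrite swk_other //; try move=> _; move: hv hN; rewrite (hB s); clear; lia.
Qed.

Lemma swh1_h : sy -> h.+2 < N -> sw h.+1 h = h.-1.
Proof.
move=> s hN; have r1 : N - h.+2 = h by rewrite (hB s); clear; lia.
have n1 : (h == h.+1) = false by clear; lia.
have n2 : (h == h.+2) = false by clear; lia.
by rewrite /swk s /= r1 eqxx n1 n2 (hB s); clear; lia.
Qed.

Lemma swh1_pred : sy -> h.+2 < N -> sw h.+1 h.-1 = h.
Proof.
move=> s hN; have r1 : N - h.+2 = h by rewrite (hB s); clear; lia.
have h0 : 0 < h by move: hN; rewrite (hB s); clear; lia.
have n1 : (h.-1 == h.+1) = false by move: h0; clear; lia.
have n2 : (h.-1 == h.+2) = false by move: h0; clear; lia.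
have n3 : (h.-1 == h) = false by move: h0; clear; lia.
have n4 : h.-1 == N - h.+3 by rewrite (hB s); clear; lia.
by rewrite /swk s /= r1 n1 n2 n3 n4.
Qed.

Lemma swp_order4 : sy -> h.+2 < N -> #[(swp evenN h * swp evenN h.+1)%g]%g = 4.
Proof.
move=> s hN; have hN' := ltnW hN.
have h0 : 0 < h by move: hN; rewrite (hB s); clear; lia.
have e1 : sw2 h h.+1 h = h.+2 by rewrite /sw2 !swkl.
have e2 : sw2 h h.+1 h.+1 = h.-1 by rewrite /sw2 swkr swh1_h.
have e3 : sw2 h h.+1 h.+2 = h.+1 by rewrite /sw2 swh_fix ?swkr //; clear; lia.
have e4 : sw2 h h.+1 h.-1 = h.
  by rewrite /sw2 swh_fix ?swh1_pred //; move: h0; clear; lia.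
have p4 : ((swp evenN h * swp evenN h.+1) ^+ 4 = 1)%g.
  apply: swp_pow => //; apply: iter_sw2_half => // v vN /(_ s) hv /=.
  case: (eqVneq v h.+1) => [->|n2]; first by rewrite e2 e4 e1 e3.
  case: (eqVneq v h.+2) => [->|n3]; first by rewrite e3 e2 e4 e1.
  have hv' : h.+2 < v by move: hv n2 n3; clear; lia.
  suff e : sw2 h h.+1 v = v by rewrite !e.
  by rewrite /sw2 swh_fix ?swh1_fix //; move: hv'; clear; lia.
have n2 : ~~ (#[(swp evenN h * swp evenN h.+1)%g]%g %| 2).
  rewrite order_dvdn; apply/eqP => /permP/(_ (Ordinal (ltnW hN')))/(congr1 val) /=.
  rewrite perm1 expgS expg1 !permM !swpE //= -[sw _ (sw _ (sw _ _))]/(sw2 h h.+1 (sw2 h h.+1 h)).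
  by rewrite e1 e3; clear; lia.
move/eqP: p4; rewrite -order_dvdn => d4; move: n2 d4 (dvdn_leq (isT : 0 < 4) d4).
by case: #[_]%g => [|[|[|[|[|k]]]]].
Qed.

Lemma swp_comm k l : h <= k -> k.+1 < l -> l.+1 < N ->
  ((swp evenN k * swp evenN l) ^+ 2 = 1)%g.
Proof.
move=> hk kl lN; have kN : k.+1 < N by move: kl lN; clear; lia.
have c v : v < N -> sw l (sw k v) = sw k (sw l v).
  move=> vN.
  have e1 : sw l k = k.
    rewrite swk_other //; try (by move: kl; clear; lia);
    by move=> s; move: hk kl lN; rewrite (hB s); clear; lia.
  have e2 : sw l k.+1 = k.+1.
    rewrite swk_other //; try (by move: kl; clear; lia);
    by move=> s; move: hk kl lN; rewrite (hB s); clear; lia.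
  have f1 : sw k l = l.
    rewrite swk_other //; try (by move: kl; clear; lia);
    by move=> s; move: hk kl lN; rewrite (hB s); clear; lia.
  have f2 : sw k l.+1 = l.+1.
    rewrite swk_other //; try (by move: kl; clear; lia);
    by move=> s; move: hk kl lN; rewrite (hB s); clear; lia.
  have main u : u < N -> (sy -> h < u) -> sw l (sw k u) = sw k (sw l u).
    move=> uN hu.
    case: (eqVneq u l) => [->|n1]; first by rewrite f1 swkl f2.
    case: (eqVneq u l.+1) => [->|n2]; first by rewrite f2 swkr f1.
    have el : sw l u = u.
      by rewrite swk_other // => s; move: (hu s) hk kl lN; rewrite (hB s); clear; lia.
    rewrite el.
    case: (eqVneq u k) => [->|n3]; first by rewrite swkl.
    case: (eqVneq u k.+1) => [->|n4]; first by rewrite swkr.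
    have ek : sw k u = u.
      by rewrite swk_other // => s; move: (hu s) hk kl lN n3 n4; rewrite (hB s); clear; lia.
    by rewrite ek.
  have [s|s] : ~~ sy \/ sy by case: (sy); [right|left].
    by apply: main => // s'; rewrite s' in s.
  case: (ltnP h v) => hv; first exact: main.
  have e : v = N - (N - v.+1).+1 by move: vN; clear; lia.
  have v'N : N - v.+1 < N by move: vN; clear; lia.
  have bk := swk_bound evenN kN v'N; have bl := swk_bound evenN lN v'N.
  have hu : h < N - v.+1 by move: hv; rewrite (hB s); clear; lia.
  move: (N - v.+1) e v'N bk bl hu => u -> uN bk bl hu.
  by rewrite !(swk_rev evenN) // main.
apply: swp_pow => // v vN /=.
by rewrite /sw2 -c ?swkK // ?swk_bound // c ?swk_bound // swkK ?swk_bound.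
Qed.
End SwpOrder.

Section TeqSwap.
Variables (N : nat) (sy : bool).
Hypothesis evenN : sy -> ~~ odd N.
Variable up : nat -> bool.
Hypothesis ups : sy -> forall i : 'I_N, up (rev_ord i).+1 = ~~ up i.+1.
Implicit Types (x : 'S_N) (a b c i j : 'I_N).

Lemma tri_between (t : rel 'I_N) (p q : nat) i j b : p < q -> tri up t p q ->
  pre up p q i.+1 -> post up p q j.+1 -> (i < b < j) || (j < b < i) ->
  if up b.+1 then t i b else t b j.
Proof.
move=> pq /triP h hi hj bij; have pb : p < b.+1 < q.
  by move: hi hj bij; rewrite /pre /post; clear -pq; lia.
case ub: (up b.+1); apply: h => //.
  by rewrite /post ub pb !orbT.
by rewrite /pre ub pb !orbT.
Qed.

(** A chord lost by the swap has [a] in [pre] and [c] in [post], or their mirror images, and passes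
    over [b]. An upper [b] would then come after [a], a lower one before [c], contrary to its
    position. *)
Lemma tri_swp x (k : nat) a c b (p q : nat) : inW sy x -> k.+1 < N ->
  x a = k :> nat -> x c = k.+1 :> nat -> (a < b < c) || (c < b < a) ->
  (if up b.+1 then x b < k else k.+1 < x b) -> p < q ->
  tri up (ordr x) p q -> tri up (ordr (x * swp evenN k)%g) p q.
Proof.
move=> Wx kN xa xc bac hb pq t; apply/triP => i j hi hj.
have xij : x i < x j by move/triP: (t); apply.
rewrite /ordr perm_lt_total; last by apply/eqP => e; rewrite e ltnn in xij.
rewrite !permM !swpE // swk_lt //; apply/negP => /orP[/andP[/eqP xi /eqP xj]|/and3P[s /eqP xi /eqP xj]].
  have ei : i = a by apply: (@perm_inj _ x); apply: val_inj; rewrite /= xi xa.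
  have ej : j = c by apply: (@perm_inj _ x); apply: val_inj; rewrite /= xj xc.
  rewrite ei ej in hi hj; have := tri_between pq t hi hj bac; rewrite /ordr xa xc.
  by case: (up _) hb; clear; lia.
have /symwP sx := implyP Wx s.
have ei : i = rev_ord c by apply: (@perm_inj _ x); apply: val_inj; rewrite sx /= xi xc.
have ej : j = rev_ord a by apply: (@perm_inj _ x); apply: val_inj; rewrite sx /= xj xa.
rewrite ei ej in hi hj.
have := @tri_between _ _ _ _ _ (rev_ord b) pq t hi hj.
rewrite (ups s b) /ordr !sx /= xa xc.
have -> : (N - c.+1 < N - b.+1 < N - a.+1) || (N - a.+1 < N - b.+1 < N - c.+1).
  by move: bac (ltn_ord a) (ltn_ord b) (ltn_ord c); clear; lia.
move=> /(_ isT); have xbN := ltn_ord (x b).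
by case: (up _) hb => /=; move: xbN kN; clear; lia.
Qed.

Lemma teq_swp x (k : nat) a c b : inW sy x -> k.+1 < N ->
  x a = k :> nat -> x c = k.+1 :> nat -> (a < b < c) || (c < b < a) ->
  (if up b.+1 then x b < k else k.+1 < x b) -> teq up x (x * swp evenN k)%g.
Proof.
move=> Wx kN xa xc bac hb p q pq qN; apply/idP/idP; first exact: tri_swp Wx kN xa xc bac hb pq.
set y := (x * _)%g => t.
have -> : x = (y * swp evenN k)%g by rewrite /y -mulgA swp_sq // mulg1.
have ya : y a = k.+1 :> nat by rewrite permM swpE // xa swkl.
have yc : y c = k :> nat by rewrite permM swpE // xc swkr.
apply: (tri_swp (a := c) (c := a) (b := b)) => //; first exact: swp_inW.
  by rewrite orbC.
have ba : b != a by apply/eqP => e; move: bac; rewrite e; clear; lia.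
have bc : b != c by apply/eqP => e; move: bac; rewrite e; clear; lia.
have nk : y b != k :> nat by rewrite -yc (inj_eq val_inj) (inj_eq perm_inj).
have nk1 : y b != k.+1 :> nat by rewrite -ya (inj_eq val_inj) (inj_eq perm_inj).
have yb : y b = swk N sy k (x b) :> nat by rewrite permM swpE.
case: (up _) hb => hb.
  have /= := @swk_lt N sy evenN k (x b) k kN hb (ltnW kN).
  rewrite swkl -yb => e; have : ~~ (k.+1 < y b); last by move: nk nk1; clear; lia.
  rewrite e; apply/negP => /orP[|/and3P[s /eqP h1 /eqP h2]]; first by move: hb; clear; lia.
  by have [n Nn] := evenE evenN s; move: h1 h2 hb kN; clear -Nn; lia.
have /= := @swk_lt N sy evenN k k.+1 (x b) kN hb (ltn_ord _).
rewrite swkr -yb => e; have : ~~ (y b < k); last by move: nk nk1; clear; lia.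
rewrite e; apply/negP => /orP[|/and3P[s /eqP h1 /eqP h2]]; first by move: hb; clear; lia.
by have [n Nn] := evenE evenN s; move: h1 h2 hb kN; clear -Nn; lia.
Qed.
End TeqSwap.

Section Generators.
Variables (gT : finGroupType) (W S : {set gT}) (N h : nat) (sy : bool).
Hypothesis evenN : sy -> ~~ odd N.
Hypothesis hB : sy -> N = h.+1 + h.+1.
Variable phi : gT -> 'S_N.
Hypothesis phiM : forall x y, phi (x * y)%g = (phi x * phi y)%g.
Hypothesis phi_inj : injective phi.
Hypothesis WE : forall x, (x \in W) = inW sy (phi x).
Variable sg : nat -> gT.
Hypothesis sgS : forall k, h <= k -> k.+1 < N -> sg k \in S.
Hypothesis sgE : forall k, h <= k -> k.+1 < N -> phi (sg k) = swp evenN k.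
Hypothesis S_sg : forall s, s \in S -> exists k, [/\ h <= k, k.+1 < N & s = sg k].
Variable o : rel gT.
Hypothesis ho : is_orientation S o.
Local Notation sw := (swk N sy).

Lemma phi_one : phi 1%g = 1%g.
Proof. by apply: (mulgI (phi 1%g)); rewrite -phiM !mulg1. Qed.

Lemma phi_order x : #[phi x]%g = #[x]%g.
Proof.
have phiX m : phi (x ^+ m)%g = (phi x ^+ m)%g.
  by elim: m => [|m IH]; rewrite ?expg0 ?phi_one // !expgS phiM IH.
apply/eqP; rewrite eqn_dvd !order_dvdn -phiX expg_order phi_one eqxx /=.
by apply/eqP/phi_inj; rewrite phiX expg_order phi_one.
Qed.

Lemma mcox_sg k l : h <= k -> k.+1 < N -> h <= l -> l.+1 < N ->
  mcox (sg k) (sg l) = #[(swp evenN k * swp evenN l)%g]%g.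
Proof. by move=> hk kN hl lN; rewrite /mcox -phi_order phiM !sgE. Qed.

Lemma swp_mirror k : sy -> k.+1 < N -> swp evenN (N - k.+2) = swp evenN k.
Proof.
move=> s kN; have kN' : (N - k.+2).+1 < N by move: kN; clear; lia.
apply/permP => i; apply: val_inj; rewrite /= !swpE // /swk s /=.
have [n Nn] := evenE evenN s; move: (ltn_ord i) kN; clear -Nn => iN kN.
by repeat (case: eqP => ? /=; try lia).
Qed.

Lemma S_swap s : s \in S -> exists k, k.+1 < N /\ phi s = swp evenN k.
Proof. by move=> /S_sg[k [hk kN ->]]; exists k; rewrite sgE. Qed.

Lemma swap_S k : (~~ sy -> h = 0) -> k.+1 < N -> exists s, s \in S /\ phi s = swp evenN k.
Proof.
move=> hA kN; case: (leqP h k) => hk; first by exists (sg k); rewrite sgS ?sgE.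
have s : sy by apply/negPn/negP => /hA e; rewrite e in hk.
have hk' : h <= N - k.+2 by rewrite (hB s); move: hk; clear; lia.
have kN' : (N - k.+2).+1 < N by move: kN; clear; lia.
by exists (sg (N - k.+2)); rewrite sgS ?sgE // swp_mirror.
Qed.

Definition special k := sy && (k == h).

Lemma mcox_edge k : h <= k -> k.+2 < N ->
  mcox (sg k) (sg k.+1) = (special k).+3 /\ mcox (sg k.+1) (sg k) = (special k).+3.
Proof.
move=> hk kN; have kN' := ltnW kN; have hk' : h <= k.+1 := leqW hk.
have e : mcox (sg k) (sg k.+1) = (special k).+3.
  rewrite mcox_sg //; case sp: (special k).
    case/andP: sp => s /eqP kh; rewrite kh in kN *; exact: (swp_order4 evenN hB s kN).
  apply: (swp_order3 evenN hB kN) => s; rewrite ltn_neqAle eq_sym hk andbT.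
  by apply/negP => kh; rewrite /special s kh in sp.
split => //; rewrite -e !mcox_sg // -orderV invMg; congr #[(_ * _)%g]%g.
  by apply/eqP; rewrite eq_invg_mul swp_sq.
by apply/eqP; rewrite eq_invg_mul swp_sq.
Qed.

(** The bounds provide a default at the extreme labels, to which no edge of the diagram
    corresponds. *)
Definition arrow (e : nat) := [&& h < e, e.+1 < N & o (sg e) (sg e.-1)].

(* The label [e] is on the upper hull iff the edge joining [sg e.-1] and [sg e]
   is oriented towards [sg e.-1]; for negative labels this is determined by the symmetry. *)
Definition updown (v : nat) := [&& 0 < v, v <= N &
  if sy && (v.-1 <= h) then ~~ arrow (N - v) else arrow v.-1].

Lemma updown0 : updown 0 = false. Proof. by []. Qed.
Lemma updownN : updown N.+1 = false. Proof. by rewrite /updown ltnn andbF. Qed.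

Lemma updown_arrow e : e < N -> (sy -> h < e) -> updown e.+1 = arrow e.
Proof.
move=> eN he; rewrite /updown eN /=; case: ifP => // /andP[/he]; by rewrite ltnNge => /negbTE->.
Qed.

Lemma updown_sym : sy -> forall i : 'I_N, updown (rev_ord i).+1 = ~~ updown i.+1.
Proof.
move=> s i; have iN := ltn_ord i; rewrite /updown s iN /=.
have -> : N - i.+1 < N by move: iN; clear; lia.
have -> : N - (N - i.+1).+1 = i by move: iN; clear; lia.
have -> : (N - i.+1 <= h) = ~~ (i <= h) by have Nh := hB s; move: iN; clear -Nh; lia.
by case: (i <= h); rewrite ?negbK.
Qed.

Lemma arrowN k : h <= k -> k.+2 < N -> o (sg k) (sg k.+1) = ~~ arrow k.+1.
Proof.
move=> hk kN; have kN' := ltnW kN; have hk' : h <= k.+1 := leqW hk.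
have [e _] := mcox_edge hk kN.
have ne : sg k != sg k.+1.
  apply/eqP => h1; move: e; rewrite -h1 mcox_sg // swp_sq // order1.
  by case: (special k).
have := ho.2 (sg k) (sg k.+1) (sgS hk kN') (sgS hk' kN) ne.
rewrite e => /(_ isT); rewrite /arrow ltnS hk kN /=.
by case: (o _ _); case: (o _ _).
Qed.

Lemma edgeP s t : o s t -> exists k, [/\ h <= k, k.+2 < N &
  [/\ s = sg k.+1, t = sg k & arrow k.+1] \/ [/\ s = sg k, t = sg k.+1 & ~~ arrow k.+1]].
Proof.
move=> st; have [/S_sg[k [hk kN es]] /S_sg[l [hl lN et]] ne m2] := ho.1 _ _ st.
have comm u v : h <= u -> u.+1 < v -> v.+1 < N -> mcox (sg u) (sg v) <= 2 /\ mcox (sg v) (sg u) <= 2.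
  move=> hu uv vN; have uN : u.+1 < N by move: uv vN; clear; lia.
  have hv : h <= v by move: hu uv; clear; lia.
  have e : mcox (sg v) (sg u) = mcox (sg u) (sg v).
    rewrite !mcox_sg // -orderV invMg; congr #[(_ * _)%g]%g.
      by apply/eqP; rewrite eq_invg_mul swp_sq.
    by apply/eqP; rewrite eq_invg_mul swp_sq.
  rewrite e mcox_sg //; suff: #[(swp evenN u * swp evenN v)%g]%g <= 2 by [].
  by apply: dvdn_leq => //; rewrite order_dvdn (swp_comm evenN hB hu uv vN).
rewrite es et in ne m2 st; rewrite es et.
case: (ltngtP k l) => kl.
- case: (ltngtP k.+1 l) => kl'.
  + by have [] := comm k l hk kl' lN; rewrite leqNgt m2.
  + by move: kl kl'; clear; lia.
  rewrite -kl' in lN st *; exists k; split => //; right; split => //.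
  by rewrite -arrowN.
- case: (ltngtP l.+1 k) => kl'.
  + by have [_] := comm l k hl kl' kN; rewrite leqNgt m2.
  + by move: kl kl'; clear; lia.
  rewrite -kl' in kN st *; exists l; split => //; left; split => //.
  by rewrite /arrow ltnS hl kN st.
by rewrite kl eqxx in ne.
Qed.

(** The alternating words of the two orientations, with a third letter at the edge labeled 4. *)
Definition altup k : 'S_N := (swp evenN k * (swp evenN k.+1 * if special k then swp evenN k else 1))%g.
Definition altdn k : 'S_N := (swp evenN k.+1 * (swp evenN k * if special k then swp evenN k.+1 else 1))%g.

Lemma phi_altup k : h <= k -> k.+2 < N ->
  phi (alt (sg k) (sg k.+1) (mcox (sg k.+1) (sg k)).-1) = altup k.
Proof.
move=> hk kN; have kN' := ltnW kN; have hk' : h <= k.+1 := leqW hk.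
rewrite (mcox_edge hk kN).2 /altup; case: (special k); rewrite /= !phiM phi_one !sgE //.
by rewrite mulg1.
Qed.

Lemma phi_altdn k : h <= k -> k.+2 < N ->
  phi (alt (sg k.+1) (sg k) (mcox (sg k) (sg k.+1)).-1) = altdn k.
Proof.
move=> hk kN; have kN' := ltnW kN; have hk' : h <= k.+1 := leqW hk.
rewrite (mcox_edge hk kN).1 /altdn; case: (special k); rewrite /= !phiM phi_one !sgE //.
by rewrite mulg1.
Qed.

Lemma gens_W s t : o s t -> t \in W /\ alt t s (mcox s t).-1 \in W.
Proof.
have S_W x : x \in S -> x \in W.
  by move=> /S_sg[k [hk kN ->]]; rewrite WE sgE // swp_inW1.
move=> st; have [sS tS _ _] := ho.1 _ _ st; split; first exact: S_W.
move: (mcox s t).-1 => m; elim: m s t sS tS {st} => [|m IH] s t sS tS /=; first by rewrite WE phi_one inW1.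
by rewrite WE phiM; apply: inWM; rewrite -WE; [exact: S_W | exact: IH].
Qed.

Lemma sw_above k v : (sy -> h < k) -> k < v -> k.+1 < v -> v < N -> sw k v = v.
Proof.
move=> hk kv kv' vN; rewrite swk_other //; try (by move: kv kv'; clear; lia).
  by move=> s; move: (hk s) kv vN; rewrite (hB s); clear; lia.
by move=> s; move: (hk s) kv vN; rewrite (hB s); clear; lia.
Qed.

Lemma sw_succ_fix k : (sy -> h < k) -> k.+2 < N -> sw k.+1 k = k.
Proof.
move=> hk kN; rewrite swk_other //; try (by clear; lia).
  by move=> s; move: (hk s) kN; rewrite (hB s); clear; lia.
by move=> s; move: (hk s) kN; rewrite (hB s); clear; lia.
Qed.

Lemma not_special k : h <= k -> special k = false -> sy -> h < k.
Proof.
move=> hk sp s; rewrite ltn_neqAle eq_sym hk andbT.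
by apply/negP => kh; rewrite /special s kh in sp.
Qed.

Lemma altup_lt k (i j : 'I_N) : h <= k -> k.+2 < N -> i = k :> nat -> j = k.+2 :> nat ->
  altup k j < altup k i.
Proof.
move=> hk kN ik jk; have kN' := ltnW kN; rewrite /altup !permM.
case sp: (special k); last first.
  have h' := not_special hk sp; rewrite !perm1 !swpE // ik jk swkl swkl.
  by rewrite [sw k k.+2]sw_above // swkr.
case/andP: sp => s /eqP kh; rewrite kh in kN kN' ik jk *.
have h0 : 0 < h by move: kN; rewrite (hB s); clear; lia.
have f : sw h h.+2 = h.+2 by rewrite (swh_fix hB s) //; clear; lia.
by rewrite !swpE // ik jk swkl swkl !f swkr swkr.
Qed.

Lemma altdn_lt k (i j : 'I_N) : h <= k -> k.+2 < N -> i = k :> nat -> j = k.+2 :> nat ->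
  altdn k j < altdn k i.
Proof.
move=> hk kN ik jk; have kN' := ltnW kN; rewrite /altdn !permM.
case sp: (special k); last first.
  have h' := not_special hk sp; rewrite !perm1 !swpE // ik jk swkr swkr.
  by rewrite [sw k.+1 k]sw_succ_fix // swkl.
case/andP: sp => s /eqP kh; rewrite kh in kN kN' ik jk *.
have h0 : 0 < h by move: kN; rewrite (hB s); clear; lia.
have f : sw h h.-1 = h.-1 by rewrite (swh_fix hB s) //; move: h0; clear; lia.
rewrite !swpE // ik jk swkr swkr !(swh1_h hB s) // f (swh1_pred hB s) //.
by move: h0; clear; lia.
Qed.

Lemma teq_altup k : h <= k -> k.+2 < N -> arrow k.+1 ->
  teq updown (swp evenN k) (altup k).
Proof.
move=> hk kN ar; have kN' := ltnW kN; rewrite /altup.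
pose a := Ordinal (ltnW kN'); pose b := Ordinal kN'; pose c := Ordinal kN.
have ub : updown b.+1 by rewrite updown_arrow.
have s1 : teq updown (swp evenN k) (swp evenN k * swp evenN k.+1)%g.
  case sp: (special k); last first.
    have h' := not_special hk sp.
    apply: (teq_swp evenN updown_sym (a := a) (c := c) (b := b)) => //.
    - exact: swp_inW1.
    - by rewrite swpE // swkl.
    - by rewrite swpE // sw_above.
    - by rewrite /= !ltnSn.
    - by rewrite ub swpE // swkr.
  case/andP: sp => s /eqP kh.
  apply: (teq_swp evenN updown_sym (a := a) (c := c) (b := b)) => //.
  - exact: swp_inW1.
  - by rewrite swpE // swkl.
  - by rewrite swpE //= kh (swh_fix hB s) //; clear; lia.
  - by rewrite /= !ltnSn.
  - by rewrite ub swpE // swkr.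
case sp: (special k); last by rewrite mulg1.
case/andP: sp => s /eqP kh; rewrite mulgA; apply: teq_trans s1 _.
have h0 : 0 < h by move: (kN); rewrite (hB s) kh; clear; lia.
have kp : k.-1 < N by move: (kN); clear; lia.
(* After two letters the central positions carry the labels [k - 1] and [k + 2], and [b], which lies
   between these labels, comes earlier. *)
apply: (teq_swp evenN updown_sym (a := Ordinal kp) (c := c) (b := b)) => //.
- by apply: inWM; apply: swp_inW1.
- rewrite permM !swpE //= kh (swh_fix hB s) ?(swh1_pred hB) -?kh //; move: h0; rewrite kh; clear; lia.
- rewrite permM !swpE //= kh (swh_fix hB s) ?swkr -?kh //; move: h0; rewrite kh; clear; lia.
- by rewrite /=; clear; lia.
- by rewrite ub permM !swpE //= kh swkr (swh1_h hB) -?kh //; move: h0; rewrite kh; clear; lia.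
Qed.

Lemma teq_altdn k : h <= k -> k.+2 < N -> ~~ arrow k.+1 ->
  teq updown (swp evenN k.+1) (altdn k).
Proof.
move=> hk kN ar; have kN' := ltnW kN; rewrite /altdn.
pose a := Ordinal (ltnW kN'); pose b := Ordinal kN'; pose c := Ordinal kN.
have ub : updown b.+1 = false by rewrite updown_arrow //=; apply/negbTE.
case sp: (special k); last first.
  have h' := not_special hk sp; rewrite mulg1.
  apply: (teq_swp evenN updown_sym (a := a) (c := c) (b := b)) => //.
  - exact: swp_inW1.
  - by rewrite swpE //= sw_succ_fix.
  - by rewrite swpE // swkr.
  - by rewrite /= !ltnSn.
  - by rewrite ub swpE // swkl.
case/andP: sp => s /eqP kh; rewrite mulgA.
have h0 : 0 < h by move: (kN); rewrite (hB s) kh; clear; lia.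
have kp : k.-1 < N by move: (kN); clear; lia.
have hN : h.+2 < N by rewrite -kh.
apply: (@teq_trans _ _ (swp evenN k.+1 * swp evenN k)%g).
  apply: (teq_swp evenN updown_sym (a := Ordinal kp) (c := c) (b := b)) => //.
  - exact: swp_inW1.
  - by rewrite swpE //= kh (swh1_pred hB).
  - by rewrite swpE // swkr.
  - by rewrite /=; clear; lia.
  - by rewrite ub swpE // swkl.
have ua : updown a.+1.
  have -> : a = rev_ord b by apply: val_inj => /=; have Nh := hB s; clear -Nh kh; lia.
  by rewrite updown_sym // ub.
(* The witness for the last letter is [a], which is upper as the mirror image of [b]. *)
apply: (teq_swp evenN updown_sym (a := Ordinal kp) (c := b) (b := a)) => //.
- by apply: inWM; apply: swp_inW1.
- by rewrite permM !swpE //= kh (swh1_pred hB) // swkl.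
- by rewrite permM !swpE //= kh swkl (swh_fix hB s) //; clear; lia.
- by rewrite /=; move: h0; rewrite kh; clear; lia.
- by rewrite ua permM !swpE //= kh (swh1_h hB) // (swh_fix hB s) //; move: h0; clear; lia.
Qed.

Lemma gens_teq s t : o s t -> teq updown (phi t) (phi (alt t s (mcox s t).-1)).
Proof.
move=> st; have [k [hk kN [[-> -> ar]|[-> -> ar]]]] := edgeP st.
  by rewrite phi_altup // sgE //; [apply: teq_altup | apply: ltnW].
by rewrite phi_altdn // sgE //; [apply: teq_altdn | apply: leqW].
Qed.

Section Congruence.
Variable Th : 'S_N -> 'S_N -> Prop.
Hypothesis genTh : forall s t, o s t -> Th (phi t) (phi (alt t s (mcox s t).-1)).

Lemma Th_altup k : h <= k -> k.+2 < N -> arrow k.+1 -> Th (swp evenN k) (altup k).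
Proof.
move=> hk kN ar; have kN' := ltnW kN; rewrite -phi_altup // -sgE //.
by apply: genTh; case/and3P: ar.
Qed.

Lemma Th_altdn k : h <= k -> k.+2 < N -> ~~ arrow k.+1 -> Th (swp evenN k.+1) (altdn k).
Proof.
move=> hk kN ar; have kN' := leqW hk; rewrite -phi_altdn // -sgE //.
by apply: genTh; rewrite arrowN.
Qed.

Lemma gens_plain : ~~ sy -> h = 0 -> forall e : 'I_N, 0 < e -> e.+1 < N ->
  exists g g', [/\ Th g g',
  (forall i j : 'I_N, i < j -> g j < g i ->
    if updown e.+1 then (i.+1 == e) && (j == e :> nat) else (i == e :> nat) && (j == e.+1 :> nat)) &
  (forall i j : 'I_N, i.+1 = e -> j = e.+1 :> nat -> g' j < g' i)].
Proof.
move=> s hz e e0 eN; have he : h <= e.-1 by rewrite hz.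
have [k ek] : exists k, nat_of_ord e = k.+1 by exists e.-1; rewrite prednK.
rewrite ek in eN he *; rewrite /= in he; have kN' := ltnW eN.
rewrite updown_arrow //.
case ar: (arrow _).
  exists (swp evenN k), (altup k); split.
  - exact: Th_altup.
  - move=> i j ij; rewrite !swpE // swk_lt // (negbTE s) /= orbF; clear; lia.
  - by move=> i j [ik] jk; apply: altup_lt.
exists (swp evenN k.+1), (altdn k); split.
- by apply: Th_altdn; rewrite ?ar.
- move=> i j ij; rewrite !swpE // swk_lt // (negbTE s) /= orbF; clear; lia.
- by move=> i j [ik] jk; apply: altdn_lt.
Qed.

Lemma gens_sym : sy -> forall e : 'I_N, 0 < e -> e.+1 < N -> ~~ updown e.+1 ->
  exists g g', [/\ inW sy g, inW sy g', Th g g' &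
  [/\ forall i j : 'I_N, i < j -> g j < g i -> (i = e :> nat /\ j = e.+1 :> nat) \/
        (i = N - e.+2 :> nat /\ j = N - e.+1 :> nat),
      forall i j : 'I_N, i.+1 = e -> j = e.+1 :> nat -> g' j < g' i &
      forall i j : 'I_N, i.+1 = e -> e.+1 = N - e.+1 -> j = e.+2 :> nat -> g' j < g' i]].
Proof.
move=> s e e0 eN ue; have Nh := hB s.
have Walt (b : bool) x y : inW sy x -> inW sy y -> inW sy (x * (y * if b then x else 1))%g.
  by move=> Wx Wy; do 2!apply: inWM => //; case: b => //; apply: inW1.
case: (ltnP h e) => he.
  have [k ek] : exists k, nat_of_ord e = k.+1 by exists e.-1; rewrite prednK.
  rewrite ek in eN he ue *; have kN' := ltnW eN.
  rewrite updown_arrow // in ue.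
  exists (swp evenN k.+1), (altdn k); split.
  - exact: swp_inW1.
  - by apply: Walt; apply: swp_inW1.
  - exact: Th_altdn.
  split.
  - move=> i j ij; rewrite !swpE // swk_lt // => /orP[/andP[/eqP-> /eqP->]|/and3P[_ /eqP-> /eqP->]].
      by left.
    by right.
  - by move=> i j [ik] jk; apply: altdn_lt.
  - by move=> i j _ h1; move: he h1; clear -Nh; lia.
(* For [e] in the negative half, the generator is that of the mirror label [k + 1], which is upper;
   the required inversions are read off through the symmetry. *)
pose k := N - e.+2.
have hk : h <= k by move: he; rewrite /k; clear -Nh; lia.
have kN : k.+2 < N by move: eN e0; rewrite /k; clear; lia.
have kN' := ltnW kN.
have ar : arrow k.+1.
  move: ue; rewrite /updown s he (ltn_ord e) /= negbK.
  by have -> : N - e.+1 = k.+1 by move: eN; rewrite /k; clear; lia.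
have Wa : inW sy (altup k) by apply: Walt; apply: swp_inW1.
exists (swp evenN k), (altup k); split => //.
- exact: swp_inW1.
- exact: Th_altup.
have /symwP sa := implyP Wa s.
have lt' (i j : 'I_N) : i.+1 = e -> j = e.+1 :> nat -> altup k j < altup k i.
  move=> ie je; have := @altup_lt k (rev_ord j) (rev_ord i) hk kN.
  rewrite !sa /= => /(_ _ _)/wrap[]; last by clear; lia.
    by rewrite je.
  by rewrite /k -ie; move: eN; rewrite -ie; clear; lia.
split => //.
- move=> i j ij; rewrite !swpE // swk_lt // => /orP[/andP[/eqP-> /eqP->]|/and3P[_ /eqP-> /eqP->]].
    by right; rewrite /k; split => //; move: eN; clear; lia.
  by left; rewrite /k; split; move: eN; clear; lia.
move=> i j ie e2 je; have eh : nat_of_ord e = h by move: e2; clear -Nh; lia.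
have kh : k = h by rewrite /k; clear -Nh eh; lia.
have sp : special h by rewrite /special eqxx andbT.
have hN : h.+2 < N by rewrite -kh.
have ih : nat_of_ord i = h.-1 by rewrite -eh -ie.
have h0 : 0 < h by rewrite -eh.
rewrite /altup kh sp /= !permM !swpE ?je ?eh //; try exact: ltnW hN.
have f1 : sw h h.+2 = h.+2 by rewrite (swh_fix hB s) //; clear; lia.
have f2 : sw h h.-1 = h.-1 by rewrite (swh_fix hB s) //; move: h0; clear; lia.
by rewrite ih f1 f2 !swkr (swh1_pred hB s) // swkl.
Qed.
End Congruence.
End Generators.

(** * Types A and B *)

Section Functional.
Variables (R : realType) (n : nat).

Lemma dotp_delta (i : 'I_n) (x : 'rV[R]_n) : dotp (delta_mx 0%R i) x = x ord0 i.
Proof.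
rewrite /dotp (bigD1 i) //= big1 ?addr0; first by rewrite mxE !eqxx mul1r.
by move=> j ji; rewrite mxE (negbTE ji) andbF mul0r.
Qed.

Lemma dotpNl (a x : 'rV[R]_n) : (dotp (- a) x = - dotp a x)%R.
Proof. by rewrite /dotp -sumrN; apply: eq_bigr => i _; rewrite mxE mulNr. Qed.
End Functional.

Section TypeAInstance.
Variables (R : realType) (n : nat).
Hypothesis hn : 2 <= n.

Lemma evenA : false -> ~~ odd n. Proof. by []. Qed.

Lemma swpA_tperm k (k1 : k < n) (k2 : k.+1 < n) :
  swp evenA k = tperm (Ordinal k1) (Ordinal k2).
Proof.
apply/permP => i; apply: val_inj; rewrite /= swpE // /swk /=.
case: tpermP => [->|->|/eqP n1 /eqP n2] /=; rewrite ?eqxx //.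
  by case: eqP => // e; move: e; clear; lia.
by rewrite (negbTE n1 : (i == k :> nat) = false) (negbTE n2 : (i == k.+1 :> nat) = false).
Qed.

Lemma iso_typeA (o : rel {perm 'I_n}) : is_orientation (SA n) o ->
  poset_iso (@partial_tri (n + 2)) (@normal_fan_le (n + 2))
    (camb_fan_cone (WA n) (SA n) (@actA R n) (@baseA R n) o).
Proof.
move=> ho; have hB : false -> n = 1 + 1 by [].
have phiM (x y : 'S_n) : id (x * y)%g = (id x * id y)%g by [].
have WE (x : 'S_n) : (x \in WA n) = inW false (id x) by rewrite in_setT.
have sgS k : 0 <= k -> k.+1 < n -> swp evenA k \in SA n.
  move=> _ kn; rewrite in_set; apply/existsP; exists (Ordinal (ltnW kn)).
  by apply/existsP; exists (Ordinal kn); rewrite (swpA_tperm (ltnW kn) kn) /= !eqxx.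
have sgE k : 0 <= k -> k.+1 < n -> id (swp evenA k) = swp evenA k by [].
have S_sg s : s \in SA n -> exists k, [/\ 0 <= k, k.+1 < n & s = swp evenA k].
  rewrite in_set => /existsP[[i hi] /existsP[[j hj] /andP[/eqP /= e /eqP->]]]; subst j.
  by exists i; rewrite (swpA_tperm hi hj).
set sg := swp evenA in sgS sgE S_sg.
pose up := updown n 0 false sg o.
have up0 : up 0 = false := updown0 n 0 false sg o.
have upN : up n.+1 = false := updownN n 0 false sg o.
have ups : false -> forall i : 'I_n, up (rev_ord i).+1 = ~~ up i.+1 by [].
have phi_surj z : inW false z -> exists x : 'S_n, id x = z by move=> _; exists z.
have cambE x y : x \in WA n -> y \in WA n -> camb (WA n) (SA n) o x y <-> teq up x y.
  apply: (@camb_teq _ _ _ n false evenA id phiM (@inj_id _) phi_surj WE) => //.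
  - exact: S_swap sgE S_sg.
  - by move=> k; apply: (swap_S hB sgS sgE).
  - exact: (gens_W phiM WE sgE S_sg ho).
  - exact: (gens_teq hB phiM (@inj_id _) sgS sgE S_sg ho).
  move=> Th cTh gTh u a c e _; apply: (contractA cTh).
  exact: (gens_plain hB phiM (@inj_id _) sgS sgE ho gTh).
have [pos posE] := pos_exists n up.
apply: (@cambrian_fan_iso n false up up0 upN evenA ups _ _ _ id o phi_surj WE cambE R n _ _
  (fun y i => y ord0 i) (fun y => \sum_(i < n) y ord0 i = 0)%R _ _ _ _ _ _ _ _ _ _ pos posE) => //.
- by move=> x y i; rewrite mxE.
- by move=> k x i; rewrite mxE.
- move=> x y Vx Vy; rewrite (eq_bigr (fun i => x ord0 i + y ord0 i)%R).
    by rewrite big_split /= Vx Vy addr0.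
  by move=> i _; rewrite mxE.
- move=> k x Vx; rewrite (eq_bigr (fun i => k * x ord0 i)%R).
    by rewrite -mulr_sumr Vx mulr0.
  by move=> i _; rewrite mxE.
- move=> f f0 _; exists (\row_i f i)%R; split; last by move=> i; rewrite mxE.
  by rewrite -[RHS]f0; apply: eq_bigr => i _; rewrite mxE.
- move=> i j; exists (delta_mx 0 j - delta_mx 0 i)%R => y.
  by rewrite dotpDl dotpNl !dotp_delta.
- move=> w y _; split.
    case=> x [x0 xle] ->; split; last by move=> i j; rewrite !mxE; apply: xle.
    rewrite -[RHS]x0 [RHS](reindex_inj (@perm_inj _ w)); apply: eq_bigr => i _.
    by rewrite mxE.
  case=> y0 yle; exists (\row_k y ord0 (w^-1%g k))%R.
    split.
      rewrite -[RHS]y0 [RHS](reindex_inj (@perm_inj _ w^-1%g)); apply: eq_bigr => i _.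
      by rewrite mxE.
    by move=> i j ij; rewrite !mxE; apply: yle; rewrite !permKV.
  by apply/rowP => j; rewrite !mxE permK.
by move=> T; split=> [h|[]] //; split.
Qed.
End TypeAInstance.

(** * Signed permutations as symmetric permutations of the labels *)

Section TypeBInstance.
Variables (R : realType) (n : nat).
Hypothesis hn : 2 <= n.
Local Notation N := (2 * n).
Implicit Types (u v : 'I_N) (x : 'I_n * bool) (w : {perm 'I_n * bool}) (z : 'S_N).

Lemma evenB : true -> ~~ odd N.
Proof. by rewrite oddM. Qed.

Definition slab_nat x : nat := if x.2 then n - x.1.+1 else n + x.1.

Lemma slab_bound x : slab_nat x < N.
Proof. by rewrite /slab_nat; have := ltn_ord x.1; case: x.2; clear; lia. Qed.

(* Sends the signed letter [i] to the label [n + i] and [-i] to [n - 1 - i], so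
   that the order of labels is that of the signed letters. *)
Definition slab x : 'I_N := Ordinal (slab_bound x).

Lemma slab_neg x : slab (negT x) = rev_ord (slab x).
Proof.
by apply: val_inj; rewrite /= /slab_nat /=; have := ltn_ord x.1; case: x.2 => /=; clear; lia.
Qed.

Lemma unslab_bound (v : nat) : v < N -> (if v < n then n - v.+1 else v - n) < n.
Proof. by move=> vN; case: ifP; move: vN; clear; lia. Qed.

Definition unslab v : 'I_n * bool := (Ordinal (unslab_bound (ltn_ord v)), v < n).

Lemma slabK : cancel slab unslab.
Proof.
move=> [i b]; rewrite /unslab; congr (_, _).
  by apply: val_inj; rewrite /= /slab_nat; case: ifP; have := ltn_ord i; case: b => /=; clear; lia.
by rewrite /= /slab_nat; have := ltn_ord i; case: b => /=; clear; lia.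
Qed.

Lemma unslabK : cancel unslab slab.
Proof.
move=> v; apply: val_inj; rewrite /= /slab_nat /=; have := ltn_ord v.
by case: (ltnP v n) => /=; clear; lia.
Qed.

Lemma sconj_inj w : injective (fun v => slab (w (unslab v))).
Proof. by move=> u v /(can_inj slabK)/perm_inj/(can_inj unslabK). Qed.

Definition sconj w : 'S_N := perm (@sconj_inj w).

Lemma sconjE w v : sconj w v = slab (w (unslab v)). Proof. by rewrite permE. Qed.

Lemma unconj_inj z : injective (fun x => unslab (z (slab x))).
Proof. by move=> x y /(can_inj unslabK)/perm_inj/(can_inj slabK). Qed.

Definition unconj z : {perm 'I_n * bool} := perm (@unconj_inj z).

Lemma unconjK : cancel unconj sconj.
Proof. by move=> z; apply/permP => v; rewrite sconjE permE !unslabK. Qed.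

Lemma sconjM w w' : sconj (w * w')%g = (sconj w * sconj w')%g.
Proof. by apply/permP => v; rewrite permM !sconjE slabK permM. Qed.

Lemma sconj_injective : injective sconj.
Proof.
move=> w w' /permP h; apply/permP => x; have := h (slab x).
by rewrite !sconjE slabK => /(can_inj slabK).
Qed.

Lemma sconj_tperm x y : sconj (tperm x y) = tperm (slab x) (slab y).
Proof. by apply/permP => v; rewrite sconjE -[in RHS](unslabK v) (inj_tperm _ _ _ (can_inj slabK)). Qed.

Lemma WB_sym w : (w \in WB n) = inW true (sconj w).
Proof.
rewrite in_set; apply/forallP/symwP => [h v|h x].
  by rewrite !sconjE -slab_neg -(eqP (h _)) -[v in LHS]unslabK -slab_neg slabK.
apply/eqP/(can_inj slabK); have := h (slab x).
by rewrite -slab_neg !sconjE !slabK slab_neg.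
Qed.

Lemma swp0_sconj (i0 : 'I_n) : i0 = 0 :> nat ->
  sconj (tperm (i0, false) (i0, true)) = swp evenB n.-1.
Proof.
move=> e; rewrite sconj_tperm; apply/permP => v; apply: val_inj.
have kN : n.-1.+1 < N by move: hn; clear; lia.
rewrite /= swpE //; case: tpermP => [->|->|/eqP n1 /eqP n2].
- have := swkr N true n.-1; rewrite prednK; last exact: ltnW.
  by rewrite /= /slab_nat /= e addn0 subn1 => ->.
- by rewrite /= /slab_nat /= e addn0 subn1 swkl prednK // ltnW.
rewrite (@swk_other _ true) //; move: n1 n2; rewrite -!val_eqE /= /slab_nat /= e; move: hn; clear; lia.
Qed.

Lemma swpS_sconj (i j : 'I_n) : j = i.+1 :> nat ->
  sconj (tperm (i, false) (j, false) * tperm (i, true) (j, true)) = swp evenB (n + i).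
Proof.
move=> e; rewrite sconjM !sconj_tperm; apply/permP => v; apply: val_inj.
have jn := ltn_ord j; have kN : (n + i).+1 < N by move: jn; rewrite e; clear; lia.
rewrite /= permM swpE //; have vN := ltn_ord v.
rewrite /swk /= !permE /= -!val_eqE /= /slab_nat /=.
have N2 : N = n + n by rewrite mul2n addnn.
have -> : (n + i).+1 = n + j by rewrite e addnS.
have -> : N - (n + j) = n - j by rewrite N2 subnDl.
have -> : N - (n + j).+1 = n - j.+1 by rewrite N2 -addnS subnDl.
have -> : n - j = n - i.+1 by rewrite e.
have ni : (n + j == n - i.+1) = false by move: jn; clear; lia.
have nj : (n + j == n - j.+1) = false by move: jn; clear; lia.
have mi : (n + i == n - i.+1) = false by move: jn; clear; lia.
have mj : (n + i == n - j.+1) = false by move: jn; clear; lia.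
case: (eqVneq (v : nat) (n + i)) => h1; first by rewrite /= /slab_nat /= ni nj.
case: (eqVneq (v : nat) (n + j)) => h2; first by rewrite /= /slab_nat /= mi mj.
by case: ifP => // _; case: ifP.
Qed.

Lemma SB_swp s : s \in SB n -> exists k, [/\ n.-1 <= k, k.+1 < N & s = unconj (swp evenB k)].
Proof.
have un w : w = unconj (sconj w) by apply: sconj_injective; rewrite unconjK.
case/setUP; rewrite in_set => /existsP[i].
  case/andP => /eqP i0 /eqP es; exists n.-1; split => //; first by move: hn; clear; lia.
  by rewrite [LHS]un es swp0_sconj.
case/existsP => j /andP[/eqP ij /eqP es]; exists (n + i); split.
- by clear; lia.
- by have := ltn_ord j; rewrite ij; clear; lia.
by rewrite [LHS]un es swpS_sconj.
Qed.

Lemma swp_SB k : n.-1 <= k -> k.+1 < N -> unconj (swp evenB k) \in SB n.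
Proof.
have un w : unconj (sconj w) = w by apply: sconj_injective; rewrite unconjK.
move=> hk kN; case: (ltnP k n) => kn.
  have -> : k = n.-1 by move: hk kn; clear; lia.
  have n0 : 0 < n by apply: ltnW.
  rewrite -(@swp0_sconj (Ordinal n0)) // un; apply/setUP; left.
  by rewrite in_set; apply/existsP; exists (Ordinal n0); rewrite !eqxx.
have i1 : k - n < n by move: kN; clear -kn; lia.
have i2 : (k - n).+1 < n by move: kN; clear -kn; lia.
have -> : k = n + Ordinal i1 by rewrite /= subnKC.
rewrite -(@swpS_sconj (Ordinal i1) (Ordinal i2)) // un; apply/setUP; right.
rewrite in_set; apply/existsP; exists (Ordinal i1); apply/existsP; exists (Ordinal i2).
by rewrite !eqxx.
Qed.

Implicit Types (y : 'rV[R]_n).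

Definition scoord y x : R := if x.2 then (- y ord0 x.1)%R else y ord0 x.1.

Lemma scoord_neg y x : scoord y (negT x) = (- scoord y x)%R.
Proof. by case: x => i [] /=; rewrite /scoord /= ?opprK. Qed.

Lemma actB_scoord w y x : w \in WB n -> scoord (actB w y) x = scoord y (w x).
Proof.
rewrite in_set => /forallP h; case: x => i [].
  have -> : (i, true) = negT (i, false) by [].
  by rewrite (eqP (h _)) !scoord_neg {1}/scoord /= mxE.
by rewrite {1}/scoord /= mxE.
Qed.

Lemma scoord_mono (y : 'rV[R]_n) : baseB y <-> forall u v, u <= v ->
  (scoord y (unslab u) <= scoord y (unslab v))%R.
Proof.
split=> [[y0 yle] u v uv|h].
  have n0 : 0 < n by apply: ltnW.
  have pos i : (0 <= y ord0 i)%R by apply: le_trans (y0 (Ordinal n0) _) (yle _ _ _).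
  have eu : nat_of_ord (unslab u).1 = if u < n then n - u.+1 else u - n by [].
  have ev : nat_of_ord (unslab v).1 = if v < n then n - v.+1 else v - n by [].
  rewrite /scoord -[(unslab u).2]/(u < n)%N -[(unslab v).2]/(v < n)%N.
  move: (unslab u).1 (unslab v).1 eu ev => i j.
  case: (ltnP u n) => un; case: (ltnP v n) => vn /= ei ej.
  - by rewrite lerN2; apply: yle; rewrite ei ej; move: uv; clear; lia.
  - by apply: (@le_trans _ _ 0%R); rewrite ?oppr_le0.
  - by move: uv un vn; clear; lia.
  - by apply: yle; rewrite ei ej leq_sub2r.
split=> [i /eqP i0|i j ij].
  have le : slab (i, true) <= slab (i, false) by rewrite /= /slab_nat /=; clear; lia.
  have := h _ _ le; rewrite !slabK /scoord /= => le0.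
  rewrite leNgt; apply/negP => lt0; move: le0.
  by rewrite leNgt (lt_trans lt0) ?oppr_gt0.
have := h (slab (i, false)) (slab (j, false)); rewrite !slabK /scoord /=; apply.
by rewrite /slab_nat /= leq_add2l.
Qed.

Lemma iso_typeB (o : rel {perm 'I_n * bool}) : is_orientation (SB n) o ->
  poset_iso (@cs_partial_tri (2 * n + 2)) (@normal_fan_le (2 * n + 2))
    (camb_fan_cone (WB n) (SB n) (@actB R n) (@baseB R n) o).
Proof.
move=> ho; have n0 : 0 < n := ltnW hn.
have hB : true -> N = n.-1.+1 + n.-1.+1 by rewrite prednK // addnn mul2n.
pose sg k := unconj (swp evenB k).
have sgE k : n.-1 <= k -> k.+1 < N -> sconj (sg k) = swp evenB k by rewrite unconjK.
pose up := updown N n.-1 true sg o.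
have up0 : up 0 = false := updown0 N n.-1 true sg o.
have upN : up N.+1 = false := updownN N n.-1 true sg o.
have ups : true -> forall v, up (rev_ord v).+1 = ~~ up v.+1 := updown_sym hB sg o.
have phi_surj z : inW true z -> exists w, sconj w = z by exists (unconj z); rewrite unconjK.
have cambE w w' : w \in WB n -> w' \in WB n ->
    camb (WB n) (SB n) o w w' <-> teq up (sconj w) (sconj w').
  apply: (@camb_teq _ _ _ N true evenB sconj sconjM sconj_injective phi_surj WB_sym) => //.
  - exact: S_swap sgE SB_swp.
  - by move=> k; apply: (swap_S hB swp_SB sgE).
  - exact: (gens_W sconjM WB_sym sgE SB_swp ho).
  - exact: (gens_teq hB sconjM sconj_injective swp_SB sgE SB_swp ho).
  move=> Th cTh gTh u a c e; apply: (contractB (n := n) _ cTh) => //.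
  - by rewrite mul2n addnn.
  - exact: ups.
  - exact: (gens_sym hB sconjM sconj_injective swp_SB sgE ho gTh).
have [pos posE] := pos_exists N up.
apply: (@cambrian_fan_iso N true up up0 upN evenB ups _ _ _ sconj o phi_surj WB_sym cambE R n _ _
  (fun y v => scoord y (unslab v)) (fun _ => True) _ _ _ _ _ _ _ _ _ _ pos posE) => //.
- by move=> x y v; rewrite /scoord !mxE; case: ifP => _ //; rewrite opprD.
- by move=> k x v; rewrite /scoord !mxE; case: ifP => _ //; rewrite mulrN.
- by move=> _ y v; rewrite -scoord_neg -[in LHS](unslabK v) -slab_neg slabK.
- move=> f _ /(_ isT) fs; exists (\row_i f (slab (i, false)))%R; split => // v.
  rewrite -[in RHS](unslabK v); case: (unslab v) => i []; rewrite /scoord /= mxE //.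
  by rewrite -fs -slab_neg.
- have coord v : exists a : 'rV[R]_n, forall y, dotp a y = scoord y (unslab v).
    case: (unslab v) => i [].
      by exists (- delta_mx 0 i)%R => y; rewrite dotpNl dotp_delta.
    by exists (delta_mx 0 i)%R => y; rewrite dotp_delta.
  move=> u v; have [a ha] := coord u; have [b hb] := coord v.
  by exists (b - a)%R => y; rewrite dotpDl dotpNl ha hb.
- move=> w y wW; split.
    case=> x /scoord_mono xle ->; split => // u v uv; rewrite !actB_scoord //.
    by have := xle _ _ uv; rewrite !sconjE !slabK.
  case=> _ yle; have WV : (w^-1)%g \in WB n.
    move: wW; rewrite !WB_sym => /inWV; congr (is_true (inW true _)).
    by apply/esym/eqP; rewrite eq_sym eq_invg_mul -sconjM mulgV; apply/eqP/permP => v; rewrite sconjE !perm1 unslabK.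
  have act1 : actB w (actB w^-1%g y) = y.
    apply/rowP => j; have := actB_scoord (actB w^-1%g y) (j, false) wW.
    by rewrite (actB_scoord _ _ WV) permK.
  exists (actB w^-1%g y); last by rewrite act1.
  apply/scoord_mono => u v uv; rewrite !actB_scoord //.
  have E t : (w^-1%g (unslab t)) = unslab ((sconj w)^-1%g t).
    apply: (@perm_inj _ w); rewrite permKV; apply: (can_inj slabK).
    by rewrite -sconjE permKV unslabK.
  by rewrite !E; apply: yle; rewrite !permKV.
- by move=> T; split=> -[h1 h2]; split => //; apply: h2.
Qed.
End TypeBInstance.

Theorem theorem1p3 (R : realType) (n : nat) (hn : 2 <= n) :
  (forall o : rel {perm 'I_n},
     is_orientation (SA n) o ->
     poset_iso (@partial_tri (n + 2)) (@normal_fan_le (n + 2))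
       (camb_fan_cone (WA n) (SA n) (@actA R n) (@baseA R n) o)) /\
  (forall o : rel {perm 'I_n * bool},
     is_orientation (SB n) o ->
     poset_iso (@cs_partial_tri (2 * n + 2)) (@normal_fan_le (2 * n + 2))
       (camb_fan_cone (WB n) (SB n) (@actB R n) (@baseB R n) o)).
Proof. by split=> o ho; [apply: iso_typeA | apply: iso_typeB]. Qed.
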